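(* For every hyperbolic once-punctured torus bundle $M_\varphi$ over $S^1$, with its canonical (monodromy) ideal triangulation $\mathcal{T}_\varphi$ and the epimorphism $\alpha:\pi_1(M_\varphi)\twoheadrightarrow\mathbb{Z}$ induced by the projection $M_\varphi\to S^1$, the twisted 1-loop invariant $\tau^{\mathrm{CS}}(\mathcal{T}_\varphi,t)$ is equal to the adjoint twisted Alexander polynomial $\tau(M_\varphi,t)$ of $M_\varphi$ (both being well-defined up to multiplication by units $\pm t^k$, $k\in\mathbb{Z}$, of $\mathbb{Z}[t^{\pm1}]$).
   Context: **Bundles and canonical triangulation.** Let $F=(\mathbb{R}^2\setminus\mathbb{Z}^2)/\mathbb{Z}^2$ be the once-punctured torus, with mapping class group identified with $\mathrm{SL}_2(\mathbb{Z})$. For $\varphi\in\mathrm{SL}_2(\mathbb{Z})$, $M_\varphi=F\times[0,1]/\!\sim$ is the $F$-bundle over $S^1$ with monodromy $\varphi$. It is hyperbolic when $\varphi$ has distinct real eigenvalues; then, up to conjugation, $\varphi=\varepsilon R^{s_1}L^{t_1}\cdots R^{s_n}L^{t_n}$ with $\varepsilon\in\{\pm1\}$, $n\ge1$, $s_i,t_i\ge 1$, $R=\begin{pmatrix}1&1\\0&1\end{pmatrix}$, $L=\begin{pmatrix}1&0\\1&1\end{pmatrix}$. Let $N=\sum_i(s_i+t_i)$, let $\varphi_i\in\{R,L\}$ ($1\le i\le N$) be the $i$-th letter of the word, and extend $N$-periodically to $i\in\mathbb{Z}$. Define bases $(h_i,v_i)$ of $\mathbb{Z}^2$, $i\in\mathbb{Z}$,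 by $h_0=(1,0)$, $v_0=(0,1)$ and $(h_i,v_i)=(h_{i-1},h_{i-1}+v_{i-1})$ if $\varphi_{i-1}=R$, $(h_i,v_i)=(h_{i-1}+v_{i-1},v_{i-1})$ if $\varphi_{i-1}=L$; put $d_i=h_i+v_i$. Let $\tau_i$ be the ideal triangulation of $F$ by two triangles whose edges are straight with directions $h_i,v_i,d_i$. Then $\tau_i$ is obtained from $\tau_{i-1}$ by one diagonal exchange (the edge $v_{i-1}$ if $\varphi_{i-1}=R$, resp. $h_{i-1}$ if $\varphi_{i-1}=L$, is replaced by $d_i$); let $\widetilde\Delta_i$ be the ideal tetrahedron whose two bottom faces are the triangles of $\tau_{i-1}$ and whose two top faces are those of $\tau_i$. Stacking all $\widetilde\Delta_i$, $i\in\mathbb{Z}$, gives an ideal triangulation of $F\times\mathbb{R}$. The linear map sending $(h_0,v_0)$ to $(\varepsilon h_N,\varepsilon v_N)$ induces a simplicial automorphism $g$ with $g\widetilde\Delta_i=\widetilde\Delta_{i+N}$, and the quotient by $\langle g\rangle$ is $M_\varphi$ with its canonical triangulation $\mathcal{T}_\varphi$, having $N$ tetrahedra. **Twisted 1-loop invariant.** Let $M$ be a 1-cusped (oriented) hyperbolic 3-manifold with an epimorphism $\alpha:\pi_1(M)\twoheadrightarrow\mathbb{Z}$ and an ideal triangulation $\mathcal{T}$ with edges $e_1,\dots,e_N$ and tetrahedra $\Delta_1,\dots,\Delta_N$. Let $\widetilde M$ be the infinite cyclic cover corresponding to $\ker\alpha$, with lifted triangulation $\widetilde{\mathcal{T}}$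 and generator $g$ of the deck group $\mathbb{Z}$. Choose a fundamental domain, giving lifts $\widetilde e_i,\widetilde\Delta_j$. Choose for each $\Delta_j$ a pair of opposite edges (quad type); assign $z_j$ to that pair and $z_j'=\frac1{1-z_j}$, $z_j''=1-\frac1{z_j}$ to the other two pairs of opposite edges, in the cyclic order around each ideal vertex determined by the orientation (the usual cross-ratio convention), $z_j\in\mathbb{C}\setminus\{0,1\}$. For $\square\in\{\ ,{}',{}''\}$, $\mathbf{G}^\square_k$ ($k\in\mathbb{Z}$) is the $N\times N$ matrix whose $(i,j)$-entry is the number of edges of $g^k\widetilde\Delta_j$ with parameter $z_j^\square$ incident to $\widetilde e_i$; $\mathbf{G}^\square(t)=\sum_k\mathbf{G}^\square_kt^k$ and $\mathbf{G}^\square=\mathbf{G}^\square(1)$. The gluing equation of $e_i$ is $\prod_jz_j^{\mathbf{G}_{ij}}z_j'^{\mathbf{G}'_{ij}}z_j''^{\mathbf{G}''_{ij}}=1$. Each peripheral curve $\gamma$ (oriented, homotopically non-trivial simple closed curve in the peripheral torus) has row vectors $\mathbf{C}_\gamma^\square\in\mathbb{Z}^N$ such that its completeness (holonomy) equation is $\prod_jz_j^{\mathbf{C}_{\gamma j}}z_j'^{\mathbf{C}'_{\gamma j}}z_j''^{\mathbf{C}''_{\gamma j}}=1$. A solution of $\mathcal{T}$ is a point $(z_1,\dots,z_N)$ satisfying all gluing and completeness equations; it is geometric if its holonomy is the geometric representation $\pi_1(M)\to\mathrm{PSL}_2(\mathbb{C})$. A geometric solution is assumed to exist. A combinatorial flattening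 is a triple $f,f',f''\in\mathbb{Z}^N$ with $f+f'+f''=(1,\dots,1)^T$, $\mathbf{G}f+\mathbf{G}'f'+\mathbf{G}''f''=(2,\dots,2)^T$ and $\mathbf{C}_\gamma f+\mathbf{C}_\gamma'f'+\mathbf{C}_\gamma''f''=0$ for all $\gamma$; one always exists. With $\zeta_j=\frac1{z_j}$, $\zeta_j'=\frac1{1-z_j}$, $\zeta_j''=\frac1{z_j(z_j-1)}$, the twisted 1-loop invariant is $$\tau^{\mathrm{CS}}(\mathcal{T},t)=\frac{\det\big(\mathbf{G}(t)\mathrm{diag}(\zeta)+\mathbf{G}'(t)\mathrm{diag}(\zeta')+\mathbf{G}''(t)\mathrm{diag}(\zeta'')\big)}{\prod_{j=1}^N\zeta_j^{f_j}\zeta_j'^{f_j'}\zeta_j''^{f_j''}}\in\mathbb{C}[t^{\pm1}]$$ evaluated at the geometric solution; it is well-defined up to units $\pm t^k$. **Adjoint twisted Alexander polynomial.** Let $\rho:\pi_1(M)\to\mathrm{SL}_2(\mathbb{C})$ be a lift of the geometric representation. Let $\pi_1(M)$ act on $\mathfrak{sl}_2(\mathbb{C})\otimes\mathbb{C}(t)$ by $\gamma\mapsto\mathrm{Ad}\rho(\gamma)\otimes t^{\alpha(\gamma)}$. The corresponding twisted cellular chain complex of (the compact core of) $M$ is acyclic, and $\tau(M,t)$ is its Reidemeister torsion, normalized as $\prod_i[\partial(b_{i+1})\,b_i/c_i]^{(-1)^{i+1}}$ where $c_i$ are the geometric bases and $b_i\subset C_i$ are lifts of bases of the images of $\partial:C_i\to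 C_{i-1}$; it is well-defined up to $\pm t^k$. *)

(* Defs.v *)
From HB Require Import structures.
From mathcomp Require Import all_boot all_order all_algebra.
From mathcomp Require Import complex.
From mathcomp Require Import classical_sets fsbigop reals.

Set Implicit Arguments.
Unset Strict Implicit.
Unset Printing Implicit Defensive.

Import Order.TTheory GRing.Theory Num.Theory.
Local Open Scope ring_scope.

Inductive letter := LetR | LetL.

Definition word_of (st : seq (nat * nat)) : seq letter :=
  flatten [seq nseq p.1 LetR ++ nseq p.2 LetL | p <- st].

(* Letters are numbered from 1 to N, then N-periodically; so letter 0 is
   letter N. *)
Definition letter_at (w : seq letter) (i : int) : letter :=
  nth LetR w `|((i - 1) %% (size w)%:Z)%Z|%N.

Definition vec : Type := (int * int)%type.

Definition frame_next (l : letter) (b : vec * vec) : vec * vec :=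
  if l is LetR then (b.1, b.1 + b.2) else (b.1 + b.2, b.2).

Definition frame_prev (l : letter) (b : vec * vec) : vec * vec :=
  if l is LetR then (b.1, b.2 - b.1) else (b.1 - b.2, b.2).

Definition frame0 : vec * vec := ((1, 0), (0, 1)).

Fixpoint frame_pos (w : seq letter) (n : nat) : vec * vec :=
  if n is m.+1 then frame_next (letter_at w m%:Z) (frame_pos w m) else frame0.

Fixpoint frame_neg (w : seq letter) (n : nat) : vec * vec :=
  if n is m.+1 then frame_prev (letter_at w (- n%:Z)) (frame_neg w m)
  else frame0.

Definition frame (w : seq letter) (i : int) : vec * vec :=
  match i with Posz n => frame_pos w n | Negz n => frame_neg w n.+1 end.

Definition hvec (w : seq letter) (i : int) : vec := (frame w i).1.
Definition vvec (w : seq letter) (i : int) : vec := (frame w i).2.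
Definition dvec (w : seq letter) (i : int) : vec := hvec w i + vvec w i.

(* The tetrahedron of index i lifts to the parallelogram with corners
   0, h_i, d_i, v_i: its four sides are the edges common to tau_(i-1) and
   tau_i, its upper diagonal is d_i, and its lower diagonal h_i - v_i is, up to
   sign, the edge of tau_(i-1) that is exchanged.  The pairs of opposite edges
   are labelled 0 (sides h_i), 1 (diagonals), 2 (sides v_i); with the product
   orientation of R^2 x R this is the counterclockwise order in which they are
   seen from each ideal vertex. *)
Definition tet_edges (w : seq letter) (i : int) (p : 'Z_3) : seq vec :=
  nth [::] [:: [:: hvec w i; hvec w i];
               [:: dvec w i; hvec w i - vvec w i];
               [:: vvec w i; vvec w i]] p.

(* There is exactly one edge of F x R for each slope, and every slope that
   occurs is that of d_i for exactly one i. *)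
Definition same_slope (u v : vec) : bool := (u == v) || (u == - v).

(* In all that follows, [neg] says that epsilon = -1. *)
Section Triangulation.
Variables (w : seq letter) (neg : bool).
Notation N := (size w).

(* A choice of quad types, and of lifts: the lift of the edge e_i is the edge
   of slope d_(i + N * le i), the lift of Delta_j is the tetrahedron of index
   j + N * lt j. *)
Variables (q : 'I_N -> 'Z_3) (le lt : 'I_N -> int).

(* The index sq : 'Z_3 stands for the decoration: 0 for z, 1 for z', 2 for
   z''.  The pair q j carries z_j, the next ones (counterclockwise) z_j' and
   z_j''. *)
Definition Gk (sq : 'Z_3) (k : int) : 'M[nat]_N :=
  \matrix_(i, j)
    count (same_slope (dvec w (i%:Z + N%:Z * le i)))
          (tet_edges w (j%:Z + N%:Z * (lt j + k)) (sq + q j)).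

Definition G1 (sq : 'Z_3) : 'M[int]_N :=
  \matrix_(i, j) \sum_(k \in [set: int]%classic) (Gk sq k i j)%:Z.

(* Universal cover of the cusp triangulation.  The triangle (i, n) is a lift of
   the link of the corner number n mod 4 of the tetrahedron of index i, the
   corners 0, h_i, d_i, v_i being numbered 0, 1, 2, 3; for n fixed, the
   triangles (i, n) form a strip transverse to the fibres.  The vertices of a
   triangle are edges of the tetrahedron directed away from the corner; they
   are listed counterclockwise, as seen from the cusp, according to the
   labels of [tet_edges]. *)
Definition cusp_vertex (t : int * int) (p : 'Z_3) : vec :=
  let h := hvec w t.1 in let v := vvec w t.1 in
  let c := `|(t.2 %% 4)%Z|%N in
  let x := nth 0 (if odd c then [:: - h; v - h; v] else [:: h; h + v; v]) p in
  if (c < 2)%N then x else - x.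

(* Deck transformation g^m l^n of the universal cover of the cusp, l being the
   boundary of the fibre; when epsilon = -1, g exchanges opposite corners. *)
Definition cusp_deck (m n : int) (t : int * int) : int * int :=
  (t.1 + N%:Z * m, t.2 + (if neg then 2 else 0) * m + 4 * n).

(* Normal arc (t, k, left) in the triangle t, entering through the side with
   vertex k on its left and vertex k + 1 on its right, and turning left around
   vertex k or right around vertex k + 1. *)
Definition arc : Type := (int * int * 'Z_3 * bool)%type.

Definition arc_tri (s : arc) : int * int := s.1.1.

Definition arc_pivot (s : arc) : 'Z_3 := if s.2 then s.1.2 else s.1.2 + 1.

Definition arc_enter (s : arc) : vec * vec :=
  (cusp_vertex (arc_tri s) s.1.2, cusp_vertex (arc_tri s) (s.1.2 + 1)).

Definition arc_exit (s : arc) : vec * vec :=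
  if s.2 then (cusp_vertex (arc_tri s) s.1.2, cusp_vertex (arc_tri s) (s.1.2 + 2))
  else (cusp_vertex (arc_tri s) (s.1.2 + 2), cusp_vertex (arc_tri s) (s.1.2 + 1)).

Definition arc_next (s s' : arc) : bool :=
  (arc_exit s == arc_enter s') &&
  (`|(arc_tri s).2 - (arc_tri s').2| <= 1).

(* A period of a normal line in the universal cover of the cusp, invariant
   under a primitive element g^m l^n, and visiting no triangle twice.  Every
   nontrivial simple closed curve is isotopic to the projection of such a line;
   the last two conditions exclude the curves with nonzero rotation number,
   such as small loops around a vertex. *)
Definition peripheral_curve (c : seq arc) : Prop :=
  exists m n : int,
    [/\ coprimez m n,
        exists s0 s1, c = s0 :: s1 /\
          path arc_next s0 (rcons s1 (cusp_deck m n s0.1.1, s0.1.2, s0.2)),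
        uniq [seq arc_tri s | s <- c] &
        forall (e : int) (s s' : arc), s \in c -> s' \in c ->
          arc_tri s' = cusp_deck (e * m) (e * n) (arc_tri s) -> e = 0].

Definition Crow (c : seq arc) (sq : 'Z_3) (j : 'I_N) : int :=
  \sum_(s <- c | (((arc_tri s).1 %% N%:Z)%Z == j%:Z) &&
                 (arc_pivot s == sq + q j)) (if s.2 then 1 else -1).

Definition shape_param (C : fieldType) (z : C) (sq : 'Z_3) : C :=
  nth 0 [:: z; (1 - z)^-1; 1 - z^-1] sq.

Definition zeta (C : fieldType) (z : C) (sq : 'Z_3) : C :=
  nth 0 [:: z^-1; (1 - z)^-1; (z * (z - 1))^-1] sq.

Definition is_solution (C : fieldType) (z : 'I_N -> C) : Prop :=
  [/\ forall j, z j != 0 /\ z j != 1,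
      forall i, \prod_j \prod_(sq : 'Z_3) shape_param (z j) sq ^ (G1 sq i j) = 1 &
      forall c, peripheral_curve c ->
        \prod_j \prod_(sq : 'Z_3) shape_param (z j) sq ^ (Crow c sq j) = 1].

Definition is_flattening (f : 'Z_3 -> 'I_N -> int) : Prop :=
  [/\ forall j, \sum_sq f sq j = 1,
      forall i, \sum_j \sum_sq G1 sq i j * f sq j = 2 &
      forall c, peripheral_curve c -> \sum_j \sum_sq Crow c sq j * f sq j = 0].

End Triangulation.

Definition ratfrac (C : fieldType) : fieldType := {fraction {poly C}}.

Definition tvar (C : fieldType) : ratfrac C := tofrac 'X.
Definition cst (C : fieldType) (c : C) : ratfrac C := tofrac c%:P.

Definition Gt (C : fieldType) (w : seq letter) (q : 'I_(size w) -> 'Z_3)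
    (le lt : 'I_(size w) -> int) (sq : 'Z_3) : 'M[ratfrac C]_(size w) :=
  \matrix_(i, j)
    \sum_(k \in [set: int]%classic) (Gk q le lt sq k i j)%:R * tvar C ^ k.

Definition tauCS (C : fieldType) (w : seq letter) (q : 'I_(size w) -> 'Z_3)
    (le lt : 'I_(size w) -> int) (z : 'I_(size w) -> C)
    (f : 'Z_3 -> 'I_(size w) -> int) : ratfrac C :=
  \det (\sum_(sq : 'Z_3)
          Gt C q le lt sq *m diag_mx (\row_j cst (zeta (z j) sq)))
  / cst (\prod_j \prod_(sq : 'Z_3) zeta (z j) sq ^ f sq j).

(* Words in the generators a, b (fibre) and s (deck transformation g), numbered
   0, 1, 2; the boolean [true] marks an inverse. *)
Definition gword : Type := seq ('I_3 * bool).

Definition gen (x : 'I_3) : gword := [:: (x, false)].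
Definition ga : 'I_3 := @Ordinal 3 0 isT.
Definition gb : 'I_3 := @Ordinal 3 1 isT.
Definition gs : 'I_3 := @Ordinal 3 2 isT.

Definition gw_inv (u : gword) : gword := rev [seq (x.1, ~~ x.2) | x <- u].

(* Lifts (alpha_i, beta_i) to the free group pi_1(F) = <a, b> of the basis
   (h_i, v_i): if V is the lift, fixed by a^-1 b^-1 a b, of the corner 0 of the
   parallelogram, then V, alpha_i V, beta_i V and
   alpha_i beta_i V = beta_i alpha_i V are the vertices of a lift of the
   tetrahedron of index i, and alpha_i, beta_i pair the opposite sides of the
   parallelogram.  The commutator a^-1 b^-1 a b does not change with i. *)
Fixpoint pi1_frame (w : seq letter) (n : nat) : gword * gword :=
  if n is m.+1 then
    let: (al, be) := pi1_frame w m in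
    if letter_at w m%:Z is LetR then (al, al ++ be) else (be ++ al, be)
  else (gen ga, gen gb).

(* Images of a and b under the automorphism of pi_1(F) induced by the linear
   map (h_0, v_0) |-> (epsilon h_N, epsilon v_N). *)
Definition monodromy (w : seq letter) (neg : bool) : gword * gword :=
  let: (al, be) := pi1_frame w (size w) in
  if neg then (gw_inv al, gw_inv be) else (al, be).

(* pi_1(M_phi) = < a, b, s | s a s^-1 = phi(a), s b s^-1 = phi(b) > *)
Definition relator_a (w : seq letter) (neg : bool) : gword :=
  gen gs ++ gen ga ++ gw_inv (gen gs) ++ gw_inv (monodromy w neg).1.
Definition relator_b (w : seq letter) (neg : bool) : gword :=
  gen gs ++ gen gb ++ gw_inv (gen gs) ++ gw_inv (monodromy w neg).2.

Inductive pi1_eq (w : seq letter) (neg : bool) : gword -> gword -> Prop :=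
| pi1_refl u : pi1_eq w neg u u
| pi1_sym u v : pi1_eq w neg u v -> pi1_eq w neg v u
| pi1_trans u v x : pi1_eq w neg u v -> pi1_eq w neg v x -> pi1_eq w neg u x
| pi1_cat u u' v v' :
    pi1_eq w neg u u' -> pi1_eq w neg v v' -> pi1_eq w neg (u ++ v) (u' ++ v')
| pi1_cancel x b : pi1_eq w neg [:: (x, b); (x, ~~ b)] [::]
| pi1_rela : pi1_eq w neg (relator_a w neg) [::]
| pi1_relb : pi1_eq w neg (relator_b w neg) [::].

(* Generators of the stabilizer in pi_1(M_phi) of the ideal vertex V above.
   When epsilon = -1, s sends V to the opposite corner. *)
Definition longitude : gword := gw_inv (gen ga) ++ gw_inv (gen gb) ++ gen ga ++ gen gb.
Definition meridian (w : seq letter) (neg : bool) : gword :=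
  if neg then
    gw_inv ((pi1_frame w (size w)).1 ++ (pi1_frame w (size w)).2) ++ gen gs
  else gen gs.

Definition alpha (u : gword) : int :=
  \sum_(x <- u | x.1 == gs) (if x.2 then -1 else 1).

Definition gw_eval (C : fieldType) (rho : 'I_3 -> 'M[C]_2) (u : gword) : 'M[C]_2 :=
  foldr (fun x m => (if x.2 then invmx (rho x.1) else rho x.1) *m m) 1%:M u.

(* rho : pi_1(M_phi) -> SL_2(C) lifts a discrete and faithful representation in
   PSL_2(C); by Mostow-Prasad rigidity such a representation is the geometric
   one, up to conjugation and up to the orientation of M_phi. *)
Definition is_geometric_lift (C : numFieldType) (w : seq letter) (neg : bool)
    (rho : 'I_3 -> 'M[C]_2) : Prop :=
  [/\ forall x, \det (rho x) = 1,
      gw_eval rho (relator_a w neg) = 1%:M /\ gw_eval rho (relator_b w neg) = 1%:M,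
      (forall u, gw_eval rho u = 1%:M \/ gw_eval rho u = - 1%:M ->
                 pi1_eq w neg u [::]) &
      (exists2 e : C, 0 < e & forall u,
         (forall i j, `|(gw_eval rho u - 1%:M) i j| < e) -> gw_eval rho u = 1%:M)].

Definition bracket (C : fieldType) (u v : 'cV[C]_2) : C := \det (row_mx u v : 'M_2).

(* Cross-ratio (in homogeneous coordinates) of the tetrahedron with vertices x
   and y 0, y 1, y 2, seen counterclockwise from x, at its edge from x to y p.
   If x is at infinity, it is (y (p + 2) - y p) / (y (p + 1) - y p). *)
Definition cross_ratio (C : fieldType) (x : 'cV[C]_2) (y : 'Z_3 -> 'cV[C]_2)
    (p : 'Z_3) : C :=
  (bracket (y p) (y (p + 2)) * bracket x (y (p + 1))) /
  (bracket (y p) (y (p + 1)) * bracket x (y (p + 2))).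

(* Other ends of the edges labelled 0, 1, 2 issued from V, as images of V *)
Definition tet_corner (w : seq letter) (n : nat) (p : 'Z_3) : gword :=
  let: (al, be) := pi1_frame w n in nth [::] [:: al; al ++ be; be] p.

(* The ideal vertices of the universal cover of M_phi form one orbit
   pi_1(M_phi) / Stab(V), so that a rho-equivariant developing map is given by
   the image of V, a point of the projective line fixed by rho(Stab(V)). *)
Definition is_holonomy (C : fieldType) (w : seq letter) (neg : bool)
    (q : 'I_(size w) -> 'Z_3) (z : 'I_(size w) -> C)
    (rho : 'I_3 -> 'M[C]_2) : Prop :=
  exists x : 'cV[C]_2,
    [/\ x != 0,
        exists c, gw_eval rho longitude *m x = c *: x,
        exists c, gw_eval rho (meridian w neg) *m x = c *: x &
        forall j : 'I_(size w),
          z j = cross_ratio x (fun p => gw_eval rho (tet_corner w j p) *m x) (q j)].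

Definition sl2_basis (C : fieldType) (k : 'I_3) : 'M[C]_2 :=
  nth 0 [:: delta_mx 0 1; delta_mx 0 0 - delta_mx 1 1; delta_mx 1 0] k.
Definition sl2_coord (C : fieldType) (X : 'M[C]_2) (k : 'I_3) : C :=
  nth 0 [:: X 0 1; X 0 0; X 1 0] k.

Definition Ad (C : fieldType) (g : 'M[C]_2) : 'M[C]_3 :=
  \matrix_(i, j) sl2_coord (g *m sl2_basis C j *m invmx g) i.

Definition tw_act (C : fieldType) (rho : 'I_3 -> 'M[C]_2) (u : gword) :
    'M[ratfrac C]_3 :=
  tvar C ^ alpha u *: map_mx (@cst C) (Ad (gw_eval rho u)).

(* Fox derivative of u with respect to the generator x, each group element
   gamma being replaced by the action of gamma^-1; in V (x)_pi C_*, one has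
   v (x) gamma c = gamma^-1 v (x) c. *)
Fixpoint tw_fox (C : fieldType) (rho : 'I_3 -> 'M[C]_2) (x : 'I_3) (u : gword) :
    'M[ratfrac C]_3 :=
  if u is y :: u' then
    (if y.1 == x then (if y.2 then - tw_act rho (gen x) else 1%:M) else 0)
    + tw_fox rho x u' *m tw_act rho (gw_inv [:: y])
  else 0.

(* The twisted cellular chain complex (on column vectors) for the handle
   decomposition of the compact core of M_phi induced by a handle decomposition
   of the fibre: the 0- and 1-handles of the fibre give the 0-handle and the
   1-handles a, b; thickening them in the direction of the circle gives the
   1-handle s and the 2-handles, attached along the relators. *)
Definition tw_d1 (C : fieldType) (rho : 'I_3 -> 'M[C]_2) :
    'M[ratfrac C]_(3, 3 + (3 + 3)) :=
  let d x := tw_act rho (gw_inv (gen x)) - 1%:M in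
  row_mx (d ga) (row_mx (d gb) (d gs)).

Definition tw_d2 (C : fieldType) (w : seq letter) (neg : bool)
    (rho : 'I_3 -> 'M[C]_2) : 'M[ratfrac C]_(3 + (3 + 3), 3 + 3) :=
  let d r := col_mx (tw_fox rho ga r) (col_mx (tw_fox rho gb r) (tw_fox rho gs r)) in
  row_mx (d (relator_a w neg)) (d (relator_b w neg)).

(* tau is the torsion prod_i [d(b_(i+1)) b_i / c_i]^((-1)^(i+1)) of the acyclic
   based complex 0 -> K^n2 -> K^(n2+n0) -> K^n0 -> 0.  The columns of b_i map to
   a basis of the image of d_i; b_0 and b_3 are empty. *)
Definition is_torsion (K : fieldType) (n0 n2 : nat)
    (d2 : 'M[K]_(n2 + n0, n2)) (d1 : 'M[K]_(n0, n2 + n0)) (tau : K) : Prop :=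
  d1 *m d2 = 0 /\
  exists (b1 : 'M[K]_(n2 + n0, n0)) (b2 : 'M[K]_n2),
    [/\ \det (d1 *m b1) != 0, \det (row_mx (d2 *m b2) b1) != 0, \det b2 != 0 &
        tau = (\det (d1 *m b1))^-1 * \det (row_mx (d2 *m b2) b1) * (\det b2)^-1].

Definition is_twisted_alexander (C : fieldType) (w : seq letter) (neg : bool)
    (rho : 'I_3 -> 'M[C]_2) (tau : ratfrac C) : Prop :=
  @is_torsion (ratfrac C) 3 6 (tw_d2 w neg rho) (tw_d1 rho) tau.

Definition eq_up_to_units (C : fieldType) (x y : ratfrac C) : Prop :=
  exists (b : bool) (k : int), x = (-1) ^+ b * tvar C ^ k * y.

(* Main.v *)
(* Let h_i, v_i, d_i be the traces of rho at alpha_i, beta_i, alpha_i beta_i, and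
   J the transposed Jacobian matrix of the map that they undergo along one period
   of the word. Both invariants turn out to be det (t^-1 - J), up to a unit.

   Torsion. It is the determinant of t^-1 minus the monodromy on the twisted
   H_1 of the fibre. A loop u carries the cycle with coefficient the traceless
   part of rho(u), dual to the derivative of tr rho(u); the cycles of alpha_i,
   beta_i, alpha_i beta_i form a basis, and change with i like the traces.

   Shapes. Developing around a peripheral curve isotopic to the boundary of the
   fibre, completeness gives it the eigenvalue 1 or -1 at the ideal vertex;
   1 would degenerate the tetrahedra, so tr rho([alpha, beta]) = -2. Therefore
   h^2 + v^2 + d^2 = h v d, and the shape parameters of the tetrahedron i are
   (h^2 + v^2) / v^2, - v^2 / h^2 and h^2 / (h^2 + v^2).

   Gluing determinant. The edge d_b appears in the tetrahedron b and is exchanged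
   at most N + 1 layers later. The weights met so far around the three edges of
   each layer form a state driven by the tetrahedra, and each edge equation is
   read when its edge is exchanged; eliminating the states in one way or the
   other evaluates the determinant as det (A - t), with A a product of 3 x 3
   matrices. Splitting off the eigenvalue 1 from A and from J leaves conjugate
   products of the same matrices of SL_2, which do not distinguish t from t^-1.

   Flattening. With s the partial sums of the flattening around the edges of a
   layer, the denominator telescopes through h^(s_h - 1) v^(s_v - 1) d^(s_d - 1). *)
From HB Require Import structures.
Require Import Defs.
From mathcomp Require Import all_boot all_order all_algebra.
From mathcomp Require Import complex reals classical_sets fsbigop.
From mathcomp Require Import perm.
From mathcomp Require Import ring lra zify.

Set Implicit Arguments.
Unset Strict Implicit.
Unset Printing Implicit Defensive.

Import Order.TTheory GRing.Theory Num.Theory.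
Local Open Scope ring_scope.

(** * Matrices of size 2 and 3 *)

(** Both reductions to SL_2 rest on an invariant linear form. The weights [zeta], [zeta'], [zeta'']
    of a tetrahedron sum to 0, so the closed loop of edge weights preserves the total weight of a
    layer; each letter preserves the cubic satisfied by the traces, so its Jacobian preserves the
    differential of this cubic. On the kernels of these forms a letter acts on both sides by the
    same matrix [shear_step]; the two products only start one letter apart, which is a conjugation.

    The delicate geometric point is that the longitude is parabolic with eigenvalue exactly -1. If
    it were sent to 1 or -1, faithfulness would make it trivial in the fundamental group, which is
    known only by generators and relations; an action on a Heisenberg group, in which the commutator
    of a and b survives and to which the monodromy extends, rules this out. Completeness becomes
    usable through an explicit normal curve, drawn where the word closes up, its last letter L being
    followed by its first letter R. *)

Section SmallMatrices.
Variable R : comNzRingType.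

Lemma forall_ord2 (P : 'I_2 -> Prop) : P 0 -> P 1 -> forall i, P i.
Proof.
move=> P0 P1 [[|[|//]] lti].
- by have -> : Ordinal lti = 0 by apply: val_inj.
- by have -> : Ordinal lti = 1 by apply: val_inj.
Qed.

Lemma forall_ord3 (P : 'I_3 -> Prop) : P 0 -> P 1 -> P 2 -> forall i, P i.
Proof.
move=> P0 P1 P2 [[|[|[|//]]] lti].
- by have -> : Ordinal lti = 0 by apply: val_inj.
- by have -> : Ordinal lti = 1 by apply: val_inj.
- by have -> : Ordinal lti = 2 by apply: val_inj.
Qed.

Lemma sum_ord2 (V : nmodType) (F : 'I_2 -> V) : \sum_i F i = F 0 + F 1.
Proof.
rewrite !big_ord_recl big_ord0 addr0.
by congr (F _ + F _); apply: val_inj.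
Qed.

Lemma sum_ord3 (V : nmodType) (F : 'I_3 -> V) : \sum_i F i = F 0 + F 1 + F 2.
Proof.
rewrite !big_ord_recl big_ord0 addr0 addrA.
by congr (F _ + F _ + F _); apply: val_inj.
Qed.

Lemma mulmx2E m p (A : 'M[R]_(m, 2)) (B : 'M_(2, p)) i j :
  (A *m B) i j = A i 0 * B 0 j + A i 1 * B 1 j.
Proof. by rewrite mxE sum_ord2. Qed.

Lemma mulmx3E m p (A : 'M[R]_(m, 3)) (B : 'M_(3, p)) i j :
  (A *m B) i j = A i 0 * B 0 j + A i 1 * B 1 j + A i 2 * B 2 j.
Proof. by rewrite mxE sum_ord3. Qed.

Lemma mxtrace2 (A : 'M[R]_2) : \tr A = A 0 0 + A 1 1.
Proof. by rewrite /mxtrace sum_ord2. Qed.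

Lemma det2 (A : 'M[R]_2) : \det A = A 0 0 * A 1 1 - A 0 1 * A 1 0.
Proof.
rewrite (expand_det_row _ 0) sum_ord2 /cofactor !det_mx11 !mxE /=.
rewrite expr0 mul1r expr1 mulN1r mulrN.
by congr (A _ _ * A _ _ - A _ _ * A _ _); apply: val_inj.
Qed.

Lemma det3 (A : 'M[R]_3) :
  \det A = A 0 0 * (A 1 1 * A 2 2 - A 1 2 * A 2 1)
         - A 0 1 * (A 1 0 * A 2 2 - A 1 2 * A 2 0)
         + A 0 2 * (A 1 0 * A 2 1 - A 1 1 * A 2 0).
Proof.
(* With indices in [nat], the lifted indices of the minors reduce by computation. *)
have [f Af] : exists f : nat -> nat -> R, forall i j, A i j = f i j.
  by exists (fun i j => A (inord i) (inord j)) => i j; rewrite !inord_val.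
rewrite (expand_det_row _ 0) sum_ord3 /cofactor !det2 !mxE !Af /=.
rewrite /bump /= !addn0 !add0n !addn1 /=.
by rewrite expr0 expr1 -signr_odd /= expr0; ring.
Qed.

Lemma matrix2P (A B : 'M[R]_2) :
  A 0 0 = B 0 0 -> A 0 1 = B 0 1 -> A 1 0 = B 1 0 -> A 1 1 = B 1 1 -> A = B.
Proof.
by move=> *; apply/matrixP; apply: forall_ord2; apply: forall_ord2.
Qed.

Lemma colv3P (u v : 'cV[R]_3) : u 0 0 = v 0 0 -> u 1 0 = v 1 0 -> u 2 0 = v 2 0 -> u = v.
Proof.
move=> *; apply/matrixP => i j; rewrite (ord1 j); move: i.
exact: forall_ord3.
Qed.

End SmallMatrices.

Lemma invmx2 (F : comUnitRingType) (A : 'M[F]_2) : \det A = 1 ->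
  invmx A = \matrix_(i, j) (if i == j then A (1 - i) (1 - i) else - A i j).
Proof.
move=> dA; have uA : A \in unitmx by rewrite unitmxE dA unitr1.
rewrite -[RHS](mulKmx uA) (_ : A *m _ = 1%:M) ?mulmx1 //.
move: dA; rewrite det2 => dA.
by apply: matrix2P; rewrite mulmx2E !mxE /= ?subrr ?subr0 -?dA; ring.
Qed.

(** Cayley-Hamilton in SL_2. *)
Lemma invmx2_tr (F : comUnitRingType) (A : 'M[F]_2) : \det A = 1 ->
  invmx A = (\tr A)%:M - A.
Proof.
move=> dA; rewrite invmx2 // mxtrace2.
by apply: matrix2P; rewrite !mxE /= ?subrr ?subr0; ring.
Qed.

(** * The adjoint representation of SL_2 *)

Section Adjoint.
Variable C : fieldType.
Hypothesis two_neq0 : 2 != 0 :> C.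

(** Coordinates in [sl2_basis] after projection along the scalar matrices. Unlike [sl2_coord], this
    makes sense for any trace, so that group elements themselves can serve as coefficients. *)
Definition tl_coord (X : 'M[C]_2) : 'cV[C]_3 :=
  \col_i nth 0 [:: X 0 1; (X 0 0 - X 1 1) / 2; X 1 0] i.

Lemma tl_coordD : {morph tl_coord : X Y / X + Y}.
Proof. by move=> X Y; apply: colv3P; rewrite !mxE /=; field. Qed.

Lemma tl_coordZ a : {morph tl_coord : X / a *: X}.
Proof. by move=> X; apply: colv3P; rewrite !mxE /=; field. Qed.

Lemma tl_coordN : {morph tl_coord : X / - X}.
Proof. by move=> X; rewrite -scaleN1r tl_coordZ scaleN1r. Qed.

Lemma tl_coord_scalar a : tl_coord a%:M = 0.
Proof. by apply: colv3P; rewrite !mxE /= ?mulr0n ?subrr ?mul0r. Qed.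

Lemma sl2_coordE X k : \tr X = 0 -> sl2_coord X k = tl_coord X k 0.
Proof.
rewrite mxtrace2 => /eqP; rewrite addr_eq0 => /eqP X00.
by move: k; apply: forall_ord3; rewrite /sl2_coord !mxE //= X00; field.
Qed.

Lemma sl2_basisE X : X = (\tr X / 2)%:M + \sum_k tl_coord X k 0 *: sl2_basis C k.
Proof.
rewrite sum_ord3 /sl2_basis mxtrace2.
by apply: matrix2P; rewrite !mxE /=; field.
Qed.

Lemma tr_sl2_basis g j : g \in unitmx -> \tr (g *m sl2_basis C j *m invmx g) = 0.
Proof.
move=> ug; rewrite mxtrace_mulC mulmxA mulVmx // mul1mx mxtrace2.
by move: j; apply: forall_ord3; rewrite /sl2_basis !mxE /= ?mulr0n ?mulr1n; ring.
Qed.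

Lemma AdE (g : 'M[C]_2) i j : g \in unitmx ->
  Ad g i j = tl_coord (g *m sl2_basis C j *m invmx g) i 0.
Proof. by move=> ug; rewrite mxE sl2_coordE // tr_sl2_basis. Qed.

Lemma Ad_tl_coord g X : g \in unitmx ->
  Ad g *m tl_coord X = tl_coord (g *m X *m invmx g).
Proof.
move=> ug; rewrite {2}[X]sl2_basisE mulmxDr mulmxDl tl_coordD.
rewrite mul_mx_scalar -scalemxAl mulmxV // tl_coordZ tl_coord_scalar scaler0 add0r.
rewrite !sum_ord3 !mulmxDr !mulmxDl !tl_coordD -!scalemxAr -!scalemxAl !tl_coordZ.
apply/matrixP => i k; rewrite (ord1 k) mulmx3E !AdE //.
have vD (u v : 'cV[C]_3) l : (u + v) l 0 = u l 0 + v l 0 by rewrite mxE.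
have vZ a (v : 'cV[C]_3) l : (a *: v) l 0 = a * v l 0 by rewrite mxE.
by rewrite !vD !vZ; ring.
Qed.

Lemma invmxM n (g h : 'M[C]_n) : g \in unitmx -> h \in unitmx ->
  invmx (g *m h) = invmx h *m invmx g.
Proof.
move=> ug uh; rewrite -[RHS](mulKmx (_ : g *m h \in unitmx)) ?unitmx_mul ?ug //.
by rewrite (mulmxA (g *m h)) mulmxK // mulmxV // mulmx1.
Qed.

Lemma AdM (g h : 'M[C]_2) : g \in unitmx -> h \in unitmx -> Ad (g *m h) = Ad g *m Ad h.
Proof.
move=> ug uh; have ugh : g *m h \in unitmx by rewrite unitmx_mul ug.
have ext (A B : 'M[C]_3) : (forall X, A *m tl_coord X = B *m tl_coord X) -> A = B.
  move=> AB; apply/matrixP => i j.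
  have eqj (D : 'M[C]_3) k : D i k = (D *m tl_coord (sl2_basis C k)) i 0.
    rewrite mulmx3E; move: k; apply: forall_ord3;
    by rewrite /sl2_basis !mxE /= ?mulr0n ?mulr1n; field.
  by rewrite eqj AB -eqj.
apply: ext => X; rewrite -mulmxA !Ad_tl_coord // !mulmxA; congr (tl_coord _).
by rewrite invmxM // !mulmxA.
Qed.

Lemma Ad1 : Ad 1%:M = 1%:M :> 'M[C]_3.
Proof.
apply/matrixP => i j; rewrite mxE invmx1 mulmx1 mul1mx.
by move: i j; apply: forall_ord3; apply: forall_ord3;
   rewrite /sl2_coord /sl2_basis !mxE /= ?mulr0n ?mulr1n ?subr0.
Qed.

Lemma det_Ad (g : 'M[C]_2) : \det g = 1 -> \det (Ad g) = 1.
Proof.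
(* With the adjugate in place of the inverse, the determinant of [Ad g] is the polynomial
   [det g ^ 3], an identity within reach of [ring]. *)
move=> dg; transitivity (\det g ^+ 3); last by rewrite dg expr1n.
rewrite det3 ![in LHS]mxE /sl2_coord /sl2_basis /=.
rewrite invmx2 // !mulmx2E !mxE /= ?subrr ?subr0 det2 ?mulr0n ?mulr1n; ring.
Qed.

End Adjoint.

(** * Fox calculus and the trace cycles *)

Section RatFrac.
Variable C : fieldType.

Lemma cst_is_zmod_morphism : zmod_morphism (@cst C).
Proof. by move=> x y; rewrite /cst !rmorphB. Qed.

Lemma cst_is_monoid_morphism : monoid_morphism (@cst C).
Proof. by split=> [|x y]; rewrite /cst ?rmorph1 // !rmorphM. Qed.

HB.instance Definition _ :=
  GRing.isZmodMorphism.Build C (ratfrac C) (@cst C) cst_is_zmod_morphism.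
HB.instance Definition _ :=
  GRing.isMonoidMorphism.Build C (ratfrac C) (@cst C) cst_is_monoid_morphism.

Lemma tvar_neq0 : tvar C != 0.
Proof. by rewrite /tvar tofrac_eq0 polyX_eq0. Qed.

End RatFrac.

Section TwistedAction.
Variable C : fieldType.
Hypothesis two_neq0 : 2 != 0 :> C.
Variable rho : 'I_3 -> 'M[C]_2.
Hypothesis det_rho : forall x, \det (rho x) = 1.
Variables (K : fieldType) (iota : {rmorphism C -> K}) (t : K).
Hypothesis t_neq0 : t != 0.
Notation ev := (gw_eval rho).

(* [tw_act] and [tw_fox] with an arbitrary field K for C(t). *)
Definition gact (u : gword) : 'M[K]_3 := t ^ alpha u *: map_mx iota (Ad (ev u)).

Fixpoint gfox (x : 'I_3) (u : gword) : 'M[K]_3 :=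
  if u is y :: u' then
    (if y.1 == x then (if y.2 then - gact (gen x) else 1%:M) else 0)
    + gfox x u' *m gact (gw_inv [:: y])
  else 0.
Notation act := gact.

Lemma gw_invD u v : gw_inv (u ++ v) = gw_inv v ++ gw_inv u.
Proof. by rewrite /gw_inv map_cat rev_cat. Qed.

Lemma gw_invK : involutive gw_inv.
Proof.
move=> u; rewrite /gw_inv map_rev revK -map_comp -[RHS]map_id.
by apply: eq_map => -[x b] /=; rewrite negbK.
Qed.

Lemma gw_evalD u v : ev (u ++ v) = ev u *m ev v.
Proof. by elim: u => [|y u IH] /=; rewrite ?mul1mx // IH mulmxA. Qed.

Lemma det_gw_eval u : \det (ev u) = 1.
Proof.
elim: u => [|y u IH] /=; first exact: det1.
by rewrite det_mulmx IH mulr1; case: ifP; rewrite ?det_inv det_rho ?invr1.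
Qed.

Lemma unit_gw_eval u : ev u \in unitmx.
Proof. by rewrite unitmxE det_gw_eval unitr1. Qed.

Lemma gw_evalV u : ev (gw_inv u) = invmx (ev u).
Proof.
elim: u => [|y u IH]; first by rewrite invmx1.
rewrite -cat1s gw_invD !gw_evalD IH invmxM ?unit_gw_eval //; congr (_ *m _).
by rewrite /gw_inv /= !mulmx1; case: y.2; rewrite /= ?invmxK.
Qed.

Lemma alphaD u v : alpha (u ++ v) = alpha u + alpha v.
Proof. by rewrite /alpha big_cat. Qed.

Lemma alphaV u : alpha (gw_inv u) = - alpha u.
Proof.
elim: u => [|y u IH]; first by rewrite /alpha !big_nil oppr0.
rewrite -cat1s gw_invD !alphaD IH opprD addrC; congr (_ + _).
rewrite /alpha /gw_inv /= !big_cons !big_nil /=.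
by case: ifP; case: y.2; rewrite /= ?addr0 ?oppr0 ?opprK.
Qed.

Lemma gactD u v : act (u ++ v) = act u *m act v.
Proof.
rewrite /gact gw_evalD alphaD expfzDr ?t_neq0 // AdM ?unit_gw_eval //.
by rewrite map_mxM -scalemxAl -scalemxAr scalerA.
Qed.

Lemma gact0 : act [::] = 1%:M.
Proof. by rewrite /gact /alpha big_nil expr0z scale1r /= Ad1 map_mx1. Qed.

Lemma gact_eq u v : ev u = ev v -> alpha u = alpha v -> act u = act v.
Proof. by rewrite /gact => -> ->. Qed.

Lemma gactVr u : act u *m act (gw_inv u) = 1%:M.
Proof.
rewrite -gactD -gact0; apply: gact_eq; last first.
  by rewrite alphaD alphaV subrr /alpha big_nil.
by rewrite gw_evalD gw_evalV mulmxV ?unit_gw_eval.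
Qed.

Lemma gactVl u : act (gw_inv u) *m act u = 1%:M.
Proof. by have := gactVr (gw_inv u); rewrite gw_invK. Qed.

Lemma gfoxD x u v :
  gfox x (u ++ v) = gfox x u + gfox x v *m act (gw_inv u).
Proof.
elim: u => [|y u IH] /=; first by rewrite add0r /gw_inv /= gact0 mulmx1.
rewrite IH mulmxDl addrA -mulmxA -gactD; congr (_ + _ *m act _).
by rewrite -gw_invD.
Qed.

Lemma gfoxV x u : gfox x (gw_inv u) = - (gfox x u *m act u).
Proof.
have fox1V y : gfox x (gw_inv [:: y]) = - (gfox x [:: y] *m act [:: y]).
  case: y => y [] /=; rewrite !mul0mx !addr0; case: eqP => [->|_].
  - by rewrite mulNmx opprK; exact: (esym (gactVr (gen x))).
  - by rewrite mul0mx oppr0.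
  - by rewrite mul1mx.
  - by rewrite mul0mx oppr0.
elim: u => [|y u IH]; first by rewrite mul0mx oppr0.
rewrite -cat1s gw_invD !gfoxD IH fox1V gw_invK mulNmx -opprD; congr (- _).
rewrite -[RHS]/((gfox x [:: y] + _) *m act (_ ++ _)).
move: (gfox x [:: y]) => m; rewrite gactD !mulmxDl !mulmxA.
rewrite [LHS]addrC; congr (_ + _).
by rewrite -[X in _ = X *m _]mulmxA gactVl mulmx1.
Qed.

(** Fundamental formula of Fox calculus, in the convention with inverses: the boundary of the lifted
    path [u] is the difference of its end points. *)
Lemma gfox_fundamental u :
  \sum_x (act (gw_inv (gen x)) - 1%:M) *m gfox x u = act (gw_inv u) - 1%:M.
Proof.
elim: u => [|y u IH] /=.
  by rewrite big1 ?gact0 ?subrr // => x _; rewrite mulmx0.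
under eq_bigr => x _ do rewrite mulmxDr mulmxA.
rewrite big_split /= -mulmx_suml IH -[gw_inv (y :: u)]/(gw_inv ([:: y] ++ u)).
rewrite gw_invD gactD (bigD1 y.1) //= eqxx big1 ?addr0; last first.
  by move=> x; rewrite eq_sym => /negbTE ->; rewrite mulmx0.
set S := _ *m (if _ then _ else _); suff -> : S = act (gw_inv [:: y]) - 1%:M.
  by rewrite mulmxBl mul1mx addrC subrKA.
rewrite {}/S; case: y => y [] /=; rewrite ?mulmx1 // mulmxN mulmxBl mul1mx.
by rewrite (gactVl (gen y)) opprB.
Qed.

End TwistedAction.

(** Independence of the bases. Modulo the image of [d2], any [b1] is the standard lift [bs] times a
    square matrix, whose determinant enters both factors and cancels. In the application the two
    minors are the column block of s in [d1] and the row blocks of a and b in [d2]. *)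
Lemma is_torsionP (K : fieldType) (n0 n2 : nat)
    (d2 : 'M[K]_(n2 + n0, n2)) (d1 : 'M[K]_(n0, n2 + n0)) (tau : K) :
  d1 *m d2 = 0 -> \det (rsubmx d1) != 0 -> \det (usubmx d2) != 0 ->
  is_torsion d2 d1 tau <-> tau = (\det (rsubmx d1))^-1 * \det (usubmx d2).
Proof.
move=> d12 nz1 nz2; pose bs : 'M[K]_(n2 + n0, n0) := col_mx 0 1%:M.
have d1bs : d1 *m bs = rsubmx d1.
  by rewrite -[in LHS](hsubmxK d1) mul_row_col mulmx0 mulmx1 add0r.
have detbs : \det (row_mx d2 bs) = \det (usubmx d2).
  by rewrite -[in LHS](vsubmxK d2) -block_mxEh det_lblock det1 mulr1.
have detb2 (b1 : 'M_(n2 + n0, n0)) b2 :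
    \det (row_mx (d2 *m b2) b1) = \det (row_mx d2 b1) * \det b2.
  have -> : row_mx (d2 *m b2) b1 = row_mx d2 b1 *m block_mx b2 0 0 1%:M.
    by rewrite mul_row_block !mulmx0 mulmx1 addr0 add0r.
  by rewrite det_mulmx det_ublock det1 mulr1.
have gen b1 : \det (row_mx d2 b1) * \det (rsubmx d1) =
              \det (usubmx d2) * \det (d1 *m b1).
  pose XY := invmx (row_mx d2 bs) *m b1.
  have u : row_mx d2 bs \in unitmx by rewrite unitmxE detbs unitfE.
  have eb1 : b1 = d2 *m usubmx XY + bs *m dsubmx XY.
    by rewrite -mul_row_col vsubmxK mulKVmx.
  have -> : row_mx d2 b1 = row_mx d2 bs *m block_mx 1%:M (usubmx XY) 0 (dsubmx XY).
    by rewrite mul_row_block !mulmx0 mulmx1 addr0 -eb1.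
  have -> : d1 *m b1 = rsubmx d1 *m dsubmx XY.
    by rewrite eb1 mulmxDr !mulmxA d12 mul0mx add0r d1bs.
  by rewrite !det_mulmx detbs det_ublock det1 mul1r mulrAC -mulrA.
split=> [[_ [b1 [b2 [nb1 nb nb2 ->]]]]|->].
  rewrite detb2 -(mulfK nz1 (\det (row_mx d2 b1))) gen.
  by field; rewrite nb1 nz1 nb2.
split=> //; exists bs, 1%:M.
by rewrite d1bs mulmx1 det1 detbs oner_eq0 invr1 mulr1.
Qed.

Section TraceCycles.
Variable C : fieldType.
Hypothesis two_neq0 : 2 != 0 :> C.
Variable rho : 'I_3 -> 'M[C]_2.
Hypothesis det_rho : forall x, \det (rho x) = 1.
Variables (K : fieldType) (iota : {rmorphism C -> K}) (t : K).
Hypothesis t_neq0 : t != 0.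
Notation ev := (gw_eval rho).
Notation act := (gact rho iota t).
Notation gfox := (gfox rho iota t).

Definition tlK (X : 'M[C]_2) : 'cV[K]_3 := map_mx iota (tl_coord X).

Lemma tlKD X Y : tlK (X + Y) = tlK X + tlK Y.
Proof. by rewrite /tlK (tl_coordD two_neq0) map_mxD. Qed.

Lemma tlKZ a X : tlK (a *: X) = iota a *: tlK X.
Proof. by rewrite /tlK (tl_coordZ two_neq0) map_mxZ. Qed.

Lemma gact_tlK u X : alpha u = 0 ->
  act u *m tlK X = tlK (ev u *m X *m invmx (ev u)).
Proof.
move=> au; rewrite /gact au expr0z scale1r /tlK -map_mxM.
by rewrite (Ad_tl_coord two_neq0) // (unit_gw_eval det_rho).
Qed.

Definition fox_fibre (u : gword) : 'M[K]_(3 + 3, 3) :=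
  col_mx (gfox ga u) (gfox gb u).

Lemma fox_fibreD u v :
  fox_fibre (u ++ v) = fox_fibre u + fox_fibre v *m act (gw_inv u).
Proof. by rewrite /fox_fibre !(gfoxD two_neq0 det_rho iota t_neq0) mul_col_mx add_col_mx. Qed.

Lemma fox_fibreV u : fox_fibre (gw_inv u) = - (fox_fibre u *m act u).
Proof. by rewrite /fox_fibre !(gfoxV two_neq0 det_rho iota t_neq0) mul_col_mx opp_col_mx. Qed.

(* The class in H_1(F; sl_2) of the loop u with coefficient the traceless part
   of rho(u), which rho(u) fixes; it is dual to the derivative of tr rho(u). *)
Definition trace_cycle (u : gword) : 'cV[K]_(3 + 3) := fox_fibre u *m tlK (ev u).

Lemma trace_cycleD u v : alpha u = 0 ->
  trace_cycle (u ++ v) =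
    fox_fibre u *m tlK (ev u *m ev v) + fox_fibre v *m tlK (ev v *m ev u).
Proof.
move=> au; have aV : alpha (gw_inv u) = 0 by rewrite alphaV au oppr0.
rewrite /trace_cycle fox_fibreD mulmxDl gw_evalD -(mulmxA (fox_fibre v)).
rewrite (gact_tlK _ aV) (gw_evalV det_rho) invmxK.
by rewrite mulmxA (mulVmx (unit_gw_eval det_rho u)) mul1mx.
Qed.

(** An equality of chains and not only of homology classes, because the formula of [trace_cycleD] is
    symmetric in [u] and [v]. *)
Lemma trace_cycleC u v : alpha u = 0 -> alpha v = 0 ->
  trace_cycle (u ++ v) = trace_cycle (v ++ u).
Proof. by move=> au av; rewrite (trace_cycleD _ au) (trace_cycleD _ av) addrC. Qed.

Lemma trace_cycleV u : alpha u = 0 -> trace_cycle (gw_inv u) = trace_cycle u.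
Proof.
move=> au; rewrite /trace_cycle fox_fibreV (gw_evalV det_rho) mulNmx -(mulmxA (fox_fibre u)).
rewrite (gact_tlK _ au) (mulmxV (unit_gw_eval det_rho u)) mul1mx.
rewrite -mulmxN (invmx2_tr (det_gw_eval det_rho u)); congr (_ *m _).
rewrite tlKD -(scaleN1r (ev u)) tlKZ opprD {1}/tlK tl_coord_scalar map_mx0 oppr0 add0r.
by rewrite rmorphN1 scaleN1r opprK.
Qed.

Lemma trace_cycleVK u v : trace_cycle (gw_inv u ++ (u ++ v)) = trace_cycle v.
Proof.
rewrite /trace_cycle !fox_fibreD fox_fibreV gw_invK
  (mulmxDl (fox_fibre u)) addKr.
rewrite -(mulmxA (fox_fibre v)) (gactVl two_neq0 det_rho iota t_neq0) mulmx1 !gw_evalD (gw_evalV det_rho).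
by rewrite mulmxA (mulVmx (unit_gw_eval det_rho u)) mul1mx.
Qed.

(** Linearization of the identity [tr (u v) + tr (u^-1 v) = tr u * tr v] of SL_2. *)
Lemma trace_cycle_trace u v : alpha u = 0 ->
  trace_cycle (u ++ v) + trace_cycle (gw_inv u ++ v) =
    iota (\tr (ev u)) *: trace_cycle v + iota (\tr (ev v)) *: trace_cycle u.
Proof.
move=> au; have aV : alpha (gw_inv u) = 0 by rewrite alphaV au oppr0.
rewrite (trace_cycleD _ au) (trace_cycleD _ aV) fox_fibreV (gw_evalV det_rho).
rewrite mulNmx -(mulmxA (fox_fibre u)) (gact_tlK _ au) !mulmxA.
rewrite (mulmxV (unit_gw_eval det_rho u)) mul1mx.
rewrite addrACA -mulmxN -!mulmxDr.
have dev := det_gw_eval det_rho u.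
rewrite /trace_cycle; move: (ev u) (ev v) dev => U V dU.
have UV : invmx U = (\tr U)%:M - U by rewrite invmx2_tr.
have -> : tlK (V *m U) + tlK (V *m invmx U) = iota (\tr U) *: tlK V.
  by rewrite -tlKD UV mulmxBr mul_mx_scalar addrC subrK tlKZ.
(* The traceless part of [U V + V U] is [tr U] times that of [V] plus [tr V] times that of [U]. *)
have -> : tlK (U *m V) - tlK (V *m invmx U) = iota (\tr V) *: tlK U.
  rewrite -[X in _ + X]scaleN1r -(rmorphN1 iota) -!tlKZ -tlKD UV.
  rewrite mulmxBr mul_mx_scalar mxtrace2 mxtrace2 /tlK; congr (map_mx _ _).
  by apply: colv3P; rewrite !(mulmx2E, mxE) /= ?(mulmx2E, mxE); field.
by rewrite -!scalemxAr addrC.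
Qed.

End TraceCycles.

Section Cols3.
Variable R : comNzRingType.

Definition cols3 m (u0 u1 u2 : 'cV[R]_m) : 'M[R]_(m, 3) :=
  \matrix_(i, j) (nth 0 [:: u0; u1; u2] j) i 0.

Lemma mul_cols3 m n (A : 'M[R]_(n, m)) u0 u1 u2 :
  A *m cols3 u0 u1 u2 = cols3 (A *m u0) (A *m u1) (A *m u2).
Proof.
apply/matrixP => i; apply: forall_ord3; rewrite !mxE;
  by apply: eq_bigr => k _; rewrite !mxE.
Qed.

Lemma cols3_mul m (u0 u1 u2 : 'cV[R]_m) (s : seq (seq R)) :
  cols3 u0 u1 u2 *m (\matrix_(i < 3, j < 3) nth 0 (nth [::] s i) j) =
  let c j := nth 0 (nth [::] s 0) j *: u0 + nth 0 (nth [::] s 1) j *: u1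
           + nth 0 (nth [::] s 2) j *: u2 in
  cols3 (c 0) (c 1) (c 2).
Proof.
apply/matrixP => i; apply: forall_ord3; rewrite mulmx3E !mxE /=;
  by rewrite ![_ * u0 _ _]mulrC ![_ * u1 _ _]mulrC ![_ * u2 _ _]mulrC.
Qed.

Lemma cols3_col_mx m n (u0 u1 u2 : 'cV[R]_m) (v0 v1 v2 : 'cV[R]_n) :
  cols3 (col_mx u0 v0) (col_mx u1 v1) (col_mx u2 v2) =
  col_mx (cols3 u0 u1 u2) (cols3 v0 v1 v2).
Proof.
by apply/matrixP => i; apply: forall_ord3; rewrite !mxE /=;
   case: (split i) => k; rewrite !mxE.
Qed.

Lemma mul_cols3_diag m (u0 u1 u2 : 'cV[R]_m) (d : 'rV_3) :
  cols3 u0 u1 u2 *m diag_mx d = cols3 (d 0 0 *: u0) (d 0 1 *: u1) (d 0 2 *: u2).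
Proof.
by rewrite mul_mx_diag; apply/matrixP => i; apply: forall_ord3; rewrite !mxE /= mulrC.
Qed.

End Cols3.

Lemma map_cols3 (R S : comNzRingType) (f : {rmorphism R -> S}) m (u0 u1 u2 : 'cV[R]_m) :
  map_mx f (cols3 u0 u1 u2) = cols3 (map_mx f u0) (map_mx f u1) (map_mx f u2).
Proof. by apply/matrixP => i; apply: forall_ord3; rewrite !mxE. Qed.

(** * Irreducibility of a pair of matrices, measured by its commutator *)

Section Irreducible.
Variable C : fieldType.
Hypothesis two_neq0 : 2 != 0 :> C.
Variables a b : 'M[C]_2.
Hypotheses (det_a : \det a = 1) (det_b : \det b = 1).

(** The additive commutator: its determinant [2 - tr [a, b]] decides whether the traceless parts of
    [a], [b], [a b] form a basis of sl_2. *)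
Definition commmx : 'M[C]_2 := a *m b - b *m a.

Lemma det_commmx : \det commmx = 2 - \tr (invmx a *m (invmx b *m (a *m b))).
Proof.
transitivity (2 * \det a * \det b - \tr (invmx a *m (invmx b *m (a *m b)))).
  rewrite !invmx2 // mxtrace2 !det2 /commmx.
  by rewrite !(mulmx2E, mxE) /= ?subrr ?subr0; ring.
by rewrite det_a det_b !mulr1.
Qed.

Lemma det_tl_coord3 : \det (cols3 (tl_coord a) (tl_coord b) (tl_coord (a *m b))) =
  \det commmx / 2.
Proof.
by rewrite det3 det2 /commmx !(mulmx2E, mxE) /= ?(mulmx2E, mxE); field.
Qed.

Lemma det_tl_coord3C : \det (cols3 (tl_coord a) (tl_coord b) (tl_coord (b *m a))) =
  - \det commmx / 2.
Proof.
by rewrite det3 det2 /commmx !(mulmx2E, mxE) /= ?(mulmx2E, mxE); field.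
Qed.

(** The three vectors are boundaries of explicit 1-chains of the fibre (see [d0_right_inverse]);
    their independence makes the twisted H_0 of the fibre vanish. *)
Lemma det_commmx3 :
  \det (cols3 (tl_coord (- commmx)) (tl_coord (- (a *m commmx))) (tl_coord (commmx *m b)))
  = - \det commmx ^+ 2.
Proof.
by rewrite det3 det2 /commmx !(mulmx2E, mxE) /= ?(mulmx2E, mxE); field.
Qed.

End Irreducible.

Definition pi1_next (l : letter) (b : gword * gword) : gword * gword :=
  if l is LetR then (b.1, b.1 ++ b.2) else (b.2 ++ b.1, b.2).

Lemma pi1_frameS w n :
  pi1_frame w n.+1 = pi1_next (letter_at w n%:Z) (pi1_frame w n).
Proof. by rewrite /=; case: (pi1_frame w n) => al be; case: letter_at. Qed.

Lemma alpha_pi1_frame w n :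
  alpha (pi1_frame w n).1 = 0 /\ alpha (pi1_frame w n).2 = 0.
Proof.
elim: n => [|n [IH1 IH2]]; first by rewrite /alpha !big_cons !big_nil.
by rewrite pi1_frameS; case: letter_at; rewrite /= ?alphaD ?IH1 ?IH2.
Qed.

Lemma monodromyE w neg : monodromy w neg =
  if neg then (gw_inv (pi1_frame w (size w)).1, gw_inv (pi1_frame w (size w)).2)
  else pi1_frame w (size w).
Proof. by rewrite /monodromy; case: pi1_frame. Qed.

Lemma alpha_monodromy w neg :
  alpha (monodromy w neg).1 = 0 /\ alpha (monodromy w neg).2 = 0.
Proof.
have [a1 a2] := alpha_pi1_frame w (size w).
by rewrite monodromyE; case: neg; rewrite /= ?alphaV ?a1 ?a2 ?oppr0.
Qed.

(* Transpose of the Jacobian matrix of the action of a letter on the traces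
   (tr alpha, tr beta, tr (alpha beta)). *)
Definition trace_jac (R : comNzRingType) (l : letter) (h v d : R) : 'M[R]_3 :=
  \matrix_(i < 3, j < 3) nth 0 (nth [::]
    (if l is LetR then [:: [:: 1; 0; d]; [:: 0; 0; -1]; [:: 0; 1; h]]
     else [:: [:: 0; 0; -1]; [:: 0; 1; d]; [:: 1; 0; v]]) i) j.

Lemma map_trace_jac (R S : comNzRingType) (f : {rmorphism R -> S}) l h v d :
  map_mx f (trace_jac l h v d) = trace_jac l (f h) (f v) (f d).
Proof.
apply/matrixP; apply: forall_ord3; apply: forall_ord3;
  by case: l; rewrite !mxE /= ?rmorph0 ?rmorph1 ?rmorphN1.
Qed.

Lemma cols3_trace_jac (R : comNzRingType) m (x y z : 'cV[R]_m) l h v d :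
  cols3 x y z *m trace_jac l h v d =
  if l is LetR then cols3 x z (h *: z + d *: x - y) else cols3 z y (v *: z + d *: y - x).
Proof.
case: l; rewrite /trace_jac cols3_mul /=;
  rewrite !scale1r !scale0r !add0r !addr0 !scaleN1r; congr cols3.
  by rewrite addrC addrA.
by rewrite [LHS]addrC [X in _ + X]addrC addrA.
Qed.

(** * Trace cycles along the word *)

Section TorsionFormula.
Variable C : fieldType.
Hypothesis two_neq0 : 2 != 0 :> C.
Variables (w : seq letter) (neg : bool).
Variable rho : 'I_3 -> 'M[C]_2.
Hypothesis det_rho : forall x, \det (rho x) = 1.
Variables (K : fieldType) (iota : {rmorphism C -> K}) (t : K).
Hypothesis t_neq0 : t != 0.
Notation ev := (gw_eval rho).
Notation tc := (trace_cycle rho iota t).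

Definition trh n := \tr (ev (pi1_frame w n).1).
Definition trv n := \tr (ev (pi1_frame w n).2).
Definition trd n := \tr (ev ((pi1_frame w n).1 ++ (pi1_frame w n).2)).

Definition cycle_frame (b : gword * gword) : 'M[K]_(3 + 3, 3) :=
  cols3 (tc b.1) (tc b.2) (tc (b.1 ++ b.2)).

Definition jac_prod n : 'M[C]_3 :=
  iteri n (fun i M => M *m trace_jac (letter_at w i%:Z) (trh i) (trv i) (trd i)) 1%:M.

Lemma cycle_frame_next l (b : gword * gword) :
  alpha b.1 = 0 -> alpha b.2 = 0 ->
  cycle_frame (pi1_next l b) = cycle_frame b *m
    map_mx iota (trace_jac l (\tr (ev b.1)) (\tr (ev b.2)) (\tr (ev (b.1 ++ b.2)))).
Proof.
case: b => al be /= a1 a2; have a12 : alpha (al ++ be) = 0 by rewrite alphaD a1 a2.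
have trC : \tr (ev (be ++ al)) = \tr (ev (al ++ be)) by rewrite !gw_evalD mxtrace_mulC.
have eR : tc (al ++ (al ++ be)) =
    iota (\tr (ev al)) *: tc (al ++ be) + iota (\tr (ev (al ++ be))) *: tc al - tc be.
  have := trace_cycle_trace two_neq0 det_rho iota t_neq0 (al ++ be) a1.
  by rewrite (trace_cycleVK two_neq0 det_rho iota t_neq0 al be) => /(canRL (addrK _)) ->.
have eL : tc ((be ++ al) ++ be) =
    iota (\tr (ev be)) *: tc (al ++ be) + iota (\tr (ev (al ++ be))) *: tc be - tc al.
  have aV : alpha (gw_inv be) = 0 by rewrite alphaV a2 oppr0.
  have := trace_cycle_trace two_neq0 det_rho iota t_neq0 (al ++ be) a2.
  rewrite (trace_cycleC two_neq0 det_rho iota t_neq0 aV a12) -catA.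
  rewrite (trace_cycleC two_neq0 det_rho iota t_neq0 a1 (_ : alpha (be ++ gw_inv be) = 0)); last first.
    by rewrite alphaD a2 aV addr0.
  have := trace_cycleVK two_neq0 det_rho iota t_neq0 (gw_inv be) al; rewrite gw_invK -!catA => ->.
  by move/(canRL (addrK _)).
have eC := trace_cycleC two_neq0 det_rho iota t_neq0 a2 a1.
by rewrite map_trace_jac /cycle_frame cols3_trace_jac; case: l; rewrite /= ?eR ?eL ?eC.
Qed.

Lemma cycle_frame_pi1 n :
  cycle_frame (pi1_frame w n) = cycle_frame (pi1_frame w 0) *m map_mx iota (jac_prod n).
Proof.
elim: n => [|n IH]; first by rewrite /jac_prod /= map_mx1 mulmx1.
have [a1 a2] := alpha_pi1_frame w n.
rewrite pi1_frameS (cycle_frame_next _ a1 a2) IH -mulmxA.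
by rewrite [jac_prod n.+1]/= map_mxM.
Qed.

(** When epsilon = -1 the monodromy inverts both lifts, but trace cycles, like traces, are unchanged
    by inversion and by cyclic permutation; the same Jacobian therefore serves both signs. *)
Lemma cycle_frame_monodromy :
  cycle_frame (monodromy w neg) =
  cycle_frame (pi1_frame w 0) *m map_mx iota (jac_prod (size w)).
Proof.
rewrite monodromyE -cycle_frame_pi1.
have [a1 a2] := alpha_pi1_frame w (size w).
have a21 : alpha ((pi1_frame w (size w)).2 ++ (pi1_frame w (size w)).1) = 0.
  by rewrite alphaD a1 a2.
case: neg; last by exact: erefl.
rewrite /cycle_frame /= (trace_cycleV two_neq0 det_rho iota t_neq0 a1).
rewrite (trace_cycleV two_neq0 det_rho iota t_neq0 a2) -gw_invD (trace_cycleV two_neq0 det_rho iota t_neq0 a21).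
by rewrite (trace_cycleC two_neq0 det_rho iota t_neq0 a2 a1).
Qed.

End TorsionFormula.

(** * The torsion of the fibration *)

Lemma map_scalar_sub (R S : comNzRingType) (f : {rmorphism R -> S}) n a (A : 'M[R]_n) :
  map_mx f (a%:M - A) = (f a)%:M - map_mx f A.
Proof. by rewrite map_mxB map_scalar_mx. Qed.

Lemma det_tvar_sub (C : fieldType) n (A : 'M[C]_n) :
  \det ((tvar C)%:M - map_mx (@cst C) A) != 0.
Proof.
have -> : (tvar C)%:M - map_mx (@cst C) A = map_mx (@tofrac _) (char_poly_mx A).
  rewrite /char_poly_mx map_scalar_sub; congr (_ - _).
  by apply/matrixP => i j; rewrite !mxE.
by rewrite det_map_mx tofrac_eq0 monic_neq0 // char_poly_monic.
Qed.

Lemma det_tvarV_sub (C : fieldType) n (A : 'M[C]_n) : A \in unitmx ->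
  \det ((tvar C)^-1%:M - map_mx (@cst C) A) != 0.
Proof.
move=> uA; pose M := map_mx (@cst C) A; pose t := tvar C.
have nt : t != 0 := tvar_neq0 C.
have -> : t^-1%:M - M = (- t^-1) *: (M *m (t%:M - map_mx (@cst C) (invmx A))).
  rewrite mulmxBr mul_mx_scalar -map_mxM mulmxV // map_mx1 scalerBr scalerA.
  by rewrite mulNr mulVf // scaleN1r scaleNr opprK scalemx1 addrC.
rewrite detZ det_mulmx; apply: mulf_neq0.
  by apply: expf_neq0; rewrite oppr_eq0 invr_eq0.
by apply: mulf_neq0 (det_tvar_sub _); rewrite det_map_mx fmorph_eq0 -unitfE -unitmxE.
Qed.

(* M is to be the monodromy on the 1-chains of the fibre, the columns of C0 a
   basis of the 1-cycles and D0 the boundary map. *)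
Lemma det_invariant_subspace (K : fieldType) n p (M : 'M[K]_(n + p))
    (C0 : 'M_(n + p, n)) (D0 : 'M_(p, n + p)) (L1 : 'M_(n, n + p)) (E : 'M_(n + p, p))
    (J : 'M_n) (S : 'M_p) :
  M *m C0 = C0 *m J -> D0 *m M = S *m D0 -> D0 *m C0 = 0 ->
  L1 *m C0 = 1%:M -> D0 *m E = 1%:M -> \det M = \det J * \det S.
Proof.
move=> MC DM DC LC DE.
have e1 : col_mx L1 D0 *m row_mx C0 E = block_mx 1%:M (L1 *m E) 0 1%:M.
  by rewrite mul_col_row LC DC DE.
have e2 : col_mx L1 D0 *m M *m row_mx C0 E = block_mx J (L1 *m (M *m E)) 0 S.
  rewrite mul_col_mx mul_col_row -!(mulmxA L1) MC mulmxA LC mul1mx.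
  by rewrite DM -!mulmxA DC DE mulmx0 mulmx1.
have d1 := congr1 determinant e1; have d2 := congr1 determinant e2.
move: d1 d2; rewrite !det_mulmx !det_ublock !det1 mulr1 => d1 <-.
by rewrite mulrAC d1 mul1r.
Qed.

Lemma sum_gens (V : nmodType) (F : 'I_3 -> V) : \sum_x F x = F ga + F gb + F gs.
Proof. by rewrite sum_ord3; congr (F _ + F _ + F _); apply: val_inj. Qed.

Lemma cols3D (R : comNzRingType) m (u0 u1 u2 v0 v1 v2 : 'cV[R]_m) :
  cols3 (u0 + v0) (u1 + v1) (u2 + v2) = cols3 u0 u1 u2 + cols3 v0 v1 v2.
Proof. by apply/matrixP => i; apply: forall_ord3; rewrite !mxE. Qed.

Lemma row_mx_twist (K : comNzRingType) m n (fa fb pa pb : 'M[K]_(m, n)) (S T : 'M_n) c :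
  S *m T = c%:M ->
  row_mx (fa *m S - pa) (fb *m S - pb) *m block_mx T 0 0 T =
  c *: row_mx fa fb - row_mx (pa *m T) (pb *m T).
Proof.
move=> ST; rewrite mul_row_block !mulmx0 addr0 add0r !mulmxBl -!mulmxA ST.
by rewrite !mul_mx_scalar scale_row_mx opp_row_mx add_row_mx.
Qed.

Definition fibre_word (u : gword) := all (fun y => y.1 != gs) u.

Lemma fibre_word_inv u : fibre_word (gw_inv u) = fibre_word u.
Proof. by rewrite /fibre_word /gw_inv all_rev all_map. Qed.

Lemma fibre_pi1_frame w n :
  fibre_word (pi1_frame w n).1 /\ fibre_word (pi1_frame w n).2.
Proof.
elim: n => [//|n [IH1 IH2]]; rewrite pi1_frameS /fibre_word.
by case: letter_at; rewrite /= ?all_cat; move: IH1 IH2; rewrite /fibre_word => -> ->.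
Qed.

Lemma fibre_monodromy w neg :
  fibre_word (monodromy w neg).1 /\ fibre_word (monodromy w neg).2.
Proof.
have [f1 f2] := fibre_pi1_frame w (size w).
by rewrite monodromyE; case: neg; rewrite /= ?fibre_word_inv.
Qed.

Section Torsion.
Variable C : fieldType.
Hypothesis two_neq0 : 2 != 0 :> C.
Variables (w : seq letter) (neg : bool).
Variable rho : 'I_3 -> 'M[C]_2.
Hypothesis det_rho : forall x, \det (rho x) = 1.
Hypothesis rel_a : gw_eval rho (relator_a w neg) = 1%:M.
Hypothesis rel_b : gw_eval rho (relator_b w neg) = 1%:M.
Hypothesis irred : \tr (gw_eval rho longitude) != 2.
Variables (K : fieldType) (iota : {rmorphism C -> K}) (t : K).
Hypothesis t_neq0 : t != 0.
Notation ev := (gw_eval rho).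
Notation act := (gact rho iota t).
Notation tc := (trace_cycle rho iota t).
Notation fox := (fox_fibre rho iota t).
Notation gfox := (gfox rho iota t).
Notation p := (monodromy w neg).

Let d0 : 'M[K]_(3, 3 + 3) :=
  row_mx (act (gw_inv (gen ga)) - 1%:M) (act (gw_inv (gen gb)) - 1%:M).

Lemma gfox_gs_fibre u : fibre_word u -> gfox gs u = 0.
Proof.
elim: u => //= y u IH /andP[ny fu]; rewrite IH // mul0mx addr0.
by rewrite (negbTE ny).
Qed.

Lemma d0_fox u : fibre_word u -> d0 *m fox u = act (gw_inv u) - 1%:M.
Proof.
move=> fu; rewrite -(gfox_fundamental two_neq0 det_rho iota t_neq0) sum_gens.
by rewrite (gfox_gs_fibre fu) mulmx0 addr0 mul_row_col.
Qed.

Lemma d0_trace_cycle u : fibre_word u -> alpha u = 0 -> d0 *m tc u = 0.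
Proof.
move=> fu au; have aV : alpha (gw_inv u) = 0 by rewrite alphaV au oppr0.
rewrite mulmxA (d0_fox fu) mulmxBl mul1mx (gact_tlK two_neq0 det_rho iota t _ aV).
rewrite (gw_evalV det_rho) invmxK (mulVmx (unit_gw_eval det_rho u)) mul1mx.
exact: subrr.
Qed.

Lemma fox_relator g u :
  ev (gen gs ++ g ++ gw_inv (gen gs) ++ gw_inv u) = 1%:M ->
  alpha g = 0 -> alpha u = 0 ->
  fox (gen gs ++ g ++ gw_inv (gen gs) ++ gw_inv u) =
    fox g *m act (gw_inv (gen gs)) - fox u.
Proof.
move=> ev1 ag au; have fs : fox (gen gs) = 0.
  rewrite /fox_fibre /gen; cbn [gfox]; rewrite mul0mx addr0.
  exact: col_mx0.
rewrite !(fox_fibreD two_neq0 det_rho iota t_neq0) !(fox_fibreV two_neq0 det_rho iota t_neq0) fs.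
rewrite mul0mx oppr0 !add0r gw_invK mulmxDl; congr (_ + _).
rewrite !mulNmx -!mulmxA -!(gactD two_neq0 det_rho iota t_neq0).
(* This word is the inverse of the relator, which [rho] sends to 1 and which has degree 0. *)
have -> : act (u ++ gen gs ++ gw_inv g ++ gw_inv (gen gs)) = 1%:M.
  rewrite -(gact0 rho iota t); apply: gact_eq; last first.
    rewrite !alphaD !alphaV ag au oppr0 !add0r subrr.
    by rewrite /alpha big_nil.
  have : invmx (ev (gen gs ++ g ++ gw_inv (gen gs) ++ gw_inv u)) = 1%:M.
    by rewrite ev1 invmx1.
  by rewrite -(gw_evalV det_rho) !gw_invD !gw_invK -!catA.
by rewrite mulmx1.
Qed.

Let AdS := map_mx iota (Ad (rho gs)).
Let Dab : 'M[K]_(3 + 3) := row_mx (fox (relator_a w neg)) (fox (relator_b w neg)).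

Lemma gact_gs_inv : act (gw_inv (gen gs)) *m AdS = t^-1%:M.
Proof.
have ags : act (gen gs) = t *: AdS.
  by rewrite /gact /alpha big_cons big_nil /= addr0 mulmx1.
have := gactVl two_neq0 det_rho iota t_neq0 (gen gs).
rewrite ags -scalemxAr => /(congr1 (fun M => t^-1 *: M)).
by rewrite scalerA mulVf // scale1r scalemx1.
Qed.

Lemma ev_monodromy :
  ev p.1 = rho gs *m rho ga *m invmx (rho gs) /\
  ev p.2 = rho gs *m rho gb *m invmx (rho gs).
Proof.
have rel x u : ev (gen gs ++ gen x ++ gw_inv (gen gs) ++ gw_inv u) = 1%:M ->
    ev u = rho gs *m rho x *m invmx (rho gs).
  rewrite !gw_evalD (gw_evalV det_rho u) /= !mulmx1 !mulmxA.
  move=> /(congr1 (fun M => M *m ev u)).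
  by rewrite (mulmxKV (unit_gw_eval det_rho u)) mul1mx.
by split; apply: rel.
Qed.

Let fox_a : fox (relator_a w neg) = fox (gen ga) *m act (gw_inv (gen gs)) - fox p.1.
Proof.
apply: (fox_relator rel_a); last by have [] := alpha_monodromy w neg.
by rewrite /alpha big_cons big_nil.
Qed.

Let fox_b : fox (relator_b w neg) = fox (gen gb) *m act (gw_inv (gen gs)) - fox p.2.
Proof.
apply: (fox_relator rel_b); last by have [] := alpha_monodromy w neg.
by rewrite /alpha big_cons big_nil.
Qed.

Lemma fox_ga : fox (gen ga) = col_mx 1%:M 0.
Proof. by rewrite /fox_fibre /gen; rewrite /= !mul0mx !addr0. Qed.

Lemma fox_gb : fox (gen gb) = col_mx 0 1%:M.
Proof. by rewrite /fox_fibre /gen /= !mul0mx !addr0. Qed.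

(** The factor on the right has determinant 1 and clears the action of s^-1 up to [t^-1]. What is
    subtracted from [t^-1] is the monodromy on the 1-chains of the fibre. *)
Lemma Dab_AdS :
  Dab *m block_mx AdS 0 0 AdS =
  t^-1%:M - row_mx (fox p.1 *m AdS) (fox p.2 *m AdS).
Proof.
rewrite /Dab fox_a fox_b (row_mx_twist _ _ _ _ gact_gs_inv) fox_ga fox_gb.
by rewrite -block_mxEh -scalar_mx_block scalemx1.
Qed.

Let bs : gword * gword := pi1_frame w 0.

Lemma AdS_tlK X :
  AdS *m tlK iota X = tlK iota (rho gs *m X *m invmx (rho gs)).
Proof.
have us : rho gs \in unitmx by rewrite unitmxE det_rho unitr1.
by rewrite -map_mxM (Ad_tl_coord two_neq0).
Qed.

Let M2 := row_mx (fox p.1 *m AdS) (fox p.2 *m AdS).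

Lemma trace_cycle_ga : tc (gen ga) = col_mx (tlK iota (rho ga)) 0.
Proof. by rewrite /trace_cycle fox_ga mul_col_mx mul1mx mul0mx /= mulmx1. Qed.

Lemma trace_cycle_gb : tc (gen gb) = col_mx 0 (tlK iota (rho gb)).
Proof. by rewrite /trace_cycle fox_gb mul_col_mx mul1mx mul0mx /= mulmx1. Qed.

Lemma trace_cycle_gab :
  tc (gen ga ++ gen gb) =
  col_mx (tlK iota (rho ga *m rho gb)) (tlK iota (rho gb *m rho ga)).
Proof.
have aa : alpha (gen ga) = 0 by rewrite /alpha big_cons big_nil.
rewrite (trace_cycleD two_neq0 det_rho iota t_neq0 _ aa) fox_ga fox_gb !mul_col_mx.
by rewrite !mul1mx !mul0mx add_col_mx addr0 add0r /= !mulmx1.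
Qed.

Lemma monodromy_cycle :
  M2 *m cycle_frame rho iota t bs = cycle_frame rho iota t p.
Proof.
have us : rho gs \in unitmx by rewrite unitmxE det_rho unitr1.
have [ea eb] := ev_monodromy; have [aa ab] := alpha_monodromy w neg.
have conjM x y : rho gs *m (x *m y) *m invmx (rho gs) =
    (rho gs *m x *m invmx (rho gs)) *m (rho gs *m y *m invmx (rho gs)).
  by rewrite !mulmxA (mulmxKV us).
rewrite /cycle_frame mul_cols3 /M2 /bs /= trace_cycle_ga trace_cycle_gb trace_cycle_gab.
rewrite !mul_row_col !mulmx0 addr0 add0r -!mulmxA !AdS_tlK !conjM -ea -eb.
by rewrite (trace_cycleD two_neq0 det_rho iota t_neq0 _ aa).
Qed.

Lemma d0_M2 : d0 *m M2 = AdS *m d0.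
Proof.
have ug x : rho x \in unitmx by rewrite unitmxE det_rho unitr1.
have [fa fb] := fibre_monodromy w neg; have [aa ab] := alpha_monodromy w neg.
have [ea eb] := ev_monodromy.
have conj x u : alpha (gen x) = 0 -> alpha u = 0 ->
    ev u = rho gs *m rho x *m invmx (rho gs) ->
    (act (gw_inv u) - 1%:M) *m AdS = AdS *m (act (gw_inv (gen x)) - 1%:M).
  move=> ax au eu; rewrite mulmxBl mulmxBr mul1mx mulmx1; congr (_ - _).
  rewrite /gact !alphaV ax au oppr0 expr0z !scale1r -!map_mxM.
  have uev := unit_gw_eval det_rho.
  rewrite -(AdM two_neq0 (uev _) (ug _)) -(AdM two_neq0 (ug _) (uev _)).
  congr (map_mx _ (Ad _)); rewrite !(gw_evalV det_rho) eu.
  have -> : ev (gen x) = rho x by rewrite /= mulmx1.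
  rewrite !invmxM ?unitmx_mul ?unitmx_inv ?ug // invmxK -!mulmxA.
  by rewrite (mulVmx (ug gs)) mulmx1.
rewrite /M2 !mul_mx_row !mulmxA !d0_fox //.
by rewrite (conj ga) ?(conj gb) // /alpha big_cons big_nil.
Qed.

Let am := rho ga.
Let bm := rho gb.

Lemma det_commmx_neq0 : \det (commmx am bm) != 0.
Proof.
rewrite (det_commmx (det_rho ga) (det_rho gb)) subr_eq0 eq_sym.
move: irred; rewrite /longitude !gw_evalD !(gw_evalV det_rho) /= !mulmx1.
by rewrite !mulmxA.
Qed.

Let M3 := cols3 (tl_coord am) (tl_coord bm) (tl_coord (am *m bm)).
Let M3' := cols3 (tl_coord am) (tl_coord bm) (tl_coord (bm *m am)).

Lemma cycle_frame_left_inverse :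
  exists L : 'M_(3, 3 + 3), L *m cycle_frame rho iota t bs = 1%:M.
Proof.
have u3 : M3 \in unitmx.
  by rewrite unitmxE det_tl_coord3 // unitfE mulf_neq0 ?invr_eq0 // det_commmx_neq0.
have u3' : M3' \in unitmx.
  by rewrite unitmxE det_tl_coord3C // unitfE mulf_neq0 ?invr_eq0 ?oppr_eq0 // det_commmx_neq0.
(* The cycles of a, b, ab have a-components [M3] with column 1 set to zero, and b-components [M3']
   with column 0 set to zero. The former give back the coordinates 0 and 2, the latter the
   coordinate 1. *)
pose d1 : 'rV[C]_3 := \row_j (j != 1)%:R; pose d2 : 'rV[C]_3 := \row_j (j != 0)%:R.
pose d3 : 'rV[C]_3 := \row_j (j == 1)%:R.
pose L := row_mx (diag_mx d1 *m invmx M3) (diag_mx d3 *m invmx M3').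
exists (map_mx iota L).
have -> : cycle_frame rho iota t bs =
    map_mx iota (col_mx (M3 *m diag_mx d1) (M3' *m diag_mx d2)).
  rewrite /cycle_frame /bs [pi1_frame _ _]/= trace_cycle_ga trace_cycle_gb trace_cycle_gab.
  rewrite cols3_col_mx map_col_mx !mul_cols3_diag !map_cols3.
  by rewrite !mxE /= !scale0r !scale1r map_mx0.
rewrite -map_mxM mul_row_col !mulmxA -(mulmxA (diag_mx d1)) -(mulmxA (diag_mx d3)).
rewrite (mulVmx u3) (mulVmx u3') !mulmx1 !mulmx_diag -raddfD /=.
rewrite (_ : _ + _ = const_mx 1) ?diag_const_mx ?map_mx1 //.
by apply/matrixP => i; apply: forall_ord3; rewrite !mxE /= ?mulr0 ?mulr1 ?addr0 ?add0r.
Qed.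

(** Irreducibility makes the boundary map of the fibre surjective. *)
Lemma d0_right_inverse : exists E : 'M_(3 + 3, 3), d0 *m E = 1%:M.
Proof.
have ug x : rho x \in unitmx by rewrite unitmxE det_rho unitr1.
pose cm := commmx am bm.
pose Mm := cols3 (tl_coord (- cm)) (tl_coord (- (am *m cm))) (tl_coord (cm *m bm)).
have um : Mm \in unitmx.
  by rewrite unitmxE det_commmx3 // unitfE oppr_eq0 expf_neq0 // det_commmx_neq0.
(* Coefficients of the form [x Y] on the generator x have boundary [Y x - x Y]; the choices [Y = b],
   [Y = a b] on a and [Y = a b] on b produce the three columns of [Mm]. *)
pose E := col_mx (cols3 (tl_coord (am *m bm)) (tl_coord (am *m (am *m bm))) 0)
                 (cols3 0 0 (tl_coord (bm *m (am *m bm)))).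
exists (map_mx iota (E *m invmx Mm)); rewrite map_mxM mulmxA.
suff -> : d0 *m map_mx iota E = map_mx iota Mm by rewrite -map_mxM mulmxV // map_mx1.
have actB x Y : alpha (gen x) = 0 ->
    (act (gw_inv (gen x)) - 1%:M) *m map_mx iota (tl_coord (rho x *m Y)) =
    map_mx iota (tl_coord (Y *m rho x - rho x *m Y)).
  move=> ax; have axV : alpha (gw_inv (gen x)) = 0 by rewrite alphaV ax oppr0.
  rewrite mulmxBl mul1mx (gact_tlK two_neq0 det_rho iota t _ axV) (gw_evalV det_rho).
  rewrite /= mulmx1 invmxK (mulKmx (ug x)) (tl_coordD two_neq0) (tl_coordN two_neq0).
  by rewrite map_mxB.
have aga : alpha (gen ga) = 0 by rewrite /alpha big_cons big_nil.
have agb : alpha (gen gb) = 0 by rewrite /alpha big_cons big_nil.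
rewrite /E map_col_mx !map_cols3 !map_mx0 mul_row_col !mul_cols3 !mulmx0 !actB //.
rewrite -cols3D !addr0 !add0r.
have -> : bm *m rho ga - rho ga *m bm = - cm by rewrite /cm /commmx opprB.
have -> : am *m bm *m rho ga - rho ga *m (am *m bm) = - (am *m cm).
  by rewrite /cm /commmx mulmxBr !mulmxA opprB.
have -> // : am *m bm *m rho gb - rho gb *m (am *m bm) = cm *m bm.
by rewrite /cm /commmx mulmxBl !mulmxA.
Qed.

(** The 1-chains split into cycles, where the monodromy is the Jacobian, and a quotient isomorphic
    to the 0-chains. The factor of the 0-chains equals the minor of [d1] at s ([det_gact_gs]) and
    cancels in the torsion. *)
Lemma det_Dab :
  \det Dab = \det (t^-1%:M - map_mx iota (jac_prod w rho (size w))) *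
             \det (t^-1%:M - AdS).
Proof.
have [L LC] := cycle_frame_left_inverse; have [E dE] := d0_right_inverse.
have <- : \det (Dab *m block_mx AdS 0 0 AdS) = \det Dab.
  by rewrite det_mulmx det_ublock /AdS det_map_mx det_Ad // rmorph1 !mulr1.
rewrite Dab_AdS; apply: det_invariant_subspace LC dE.
- rewrite mulmxBl mulmxBr mul_scalar_mx mul_mx_scalar; congr (_ - _).
  by rewrite -(cycle_frame_monodromy two_neq0 w neg det_rho iota t_neq0) monodromy_cycle.
- by rewrite mulmxBl mulmxBr mul_scalar_mx mul_mx_scalar -d0_M2.
rewrite /cycle_frame mul_cols3 !d0_trace_cycle //.
- by apply/matrixP => i; apply: forall_ord3; rewrite !mxE.
- by rewrite /alpha !big_cons big_nil.
- by rewrite /alpha !big_cons big_nil.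
- by rewrite /alpha !big_cons big_nil.
Qed.

Lemma det_gact_gs : \det (act (gw_inv (gen gs)) - 1%:M) = \det (t^-1%:M - AdS).
Proof.
have <- : \det ((act (gw_inv (gen gs)) - 1%:M) *m AdS) = \det (act (gw_inv (gen gs)) - 1%:M).
  by rewrite det_mulmx /AdS det_map_mx det_Ad // rmorph1 mulr1.
by rewrite mulmxBl mul1mx gact_gs_inv.
Qed.

End Torsion.

(** The sizes [3 + (3 + 3)] and [6 + 3] are convertible; blocks written for the first are cut here
    according to the second, a and b against s. *)
Lemma usubmx_col_mx3 (R : Type) n (A B D : 'M[R]_(3, n)) :
  @usubmx R 6 3 n (col_mx A (col_mx B D)) = col_mx A B.
Proof.
have -> : col_mx A (col_mx B D) = @col_mx R 6 3 n (col_mx A B) D.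
  by rewrite col_mxA castmx_id.
by rewrite col_mxKu.
Qed.

Lemma rsubmx_row_mx3 (R : Type) n (A B D : 'M[R]_(n, 3)) :
  @rsubmx R n 6 3 (row_mx A (row_mx B D)) = D.
Proof.
have -> : row_mx A (row_mx B D) = @row_mx R n 6 3 (row_mx A B) D.
  by rewrite row_mxA castmx_id.
by rewrite row_mxKr.
Qed.

Lemma usubmx_row_mx (R : Type) m1 m2 n1 n2 (A : 'M[R]_(m1 + m2, n1)) (B : 'M_(m1 + m2, n2)) :
  usubmx (row_mx A B) = row_mx (usubmx A) (usubmx B).
Proof. by apply/matrixP => i j; rewrite !mxE; case: split => k; rewrite !mxE. Qed.

Lemma usubmx_row_col3 (R : Type) (A B D A' B' D' : 'M[R]_(3, 3)) :
  @usubmx R 6 3 6 (row_mx (col_mx A (col_mx B D)) (col_mx A' (col_mx B' D'))) =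
  row_mx (col_mx A B) (col_mx A' B').
Proof. by rewrite (@usubmx_row_mx R 6 3 3 3) !usubmx_col_mx3. Qed.

Lemma mulmx_row_mx_eq0 (R : comNzRingType) m n n1 n2
    (A : 'M[R]_(m, n)) (B : 'M_(n, n1)) (D : 'M_(n, n2)) :
  A *m B = 0 -> A *m D = 0 -> A *m row_mx B D = 0.
Proof. by move=> AB AD; rewrite mul_mx_row AB AD row_mx0. Qed.

(** * The torsion as a characteristic polynomial of the Jacobian *)

Section Alexander.
Variable C : fieldType.
Hypothesis two_neq0 : 2 != 0 :> C.
Variables (w : seq letter) (neg : bool).
Variable rho : 'I_3 -> 'M[C]_2.
Hypothesis det_rho : forall x, \det (rho x) = 1.
Hypothesis rel_a : gw_eval rho (relator_a w neg) = 1%:M.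
Hypothesis rel_b : gw_eval rho (relator_b w neg) = 1%:M.
Hypothesis irred : \tr (gw_eval rho longitude) != 2.
Notation K := (ratfrac C).
Notation t := (tvar C).
Let iota : {rmorphism C -> K} := @cst C.

Lemma tw_actE u : tw_act rho u = gact rho iota t u.
Proof. exact: erefl. Qed.

Lemma tw_foxE x u : tw_fox rho x u = gfox rho iota t x u.
Proof. by elim: u => [|y u IH]; [exact: erefl|cbn [tw_fox gfox]; rewrite IH]. Qed.

Lemma tw_d1_relator g :
  gw_eval rho g = 1%:M -> alpha g = 0 ->
  tw_d1 rho *m col_mx (tw_fox rho ga g) (col_mx (tw_fox rho gb g) (tw_fox rho gs g)) = 0.
Proof.
move=> eg ag; rewrite /tw_d1 !mul_row_col !tw_foxE !tw_actE addrA.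
rewrite -(sum_gens (fun x => (gact rho iota t (gw_inv (gen x)) - 1%:M) *m gfox rho iota t x g)).
rewrite (gfox_fundamental two_neq0 det_rho iota (tvar_neq0 C)).
rewrite /gact alphaV ag oppr0 expr0z scale1r (gw_evalV det_rho) eg invmx1 Ad1 map_mx1.
exact: subrr.
Qed.
Lemma twisted_alexanderP tau :
  is_twisted_alexander w neg rho tau <->
  tau = \det (t^-1%:M - map_mx iota (jac_prod w rho (size w))).
Proof.
have [aa ab] := alpha_monodromy w neg.
have ra : alpha (relator_a w neg) = 0.
  by rewrite /relator_a !alphaD !alphaV aa /alpha !big_cons !big_nil.
have rb : alpha (relator_b w neg) = 0.
  by rewrite /relator_b !alphaD !alphaV ab /alpha !big_cons !big_nil.
have dDab := det_Dab two_neq0 det_rho rel_a rel_b irred iota (tvar_neq0 C).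
have dgs := det_gact_gs two_neq0 det_rho iota (tvar_neq0 C).
have eu : @usubmx _ 6 3 6 (tw_d2 w neg rho) =
    row_mx (fox_fibre rho iota t (relator_a w neg)) (fox_fibre rho iota t (relator_b w neg)).
  have ef u : fox_fibre rho iota t u = col_mx (tw_fox rho ga u) (tw_fox rho gb u).
    by rewrite (tw_foxE ga u) (tw_foxE gb u).
  rewrite !ef; exact: usubmx_row_col3.
have er : @rsubmx _ 3 6 3 (tw_d1 rho) = gact rho iota t (gw_inv (gen gs)) - 1%:M.
  exact: rsubmx_row_mx3.
have n1 : \det (@rsubmx _ 3 6 3 (tw_d1 rho)) != 0.
  rewrite er dgs; apply: det_tvarV_sub.
  by rewrite unitmxE det_Ad // unitr1.
have detJ n : \det (jac_prod w rho n) = 1.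
  elim: n => [|n IH]; first exact: det1.
  rewrite [jac_prod _ _ _]/= det_mulmx IH mul1r det3.
  by case: letter_at; rewrite !mxE /=; ring.
have n2 : \det (t^-1%:M - map_mx iota (jac_prod w rho (size w))) != 0.
  by apply: det_tvarV_sub; rewrite unitmxE detJ unitr1.
have n3 : \det (@usubmx _ 6 3 6 (tw_d2 w neg rho)) != 0.
  by rewrite eu dDab; apply: mulf_neq0 n2 _; rewrite -dgs -er.
have d12 : @mulmx _ 3 9 6 (tw_d1 rho) (tw_d2 w neg rho) = 0.
  exact: mulmx_row_mx_eq0 (tw_d1_relator rel_a ra) (tw_d1_relator rel_b rb).
have := @is_torsionP K 3 6 (tw_d2 w neg rho) (tw_d1 rho) tau d12 n1 n3.
rewrite eu er dDab -dgs -er (mulrC (\det (_ - _))) (mulKf n1); exact.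
Qed.
End Alexander.

(** * Layered states *)

Section LayeredStates.
Variable R : comUnitRingType.

Definition mx3 (s : seq (seq R)) : 'M[R]_3 :=
  \matrix_(i < 3, j < 3) nth 0 (nth [::] s i) j.

(* A state lists the weights accumulated so far around the edges h, v and d of a
   layer. A letter renames h and v, and leaves d to the new edge. *)
Definition letter_shift (l : letter) : 'M[R]_3 :=
  if l is LetR then mx3 [:: [:: 1; 0; 0]; [:: 0; 0; 1]; [:: 0; 0; 0]]
  else mx3 [:: [:: 0; 0; 1]; [:: 0; 1; 0]; [:: 0; 0; 0]].

(** Reads the weight of the edge that the letter exchanges, v for R and h for L. *)
Definition letter_kill (l : letter) : 'rV[R]_3 :=
  if l is LetR then delta_mx 0 1 else delta_mx 0 0.

Fixpoint layer_state m (l : nat -> letter) (s0 : 'M[R]_(3, m))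
    (Y : nat -> 'M[R]_(3, m)) (n : nat) : 'M[R]_(3, m) :=
  if n is k.+1 then letter_shift (l k) *m layer_state l s0 Y k + Y k else s0.

Definition shift_prod (l : nat -> letter) n : 'M[R]_3 :=
  layer_state l 1%:M (fun=> 0) n.

Lemma layer_stateE m l (s0 : 'M[R]_(3, m)) Y n :
  layer_state l s0 Y n = shift_prod l n *m s0 + layer_state l 0 Y n.
Proof.
elim: n => [|n IH]; first by rewrite /shift_prod /= addr0 mul1mx.
by rewrite /shift_prod /= {}IH mulmxDr mulmxA addr0 addrA.
Qed.

Lemma letter_shift_trig l (i j : 'I_3) : (j <= i)%N ->
  letter_shift l i j = (i == j)%:R * letter_shift l i i.
Proof.
case: l; move: i j; apply: forall_ord3; apply: forall_ord3; rewrite !mxE /= => // _;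
  by rewrite ?mulr1 ?mulr0 ?mul0r.
Qed.

Lemma shift_prod_trig l n (i j : 'I_3) : (j <= i)%N ->
  shift_prod l n i j = (i == j)%:R * \prod_(k < n) letter_shift (l k) i i.
Proof.
elim: n i j => [|n IH] i j ji; first by rewrite big_ord0 mulr1 mxE.
rewrite /shift_prod /= addr0 mxE (bigD1 i) //= [in LHS]big1 ?addr0.
  rewrite -/(shift_prod l n) IH // big_ord_recr /=; ring.
move=> k ki; have [ik|ki'] := ltnP k i.
  by rewrite letter_shift_trig 1?ltnW // eq_sym (negbTE ki) !mul0r.
rewrite -/(shift_prod l n) IH ?(leq_trans ji) // (_ : (k == j) = false) ?mul0r ?mulr0 //.
apply/negbTE; move: ki; rewrite -!val_eqE /= => ki.
by rewrite neq_ltn orbC (leq_ltn_trans ji) // ltn_neqAle eq_sym ki.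
Qed.

(** Shifts are upper triangular, with diagonal (1, 0, 0) for R and (0, 1, 0) for L; once both
    letters occur, the product has zero diagonal and is nilpotent. *)
Lemma det_shift_prod l N t :
  (exists2 k, (k < N)%N & l k = LetR) -> (exists2 k, (k < N)%N & l k = LetL) ->
  \det (t%:M - shift_prod l N) = t ^+ 3.
Proof.
move=> [kr ltr lr] [kl ltl ll].
have diag0 (i : 'I_3) : \prod_(k < N) letter_shift (l k) i i = 0.
  have prod0 k (kN : (k < N)%N) : letter_shift (l k) i i = 0 ->
      \prod_(k < N) letter_shift (l k) i i = 0.
    by move=> e; rewrite (bigD1 (Ordinal kN)) //= e mul0r.
  move: i prod0; apply: forall_ord3 => prod0.
  - by apply: (prod0 kl) => //; rewrite ll mxE.
  - by apply: (prod0 kr) => //; rewrite lr mxE.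
  - by apply: (prod0 kr) => //; rewrite lr mxE.
rewrite -det_tr det_trig.
  under eq_bigr => i _ do
    rewrite !mxE eqxx mulr1n shift_prod_trig // diag0 mulr0 subr0.
  by rewrite prodr_const card_ord.
apply/is_trig_mxP => i j ij; rewrite !mxE shift_prod_trig 1?ltnW // diag0 mulr0 subr0.
by rewrite (_ : (j == i) = false) //; apply/negbTE; rewrite -val_eqE /= neq_ltn ij orbT.
Qed.

(** The initial state that gets multiplied by [t] over a period. It accounts for the weights
    received below level 0 by the edges still present there. *)
Definition periodic_start m l (Y : nat -> 'M[R]_(3, m)) N t : 'M[R]_(3, m) :=
  invmx (t%:M - shift_prod l N) *m layer_state l 0 Y N.

Section Periodic.
Variables (m : nat) (l : nat -> letter) (Y : nat -> 'M[R]_(3, m)) (N : nat) (t : R).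
Hypothesis t_unit : t \is a GRing.unit.
Hypothesis l_per : forall n, l (n + N)%N = l n.
Hypothesis Y_per : forall n, Y (n + N)%N = t *: Y n.
Hypothesis has_R : exists2 k, (k < N)%N & l k = LetR.
Hypothesis has_L : exists2 k, (k < N)%N & l k = LetL.
Notation s0 := (periodic_start l Y N t).

Lemma periodic_startP : layer_state l s0 Y N = t *: s0.
Proof.
have u : t%:M - shift_prod l N \in unitmx.
  by rewrite unitmxE det_shift_prod // unitrX.
have := mulKVmx u (layer_state l 0 Y N); rewrite -/s0 mulmxBl mul_scalar_mx => e.
by rewrite layer_stateE -e addrC subrK.
Qed.

Lemma layer_state_periodic n :
  layer_state l s0 Y (n + N) = t *: layer_state l s0 Y n.
Proof.
elim: n => [|n IH]; first by rewrite add0n periodic_startP.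
by rewrite addSn /= IH l_per Y_per scalerDr scalemxAr.
Qed.

End Periodic.

Section Feedback.
Variables (l : nat -> letter) (y : nat -> 'cV[R]_3) (N : nat) (t : R).
Hypothesis t_unit : t \is a GRing.unit.
Hypothesis has_R : exists2 k, (k < N)%N & l k = LetR.
Hypothesis has_L : exists2 k, (k < N)%N & l k = LetL.

(** Evolution of the state when each input is chosen so that the residual vanishes: feedback by
    minus the weight of the exchanged edge. *)
Fixpoint closed_prod n : 'M[R]_3 :=
  if n is k.+1 then (letter_shift (l k) - y k *m letter_kill (l k)) *m closed_prod k
  else 1%:M.

(** The equation of the edge exchanged on entering tetrahedron [n]: its accumulated weight plus the
    last contribution, with weight 1, as lower diagonal of this tetrahedron. *)
Definition residual m (s0 : 'M[R]_(3, m)) (u : nat -> 'rV[R]_m) n : 'rV[R]_m :=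
  letter_kill (l n) *m layer_state l s0 (fun k => y k *m u k) n + u n.

Definition residual_mx m (s0 : 'M[R]_(3, m)) u : 'M[R]_(N, m) :=
  \matrix_(i, j) residual s0 u i 0 j.

Definition input m (M : 'M[R]_(N, m)) (n : nat) : 'rV[R]_m :=
  if insub n is Some i then row i M else 0.

Lemma inputE m (M : 'M[R]_(N, m)) (i : 'I_N) : input M i = row i M.
Proof. by rewrite /input valK. Qed.

Lemma input_mul m (M : 'M[R]_(N, m)) n : input M n = input 1%:M n *m M.
Proof.
by rewrite /input; case: insubP => [i _ _|_]; rewrite ?mul0mx // -row_mul mul1mx.
Qed.

Lemma layer_state_linear m (M : 'M[R]_(N, m)) s0 n :
  layer_state l s0 (fun k => y k *m input M k) n =
  layer_state l 0 (fun k => y k *m input 1%:M k) n *m M + shift_prod l n *m s0.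
Proof.
rewrite layer_stateE addrC; congr (_ + _).
elim: n => [|n IH] /=; first by rewrite mul0mx.
by rewrite {}IH mulmxDl -!mulmxA -input_mul.
Qed.

Lemma residual_linear m (M : 'M[R]_(N, m)) s0 :
  residual_mx s0 (input M) =
  residual_mx 0 (input 1%:M) *m M + residual_mx 1%:M (fun=> 0) *m s0.
Proof.
apply/row_matrixP => i; rewrite linearD /= !row_mul.
have rowE k (s : 'M_(3, k)) u : row i (residual_mx s u) = residual s u i.
  by apply/rowP => j; rewrite !mxE.
rewrite !rowE /residual layer_state_linear mulmxDr mulmxDl addr0 -!mulmxA -input_mul.
rewrite (_ : layer_state l 1%:M _ i = shift_prod l i) 1?addrAC //.
by elim: (val i) => //= n ->; rewrite mulmx0.
Qed.

Lemma closed_loop n : (n <= N)%N ->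
  layer_state l 1%:M
    (fun k => y k *m input (\matrix_(i < N) - (letter_kill (l i) *m closed_prod i)) k) n
  = closed_prod n.
Proof.
elim: n => //= n IH ltn; rewrite IH 1?ltnW //.
rewrite -[n in input _ n]/(val (Ordinal ltn)) inputE rowK /=.
by rewrite mulmxBl mulmxN mulmxA.
Qed.

(** The block matrix [[U, W; Yd, Z]] sends inputs and an initial state to the residuals and to the
    defect of quasi-periodicity. Correcting each input by its state [s0] clears the defect;
    correcting each initial state by the feedback [X] clears the residuals. Comparing the
    determinants gives the identity, since [U] is unitriangular. *)
Lemma det_feedback :
  let s0 := periodic_start l (fun k => y k *m input 1%:M k) N t in
  \det (residual_mx s0 (input 1%:M)) * \det (shift_prod l N - t%:M) =
  \det (closed_prod N - t%:M).
Proof.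
move=> s0; pose Z := shift_prod l N - t%:M.
pose U := residual_mx 0 (input 1%:M); pose W := residual_mx 1%:M (fun=> 0 : 'rV_3).
pose Yd := layer_state l 0 (fun k => y k *m input 1%:M k) N.
pose X := \matrix_(i < N) - (letter_kill (l i) *m closed_prod i).
have uZ : t%:M - shift_prod l N \in unitmx.
  by rewrite unitmxE det_shift_prod // unitrX.
have e1 : block_mx U W Yd Z *m block_mx 1%:M 0 s0 1%:M =
    block_mx (residual_mx s0 (input 1%:M)) W 0 Z.
  rewrite mulmx_block !mulmx1 !mulmx0 !add0r residual_linear mulmx1.
  congr block_mx; rewrite /Z -opprB mulNmx mulmxA mulmxV // mul1mx.
  exact: subrr.
have e2 : block_mx U W Yd Z *m block_mx 1%:M X 0 1%:M =
    block_mx U 0 Yd (closed_prod N - t%:M).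
  rewrite mulmx_block !mulmx1 !mulmx0 !addr0; congr block_mx.
    rewrite -[W]mulmx1 -residual_linear; apply/matrixP => i j.
    rewrite [LHS]mxE [RHS]mxE /residual closed_loop 1?ltnW //.
    by rewrite inputE rowK subrr mxE.
  rewrite /Z addrA; congr (_ - _).
  by rewrite -[shift_prod _ _]mulmx1 -layer_state_linear closed_loop.
have detU : \det U = 1.
  (* Causality: an input influences only later states. *)
  have U0 n (j : 'I_N) i : (n <= j)%N ->
      layer_state l 0 (fun k => y k *m input 1%:M k) n i j = 0.
    elim: n i => [|n IH] i nj; first by rewrite mxE.
    rewrite /= mxE [X in _ + X]mxE big1 ?addr0; last first.
      move=> k _; rewrite (ord1 k) /input; case: insubP => [i' _ e|_]; rewrite !mxE ?mulr0 //.
      by rewrite (_ : (i' == j) = false) ?mulr0 // -val_eqE /= e ltn_eqF.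
    by rewrite mxE big1 // => k _; rewrite IH ?mulr0 // ltnW.
  have Ur (i j : 'I_N) : (i <= j)%N -> U i j = (i == j)%:R.
    move=> ij; rewrite !mxE big1 ?add0r => [|k _]; last by rewrite U0 ?mulr0.
    by rewrite inputE !mxE.
  rewrite det_trig; first by rewrite big1 // => i _; rewrite Ur // eqxx.
  apply/is_trig_mxP => i j ij; rewrite Ur 1?ltnW //.
  by rewrite (_ : (i == j) = false) // -val_eqE /= ltn_eqF.
move: (congr1 determinant e1) (congr1 determinant e2).
rewrite !det_mulmx !det_ublock !det_lblock !det1 !mulr1 => <- ->.
by rewrite detU mul1r.
Qed.

End Feedback.

End LayeredStates.

(** * Slopes and edges of the layered triangulation *)

Definition vdet (u v : vec) : int := u.1 * v.2 - u.2 * v.1.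

Lemma vdetDl u u' v : vdet (u + u') v = vdet u v + vdet u' v.
Proof. by rewrite /vdet /=; ring. Qed.

Lemma vdetDr u v v' : vdet u (v + v') = vdet u v + vdet u v'.
Proof. by rewrite /vdet /=; ring. Qed.

Lemma vdetNl u v : vdet (- u) v = - vdet u v.
Proof. by rewrite /vdet /=; ring. Qed.

Lemma vdetNr u v : vdet u (- v) = - vdet u v.
Proof. by rewrite /vdet /=; ring. Qed.

Lemma vdetvv u : vdet u u = 0.
Proof. by rewrite /vdet; ring. Qed.

Lemma vdetC u v : vdet u v = - vdet v u.
Proof. by rewrite /vdet; ring. Qed.

Lemma same_slope_vdet u v : vdet u v != 0 -> same_slope u v = false.
Proof.
move=> nz; apply/negbTE; apply: contra nz => /orP[]/eqP->.
  by rewrite vdetvv.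
by rewrite vdetNl vdetvv oppr0.
Qed.

Lemma same_slopexx u : same_slope u u.
Proof. by rewrite /same_slope eqxx. Qed.

Lemma same_slopeNr u v : same_slope u (- v) = same_slope u v.
Proof. by rewrite /same_slope opprK orbC. Qed.

Lemma same_slope_sym u v : same_slope u v = same_slope v u.
Proof. by rewrite /same_slope eq_sym (eq_sym u) eqr_oppLR. Qed.

Lemma same_slopeN u v w : same_slope u v -> same_slope u w = same_slope v w.
Proof.
move=> /orP[]/eqP->//; rewrite same_slope_sym same_slopeNr.
by rewrite same_slope_sym.
Qed.

Section Frames.
Variable w : seq letter.
Notation N := (size w).
Notation h := (hvec w).
Notation v := (vvec w).
Notation d := (dvec w).

Lemma letter_at_periodic i m : letter_at w (i + N%:Z * m) = letter_at w i.
Proof. by rewrite /letter_at addrAC addrC mulrC modzMDl. Qed.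

Lemma frame_prevK l b : frame_next l (frame_prev l b) = b.
Proof. by case: l b => -[b1 b2] /=; rewrite ?subrK // addrC subrK. Qed.

Lemma frameS i : frame w (i + 1) = frame_next (letter_at w i) (frame w i).
Proof.
case: i => n; first by rewrite -PoszD addn1.
case: n => [|n].
  by rewrite [in RHS]/= frame_prevK.
have -> : Negz n.+1 + 1 = Negz n by rewrite !NegzE; lia.
by rewrite [in RHS]/frame [frame_neg _ n.+2]/= NegzE frame_prevK.
Qed.

Lemma framesE i : (letter_at w i = LetR /\ h (i + 1) = h i /\ v (i + 1) = d i) \/
                  (letter_at w i = LetL /\ h (i + 1) = d i /\ v (i + 1) = v i).
Proof.
by rewrite /dvec /hvec /vvec frameS; case: letter_at; [left|right]; case: (frame w i).
Qed.

Lemma hvecS i : h (i + 1) = if letter_at w i is LetR then h i else d i.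
Proof. by case: (framesE i) => -[-> [-> _]]. Qed.

Lemma vvecS i : v (i + 1) = if letter_at w i is LetR then d i else v i.
Proof. by case: (framesE i) => -[-> [_ ->]]. Qed.

Lemma int_shift_ind (P : int -> Prop) : P 0 -> (forall i, P i <-> P (i + 1)) -> forall i, P i.
Proof.
move=> P0 PS; elim/int_rect => [//|n IH|n IH].
  by rewrite -addn1 PoszD; apply: (PS _).1.
by apply: (PS _).2; rewrite (_ : _ + 1 = - n%:Z) //; lia.
Qed.

Lemma vdet_frame i : vdet (h i) (v i) = 1.
Proof.
elim/int_shift_ind: i => [//|i].
rewrite hvecS vvecS /dvec; case: letter_at;
  by rewrite ?vdetDl ?vdetDr vdetvv ?add0r ?addr0.
Qed.

(** In the basis of level i, later frames have nonnegative coordinates, since letters only add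
    vectors. *)
Lemma frames_after i n : [/\ 0 <= vdet (h (i + n%:Z)) (v i), 0 <= vdet (h i) (h (i + n%:Z)),
  0 <= vdet (v (i + n%:Z)) (v i) & 0 <= vdet (h i) (v (i + n%:Z))].
Proof.
elim: n => [|n [a1 a2 a3 a4]]; first by rewrite addr0 !vdetvv vdet_frame.
rewrite -addn1 PoszD addrA hvecS vvecS /dvec.
by case: letter_at; split; rewrite ?vdetDl ?vdetDr //; apply: addr_ge0.
Qed.

(** Dually, in a later basis the vectors of level j have coordinates of opposite signs. *)
Lemma frames_before j n : [/\ 0 <= vdet (h j) (v (j + n%:Z)), vdet (h (j + n%:Z)) (h j) <= 0,
  vdet (v j) (v (j + n%:Z)) <= 0 & 0 <= vdet (h (j + n%:Z)) (v j)].
Proof.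
elim: n => [|n [a1 a2 a3 a4]]; first by rewrite addr0 !vdetvv vdet_frame.
rewrite -addn1 PoszD addrA hvecS vvecS /dvec.
have := vdetC (h j) (h (j + n%:Z)); have := vdetC (v j) (h (j + n%:Z)).
have := vdetC (v (j + n%:Z)) (h j); have := vdetC (v (j + n%:Z)) (v j).
case: letter_at => e1 e2 e3 e4; split; rewrite ?vdetDl ?vdetDr; lra.
Qed.

Definition incidence (e : vec) (j : int) (p : 'Z_3) : nat :=
  count (same_slope e) (tet_edges w j p).

Lemma forall_Z3 (P : 'Z_3 -> Prop) : P 0 -> P 1 -> P 2 -> forall i, P i.
Proof. exact: forall_ord3. Qed.

Lemma edge_not_below (i j : int) p : j < i -> incidence (d i) j p = 0%N.
Proof.
move=> ji; have [n ei] : exists n : nat, i = j + n%:Z + 1.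
  by exists (absz (i - j - 1)%R); lia.
have i_eq : i = j + (n + 1)%N%:Z by rewrite PoszD addrA.
have i_eq' : i = j + 1 + n%:Z by rewrite ei; lia.
have [b1 b2 b3 b4] := frames_before j (n + 1); rewrite -i_eq in b1 b2 b3 b4.
have [c1 c2 c3 c4] := frames_before (j + 1) n; rewrite -i_eq' in c1 c2 c3 c4.
(* In the frame of level i the direction d_i is (1, 1), and the edges of the
   lower tetrahedra have coordinates of opposite signs. *)
have neq e : vdet e (v i) * vdet (h i) e <= 0 -> same_slope (d i) e = false.
  move=> le0; apply/negbTE; apply/negP => /orP[]/eqP ed.
    move: le0; rewrite -ed /dvec vdetDl vdetDr !vdetvv vdet_frame; lia.
  have ee : e = - d i by rewrite ed opprK.
  move: le0; rewrite ee vdetNl vdetNr /dvec vdetDl vdetDr !vdetvv vdet_frame; lia.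
have nh : same_slope (d i) (h j) = false by apply: neq; exact: mulr_ge0_le0.
have nv : same_slope (d i) (v j) = false by apply: neq; exact: mulr_le0_ge0.
have nd : same_slope (d i) (d j) = false.
  case: (framesE j) => -[_ [eh ev]].
    by rewrite -ev; apply: neq; exact: mulr_le0_ge0.
  by rewrite -eh; apply: neq; exact: mulr_ge0_le0.
have nl : same_slope (d i) (h j - v j) = false.
  apply: neq; rewrite vdetDl vdetDr vdetNl vdetNr.
  by apply: mulr_ge0_le0; lia.
by move: p; apply: forall_Z3; rewrite /incidence /= ?nh ?nv ?nd ?nl.
Qed.

Lemma edge_not_above (i j : int) e p :
  i < j -> same_slope e (h i - v i) -> incidence e j p = 0%N.
Proof.
move=> ij se; have [n ei] : exists n : nat, j = i + n%:Z + 1.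
  by exists (absz (j - i - 1)%R); lia.
have j_eq : j = i + (n + 1)%N%:Z by rewrite PoszD addrA.
have [b1 b2 b3 b4] := frames_after i (n + 1); rewrite -j_eq in b1 b2 b3 b4.
have [c1 c2 c3 c4] := frames_after i n.
(* In the basis of level i the lower diagonal is (1, -1) up to sign, while all later edges have
   coordinates of equal signs. *)
have neq f : 0 <= vdet f (v i) * vdet (h i) f -> same_slope e f = false.
  move=> ge0; rewrite (same_slopeN _ se); apply/negbTE; apply/negP => /orP[]/eqP ed.
    move: ge0; rewrite -ed vdetDl vdetDr vdetNl vdetNr !vdetvv vdet_frame; lia.
  have ee : f = - (h i - v i) by rewrite ed opprK.
  move: ge0; rewrite ee vdetNl vdetNr vdetDl vdetDr vdetNl vdetNr !vdetvv vdet_frame; lia.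
have nh : same_slope e (h j) = false by apply: neq; exact: mulr_ge0.
have nv : same_slope e (v j) = false by apply: neq; exact: mulr_ge0.
have nd : same_slope e (d j) = false.
  by apply: neq; rewrite vdetDl vdetDr; apply: mulr_ge0; apply: addr_ge0.
have nl : same_slope e (h j - v j) = false.
  rewrite ei hvecS vvecS /dvec; case: letter_at.
    by rewrite opprD addrA subrr sub0r same_slopeNr; apply: neq; exact: mulr_ge0.
  by rewrite addrK; apply: neq; exact: mulr_ge0.
by move: p; apply: forall_Z3; rewrite /incidence /= ?nh ?nv ?nd ?nl.
Qed.

Lemma incidence_h j p : incidence (h j) j p = if p == 0 then 2%N else 0%N.
Proof.
have f := vdet_frame j.
have n1 : same_slope (h j) (d j) = false.
  by apply: same_slope_vdet; rewrite vdetDr vdetvv f.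
have n2 : same_slope (h j) (h j - v j) = false.
  by apply: same_slope_vdet; rewrite vdetDr vdetNr vdetvv f.
have n3 : same_slope (h j) (v j) = false by apply: same_slope_vdet; rewrite f.
by move: p; apply: forall_Z3; rewrite /incidence /= ?same_slopexx ?n1 ?n2 ?n3.
Qed.

Lemma incidence_v j p : incidence (v j) j p = if p == 2 then 2%N else 0%N.
Proof.
have f : vdet (v j) (h j) = - 1 by rewrite vdetC vdet_frame.
have n1 : same_slope (v j) (d j) = false.
  by apply: same_slope_vdet; rewrite vdetDr vdetvv f.
have n2 : same_slope (v j) (h j - v j) = false.
  by apply: same_slope_vdet; rewrite vdetDr vdetNr vdetvv f.
have n3 : same_slope (v j) (h j) = false by apply: same_slope_vdet; rewrite f.
by move: p; apply: forall_Z3; rewrite /incidence /= ?same_slopexx ?n1 ?n2 ?n3.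
Qed.

Lemma incidence_d j p : incidence (d j) j p = if p == 1 then 1%N else 0%N.
Proof.
have f := vdet_frame j; have f' : vdet (v j) (h j) = - 1 by rewrite vdetC f.
have n1 : same_slope (d j) (h j) = false.
  by apply: same_slope_vdet; rewrite vdetDl vdetvv f'.
have n2 : same_slope (d j) (h j - v j) = false.
  by apply: same_slope_vdet; rewrite vdetDl !vdetDr !vdetNr !vdetvv f f'.
have n3 : same_slope (d j) (v j) = false.
  by apply: same_slope_vdet; rewrite vdetDl vdetvv f.
by move: p; apply: forall_Z3; rewrite /incidence /= ?same_slopexx ?n1 ?n2 ?n3.
Qed.

Lemma incidence_low j e p : same_slope e (h j - v j) ->
  incidence e j p = if p == 1 then 1%N else 0%N.
Proof.
move=> se; have f := vdet_frame j; have f' : vdet (v j) (h j) = - 1 by rewrite vdetC f.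
have n1 : same_slope e (h j) = false.
  by rewrite (same_slopeN _ se); apply: same_slope_vdet; rewrite vdetDl vdetNl vdetvv f'.
have n2 : same_slope e (d j) = false.
  rewrite (same_slopeN _ se); apply: same_slope_vdet.
  by rewrite vdetDl vdetNl !vdetDr !vdetvv f f'.
have n3 : same_slope e (v j) = false.
  by rewrite (same_slopeN _ se); apply: same_slope_vdet; rewrite vdetDl vdetNl vdetvv f.
by move: p; apply: forall_Z3; rewrite /incidence /= ?se ?n1 ?n2 ?n3.
Qed.

End Frames.

(** * Deck transformations acting on slopes *)

Section FrameShift.
Variable w : seq letter.
Notation N := (size w).
Notation h := (hvec w).
Notation v := (vvec w).
Notation d := (dvec w).

Definition frame_map (b : vec * vec) (u : vec) : vec :=
  (u.1 * b.1.1 + u.2 * b.2.1, u.1 * b.1.2 + u.2 * b.2.2).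

Lemma frame_mapD b u u' : frame_map b (u + u') = frame_map b u + frame_map b u'.
Proof. by rewrite /frame_map /=; congr pair => /=; ring. Qed.

Lemma frame_mapN b u : frame_map b (- u) = - frame_map b u.
Proof. by rewrite /frame_map /=; congr pair => /=; ring. Qed.

Lemma frame_map_inj b : vdet b.1 b.2 = 1 -> injective (frame_map b).
Proof.
rewrite /vdet => b1 [u1 u2] [u3 u4] [] /= e1 e2; congr pair.
  rewrite -[u1]mulr1 -[u3]mulr1 -b1; move: e1 e2 => /eqP; rewrite -subr_eq0 => /eqP e1.
  move=> /eqP; rewrite -subr_eq0 => /eqP e2; apply/eqP; rewrite -subr_eq0; apply/eqP.
  transitivity (b.2.2 * 0 - b.2.1 * 0); last by rewrite !mulr0 subrr.
  by rewrite -{1}e1 -e2; ring.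
rewrite -[u2]mulr1 -[u4]mulr1 -b1; move: e1 e2 => /eqP; rewrite -subr_eq0 => /eqP e1.
move=> /eqP; rewrite -subr_eq0 => /eqP e2; apply/eqP; rewrite -subr_eq0; apply/eqP.
transitivity (b.1.1 * 0 - b.1.2 * 0); last by rewrite !mulr0 subrr.
by rewrite -{1}e2 -e1; ring.
Qed.

(** Both sides follow the same periodic letters and agree at level 0, where the frame is the
    standard basis. *)
Lemma frame_shift m i :
  h (i + N%:Z * m) = frame_map (frame w (N%:Z * m)) (h i) /\
  v (i + N%:Z * m) = frame_map (frame w (N%:Z * m)) (v i).
Proof.
set G := frame_map _.
have GD u u' : G (u + u') = G u + G u' by exact: frame_mapD.
elim/int_shift_ind: i => [|i].
  by rewrite add0r /G /frame_map /hvec /vvec; case: (frame w _) => -[a b] [c e] /=;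
     split; congr pair; ring.
rewrite addrAC !hvecS !vvecS letter_at_periodic /dvec; case: letter_at; rewrite !GD.
  split=> [[-> ->] //|[-> e]]; split=> //.
  exact: (@addrI _ (G (h i)) _ _ e).
split=> [[-> ->] //|[e ev]]; split=> //; rewrite ev in e.
exact: (@addIr _ (G (v i)) _ _ e).
Qed.

Lemma incidence_shift m i j p :
  incidence w (d (i + N%:Z * m)) (j + N%:Z * m) p = incidence w (d i) j p.
Proof.
have [hi vi] := frame_shift m i; have [hj vj] := frame_shift m j.
set G := frame_map _ in hi vi hj vj.
have GD u u' : G (u + u') = G u + G u' by exact: frame_mapD.
have GN u : G (- u) = - G u by exact: frame_mapN.
have GI : injective G by apply: frame_map_inj; exact: vdet_frame.
have sG u u' : same_slope (G u) (G u') = same_slope u u'.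
  by rewrite /same_slope -GN !(inj_eq GI).
move: p; apply: forall_Z3; rewrite /incidence /= /dvec ?hi ?vi ?hj ?vj -?GN -?GD ?sG //.
Qed.

End FrameShift.

Definition is_R (l : letter) := if l is LetR then true else false.

(** * The life of an edge *)

Section EdgeTracking.
Variable w : seq letter.
Notation N := (size w).
Notation h := (hvec w).
Notation v := (vvec w).
Notation d := (dvec w).
Notation lt n := (letter_at w (n%:Z - 1)).

(** The boolean stands for a letter, as in [is_R]: R exchanges v, L exchanges h. *)
Definition exchanged (c : bool) (i : int) : vec := if c then v i else h i.

Definition exchanged_label (c : bool) : 'Z_3 := if c then 2 else 0.

Definition edge_weight (V : nmodType) (T : nat -> 'Z_3 -> V) (e : vec) (n : nat) : V :=
  \sum_(p : 'Z_3) T n p *+ incidence w e n%:Z p.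

(* State of index n + 1: weights around the edges of level n. *)
Definition layered (V : nmodType) (T : nat -> 'Z_3 -> V) (s : bool -> nat -> V)
    (sd : nat -> V) : Prop :=
  forall n, sd n.+1 = T n 1 /\
    forall c, s c n.+1 = (if is_R (lt n) == c then sd n else s c n)
                       + T n (exchanged_label c) *+ 2.

Lemma exchangedS c i :
  exchanged c (i + 1) = if is_R (letter_at w i) == c then d i else exchanged c i.
Proof. by rewrite /exchanged hvecS vvecS; case: c; case: letter_at. Qed.

Lemma exchanged_low i : same_slope (exchanged (is_R (letter_at w i)) i)
                                   (h (i + 1) - v (i + 1)).
Proof.
rewrite /exchanged hvecS vvecS /dvec; case: letter_at => /=.
  by rewrite opprD addrA subrr sub0r same_slopeNr same_slopexx.
by rewrite addrK same_slopexx.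
Qed.

Lemma sum_Z3 (V : nmodType) (F : 'Z_3 -> V) : \sum_p F p = F 0 + F 1 + F 2.
Proof. exact: sum_ord3. Qed.

Lemma edge_weight_d V T (n : nat) : @edge_weight V T (d n) n = T n 1.
Proof.
by rewrite /edge_weight sum_Z3 !incidence_d /= !mulr0n addr0 add0r.
Qed.

Lemma edge_weight_exchanged V T c (n : nat) :
  @edge_weight V T (exchanged c n) n = T n (exchanged_label c) *+ 2.
Proof.
rewrite /edge_weight sum_Z3 /exchanged /exchanged_label.
by case: c; rewrite ?incidence_v ?incidence_h /= !mulr0n ?add0r ?addr0.
Qed.

Lemma edge_weight_low V T e (n : nat) : same_slope e (h n - v n) -> @edge_weight V T e n = T n 1.
Proof.
by move=> se; rewrite /edge_weight sum_Z3 !(incidence_low _ se) /= !mulr0n addr0 add0r.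
Qed.

(** The letter at [b] gives the new diagonal its role, v for R and h for L. The edge keeps it until
    the same letter recurs, at most [N] steps later by periodicity; the next tetrahedron [n] has it
    as lower diagonal. Until then its weight is a coordinate of the state. *)
Lemma edge_lifetime (b : nat) : (0 < N)%N ->
  exists n : nat, [/\ (b < n <= b + N + 1)%N, same_slope (d b) (h n - v n) &
    forall V T s sd, @layered V T s sd ->
      \sum_(j < N.+2) edge_weight T (d b) (b + j) = s (is_R (lt n)) n + T n 1].
Proof.
move=> N0; pose c := is_R (letter_at w b%:Z).
have exk : exists k, (0 < k)%N && (is_R (letter_at w (b + k)%N%:Z) == c).
  exists N; rewrite N0 /c /= (_ : (b + N)%N%:Z = b%:Z + N%:Z * 1).
    by rewrite letter_at_periodic.
  by rewrite mulr1 PoszD.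
case: (ex_minnP exk) => k0 /andP[k0_gt0 /eqP ck0] min_k0.
have k0N : (k0 <= N)%N.
  apply: min_k0; rewrite N0 /c /= (_ : (b + N)%N%:Z = b%:Z + N%:Z * 1).
    by rewrite letter_at_periodic.
  by rewrite mulr1 PoszD.
have ltS n : lt n.+1 = letter_at w n%:Z by rewrite -addn1 PoszD addrK.
have alive k : (k < k0)%N -> exchanged c (b + k.+1)%N%:Z = d b.
  elim: k => [_|k IH kk0]; rewrite addnS -addn1 PoszD exchangedS ?addn0 ?eqxx //.
  case: eqP => [e|_]; last exact: IH (ltnW kk0).
  have := min_k0 k.+1; rewrite e eqxx => /(_ isT); lia.
have state V T s sd (L : @layered V T s sd) k : (k < k0)%N ->
    s c (b + k.+2)%N = \sum_(j < k.+2) edge_weight T (d b) (b + j).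
  elim: k => [|k IH] kk0.
    rewrite !big_ord_recl big_ord0 addr0 /= /bump /= addn0 addn1 addn2.
    have [_ ->] := L b.+1; rewrite ltS eqxx; have [-> _] := L b.
    have al := alive 0%N kk0; rewrite addn1 in al.
    by rewrite edge_weight_d -al edge_weight_exchanged.
  rewrite big_ord_recr /= -IH 1?ltnW // addnS; have [_ ->] := L (b + k.+2)%N.
  rewrite [(b + k.+2)%N]addnS ltS; case: eqP => [e|_].
    have := min_k0 k.+1; rewrite e eqxx => /(_ isT); lia.
  by rewrite -addnS -(alive k.+1) // edge_weight_exchanged.
have k0E : k0 = k0.-1.+1 by rewrite prednK.
have low : same_slope (d b) (h (b + k0.+1)%N - v (b + k0.+1)%N).
  have := exchanged_low (b + k0)%N%:Z; rewrite ck0.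
  have := alive k0.-1; rewrite -k0E leqnn => -> //.
  by rewrite addnS -addn1 PoszD.
exists (b + k0.+1)%N; split=> //; first lia.
move=> V T s sd L.
have Nk : N.+2 = (k0.+2 + (N - k0))%N by lia.
rewrite Nk big_split_ord /= [X in _ + X]big1 ?addr0 => [|j _]; last first.
  rewrite /edge_weight big1 // => p _.
  by rewrite (edge_not_above (i := (b + k0.+1)%N)) // ?mulr0n //; lia.
rewrite big_ord_recr /= (edge_weight_low _ low); congr (_ + _).
have := state _ _ _ _ L k0.-1; rewrite -k0E leqnn => <- //.
by rewrite [in RHS]addnS ltS ck0 addnS.
Qed.

End EdgeTracking.

Section EdgeWindow.
Variable w : seq letter.
Notation N := (size w).
Notation d := (dvec w).
Hypothesis N_gt0 : (0 < N)%N.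

(** The edge meets tetrahedra of index [i] to [i + N + 1] at most, hence at most [2 N]: three
    periods suffice, and the third is entered only at its first tetrahedron. *)
Lemma incidence_window (i j : 'I_N) (m : int) p :
  ~~ (0 <= m < 3) -> incidence w (d i) (j%:Z + N%:Z * m) p = 0%N.
Proof.
have iN := ltn_ord i; have jN := ltn_ord j.
rewrite negb_and -!ltNge => /orP[m0|m3].
  have [k ek] : exists k : nat, m = - (k%:Z + 1) by exists (absz (- m - 1)%R); lia.
  by rewrite (@edge_not_below w i) // ek; nia.
have [k ek] : exists k : nat, m = k%:Z + 3 by exists (absz (m - 3)%R); lia.
have [n0 [/andP[_ n0N] low _]] := edge_lifetime i N_gt0.
by rewrite (@edge_not_above w n0) // ek; nia.
Qed.

Lemma edge_weight_window (V : nmodType) (T : nat -> 'Z_3 -> V) (b : 'I_N) :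
  \sum_(n < N.+2) edge_weight w T (d b) (b + n) =
  \sum_(k < 3) \sum_(n < N) edge_weight w T (d b) (N * k + n).
Proof.
have N0 : (0 < N)%N := N_gt0; have bN := ltn_ord b.
have -> : \sum_(n < N.+2) edge_weight w T (d b) (b + n) =
          \sum_(n < N + (N + N)) edge_weight w T (d b) n.
  have [n0 [/andP[_ n0N] low _]] := edge_lifetime b N_gt0.
  have -> : (N + (N + N) = b + (N.+2 + (N + (N + N) - b - N.+2)))%N by lia.
  rewrite !big_split_ord /= [X in _ = X + _]big1 ?add0r => [|n _]; last first.
    rewrite /edge_weight big1 // => p _.
    by rewrite (@edge_not_below w b) ?mulr0n //; have := ltn_ord n; lia.
  rewrite [X in _ = _ + X]big1 ?addr0 // => n _.
  rewrite /edge_weight big1 // => p _.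
  by rewrite (@edge_not_above w n0) ?mulr0n //; lia.
rewrite !big_ord_recr big_ord0 /= add0r !big_split_ord /= muln0 muln1 muln2 -addnn -addrA.
by congr (_ + (_ + _)); apply: eq_bigr => n _; rewrite ?add0n ?addnA.
Qed.

End EdgeWindow.

(** * The determinant of the gluing matrix *)

Section RowSelect.
Variable R : comNzRingType.

Lemma det_row_select n (A B : 'M[R]_n) (c : 'I_n -> R) (pi : 'I_n -> 'I_n) :
  injective pi -> (forall i, row i A = c i *: row (pi i) B) ->
  exists s : bool, \det A = (-1) ^+ s * (\prod_i c i * \det B).
Proof.
move=> pi_inj AB; exists (perm pi_inj); rewrite -det_perm.
have -> : A = diag_mx (\row_i c i) *m (perm_mx (perm pi_inj) *m B).
  rewrite -row_permE; apply/row_matrixP => i; rewrite AB.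
  by apply/rowP => j; rewrite mul_diag_mx !mxE permE.
rewrite !det_mulmx det_diag mulrCA; congr (_ * (_ * _)).
by apply: eq_bigr => i _; rewrite mxE.
Qed.

End RowSelect.

Lemma layer_state_ext (R : comUnitRingType) m l (s0 : 'M[R]_(3, m)) Y Y' N :
  (forall k, (k < N)%N -> Y k = Y' k) ->
  forall n, (n <= N)%N -> layer_state l s0 Y n = layer_state l s0 Y' n.
Proof.
by move=> YY; elim=> //= n IH nN; rewrite IH 1?ltnW // YY.
Qed.

Section IncidenceMatrix.
Variable w : seq letter.
Notation N := (size w).
Notation d := (dvec w).
Notation h := (hvec w).
Notation v := (vvec w).
Notation lw n := (letter_at w (n%:Z - 1)).
Hypothesis N_gt0 : (0 < N)%N.
Hypothesis has_R : exists2 k, (k < N)%N & lw k = LetR.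
Hypothesis has_L : exists2 k, (k < N)%N & lw k = LetL.

Lemma same_slope_shift (b n : int) m : same_slope (d b) (h n - v n) ->
  same_slope (d (b + N%:Z * m)) (h (n + N%:Z * m) - v (n + N%:Z * m)).
Proof.
rewrite /dvec; have [-> ->] := frame_shift w m b; have [-> ->] := frame_shift w m n.
rewrite -frame_mapN -!frame_mapD => /orP[]/eqP->; first exact: same_slopexx.
by rewrite frame_mapN /same_slope eqxx orbT.
Qed.

Lemma dvec_slope_inj (b b' : int) : same_slope (d b) (d b') -> b = b'.
Proof.
have lt_neq (i j : int) : j < i -> same_slope (d i) (d j) = false.
  move=> ji; apply/negbTE/negP => s.
  have := edge_not_below w 1 ji; rewrite /incidence /=.
  by rewrite s.
move=> s; apply/eqP; case: (ltgtP b b') => // ltb.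
  by rewrite same_slope_sym lt_neq in s.
by rewrite lt_neq in s.
Qed.

Lemma lw_periodic n : lw (n + N)%N = lw n.
Proof.
rewrite PoszD -addrA (addrC N%:Z) addrA -[X in _ + X]mulr1.
exact: letter_at_periodic.
Qed.

(** A deck transformation would carry one edge to the other, and the slopes [d_i] are pairwise
    distinct. Thus deaths modulo N match the [N] edge equations with the [N] residuals. *)
Lemma edge_death_inj (b b' n n' : nat) : (b < N)%N -> (b' < N)%N ->
  same_slope (d b) (h n - v n) -> same_slope (d b') (h n' - v n') ->
  n = n' %[mod N] -> b = b'.
Proof.
move=> bN bN' s s' nn'.
pose m := (n' %/ N)%N%:Z - (n %/ N)%N%:Z.
have en : n'%:Z = n%:Z + N%:Z * m.
  by rewrite {1}(divn_eq n N) {1}(divn_eq n' N) nn' /m !PoszD !PoszM; ring.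
have := same_slope_shift m s; rewrite -en => s2.
have s3 : same_slope (d (b%:Z + N%:Z * m)) (d b').
  by rewrite (same_slopeN _ s2) same_slope_sym.
have eb := dvec_slope_inj s3.
apply/eqP; rewrite -(modn_small bN) -(modn_small bN').
have : (b'%:Z = b%:Z %[mod N%:Z])%Z by rewrite -eb addrC mulrC modzMDl.
by rewrite !modz_nat => -[->].
Qed.

Variables (K : fieldType) (t : K).
Hypothesis t_neq0 : t != 0.
Variable r : nat -> 'Z_3 -> K.
Hypothesis r1 : forall n, r n 1 = 1.
Hypothesis r_per : forall n p, r (n + N)%N p = r n p.

(** The twisted gluing matrix for the standard lifts, each column divided by the weight at label
    1. *)
Definition incidence_mx : 'M[K]_N :=
  \matrix_(i, j) \sum_(k < 3) t ^+ k *
    \sum_(p : 'Z_3) r j p *+ incidence w (d i) (j%:Z + N%:Z * k%:Z) p.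

(** Weights given to the edges h, v, d: each side class occurs twice in the tetrahedron, the upper
    diagonal once. *)
Definition tet_input (n : nat) : 'cV[K]_3 :=
  \col_i nth 0 [:: r n 0 *+ 2; r n 2 *+ 2; 1] i.

(** The tetrahedron [n] as a translate of one of the first [N], with [t] counting the periods. *)
Let u (n : nat) : 'rV[K]_N := \row_j (t ^+ (n %/ N)%N *+ (n %% N == j)%N).
Let Y n := tet_input n *m u n.
Let s0 := periodic_start (fun n => lw n) Y N t.
Let St n := layer_state (fun n => lw n) s0 Y n.
Let res n := letter_kill K (lw n) *m St n + u n.

Let u_per n : u (n + N)%N = t *: u n.
Proof.
by apply/rowP => j; rewrite !mxE modnDr divnDr ?dvdnn // divnn N_gt0 addn1 exprS mulrnAr.
Qed.

Let Y_per n : Y (n + N)%N = t *: Y n.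
Proof.
rewrite /Y u_per -scalemxAr; congr (_ *: (_ *m _)).
by apply/colP => i; rewrite !mxE !r_per.
Qed.

Let St_per n : St (n + N)%N = t *: St n.
Proof. by apply: layer_state_periodic; rewrite ?unitfE // => k; rewrite lw_periodic. Qed.

Let res_per n : res (n + N)%N = t *: res n.
Proof. by rewrite /res St_per u_per lw_periodic scalerDr scalemxAr. Qed.

Let res_perM n m : res (n + N * m)%N = t ^+ m *: res n.
Proof.
elim: m => [|m IH]; first by rewrite muln0 addn0 scale1r.
by rewrite mulnS addnCA addnC res_per IH scalerA -exprS.
Qed.

Let T n p := r n p *: u n.

Let layered_St :
  layered w T (fun c n => row (if c then 1 else 0) (St n)) (fun n => row 2 (St n)).
Proof.
move=> n; rewrite /St /= -/(St n) /T r1 scale1r; split.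
  apply/rowP => j; rewrite [LHS]mxE [LHS]mxE mulmx3E /Y [(_ *m u n) _ _]mxE big_ord1 mxE.
  by case: letter_at; rewrite !mxE /= ?mul0r ?add0r ?mul1r.
move=> c; apply/rowP => j; rewrite [LHS]mxE [LHS]mxE mulmx3E /Y [(_ *m u n) _ _]mxE big_ord1.
by case: letter_at; case: c; rewrite !mxE /= ?mul0r ?addr0 ?add0r ?mul1r ?mulrnAl.
Qed.

Let incidence_mx_row (b : 'I_N) :
  row b incidence_mx = \sum_(n < N.+2) edge_weight w T (d b) (b + n).
Proof.
rewrite edge_weight_window //; apply/rowP => j.
have block k : (\sum_(n < N) edge_weight w T (d b) (N * k + n)) 0 j =
    t ^+ k * \sum_(p : 'Z_3) r j p *+ incidence w (d b) (j%:Z + N%:Z * k%:Z) p.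
  have r_perM n m p : r (N * m + n)%N p = r n p.
    by elim: m => [|m IH]; rewrite ?muln0 // mulnS -addnA addnC r_per.
  have uE (n : 'I_N) : u (N * k + n)%N 0 j = t ^+ k *+ (n == j).
    by rewrite mxE mulnC divnMDl // divn_small // addn0 modnMDl modn_small.
  rewrite summxE (bigD1 j) //= big1 ?addr0 => [|n nj].
    rewrite summxE mulr_sumr; apply: eq_bigr => p _; rewrite PoszD PoszM addrC.
    by rewrite mulmxnE /T mxE uE r_perM eqxx mulr1n mulrnAr mulrC.
  rewrite summxE big1 // => p _.
  by rewrite mulmxnE /T mxE uE r_perM (negbTE nj) mulr0n mulr0 mul0rn.
by rewrite [LHS]mxE [LHS]mxE [RHS]summxE; apply: eq_bigr => k _; rewrite block.
Qed.

(** Each row is a power of [t] times the residual at the death of its edge, and deaths permute the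
    residues; [det_feedback] evaluates the residual matrix, with the factor [- t ^+ 3] from the
    nilpotent shift. *)
Lemma det_incidence_mx :
  exists (s : bool) (k : int), \det incidence_mx =
    (-1) ^+ s * t ^ k * \det (closed_prod (fun n => lw n) tet_input N - t%:M).
Proof.
have tu : t \is a GRing.unit by rewrite unitfE.
pose s0' := periodic_start (fun n => lw n) (fun k => tet_input k *m input (1%:M : 'M_N) k) N t.
pose Res := residual_mx (fun n => lw n) tet_input N s0' (input (1%:M : 'M_N)).
have Y_input k : (k < N)%N -> tet_input k *m input (1%:M : 'M_N) k = Y k.
  move=> kN; congr (_ *m _); rewrite -[k in input _ k]/(val (Ordinal kN)) inputE.
  by apply/rowP => j; rewrite !mxE divn_small // modn_small.
have es0 : s0' = s0.
  by rewrite /s0 /s0' /periodic_start (layer_state_ext _ _ Y_input).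
have Res_row (i : 'I_N) : row i Res = res i.
  apply/rowP => j; rewrite !mxE /residual es0 (layer_state_ext _ _ Y_input) 1?ltnW //.
  by rewrite inputE !mxE divn_small // modn_small.
have [death deathP] := fin_all_exists (fun b : 'I_N => edge_lifetime b N_gt0).
have row_death b : row b incidence_mx =
    t ^+ (death b %/ N) *: row (Ordinal (ltn_pmod (death b) N_gt0)) Res.
  have [_ _ wt] := deathP b; rewrite incidence_mx_row (wt _ _ _ _ layered_St).
  rewrite Res_row -res_perM /= mulnC addnC -divn_eq /res /T r1 scale1r; congr (_ + _).
  by case: letter_at; rewrite rowE.
have pi_inj : injective (fun b => Ordinal (ltn_pmod (death b) N_gt0)).
  move=> b b' /(congr1 val) /= e; have [_ low _] := deathP b; have [_ low' _] := deathP b'.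
  exact: val_inj (edge_death_inj (ltn_ord b) (ltn_ord b') low low' e).
have [s ->] := det_row_select pi_inj row_death.
have := det_feedback tet_input tu has_R has_L; rewrite -/s0' -/Res => <-.
rewrite -[X in \det X * _]/Res (_ : \det (_ - t%:M) = - t ^+ 3); last first.
  by rewrite -opprB -scaleN1r detZ det_shift_prod // -signr_odd /= expr1 mulN1r.
exists (~~ s), ((\sum_b death b %/ N)%N%:Z - 3).
rewrite prodrXr expfzDr // signrN -exprnP (_ : t ^ (- 3) = (t ^+ 3)^-1) //.
move: (t ^+ (\sum_b _)) (\det Res) ((-1) ^+ s : K) => a x y.
by field.
Qed.

End IncidenceMatrix.

(** * Reduction of both 3 x 3 products to SL_2 *)

Section LeftProducts.
Variable R : comNzRingType.

Fixpoint lprod k (M : nat -> 'M[R]_k) n : 'M[R]_k :=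
  if n is m.+1 then M m *m lprod M m else 1%:M.

Lemma lprod_shift k (M : nat -> 'M[R]_k) n :
  lprod (fun i => M i.+1) n *m M 0%N = M n *m lprod M n.
Proof. by elim: n => [|n IH] /=; rewrite ?mul1mx ?mulmx1 // -mulmxA IH. Qed.

Lemma lprod_triangular p q (E M : nat -> 'M[R]_(p + q)) (B : nat -> 'M[R]_p) c n :
  (forall i, E i.+1 *m M i = block_mx (B i) (c i) 0 1%:M *m E i) ->
  exists c', E n *m lprod M n = block_mx (lprod B n) c' 0 1%:M *m E 0%N.
Proof.
move=> EM; elim: n => [|n [c' IH]].
  by exists 0; rewrite /= -scalar_mx_block mul1mx mulmx1.
exists (B n *m c' + c n); rewrite /= mulmxA EM -mulmxA IH mulmxA mulmx_block.
by rewrite !mulmx0 !mul0mx !mulmx1 addr0 !add0r.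
Qed.

End LeftProducts.

Lemma det_sub_triangular (F K : fieldType) (iota : {rmorphism F -> K}) p q
    (E M : 'M[F]_(p + q)) (B : 'M[F]_p) c x :
  E \in unitmx -> E *m M = block_mx B c 0 1%:M *m E ->
  \det (x%:M - map_mx iota M) = \det (x%:M - map_mx iota B) * (x - 1) ^+ q.
Proof.
move=> uE EM; pose E' := map_mx iota E.
have uE' : \det E' != 0 by rewrite det_map_mx fmorph_eq0 -unitfE -unitmxE.
apply: (mulfI uE'); rewrite -det_mulmx mulmxBr mul_mx_scalar -map_mxM EM map_mxM.
rewrite -/E' -mul_scalar_mx -mulmxBl det_mulmx mulrC; congr (_ * _).
rewrite map_block_mx map_mx0 map_mx1 scalar_mx_block opp_block_mx add_block_mx.
by rewrite oppr0 addr0 sub0r det_ublock -raddfB det_scalar.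
Qed.

Section TraceRecursion.
Variables (F K : fieldType) (iota : {rmorphism F -> K}).
Hypothesis two_neq0 : 2 != 0 :> F.
Variables (l : nat -> letter) (N : nat) (h v d : nat -> F).

(* The letter l n leads from level n to level n + 1. *)
Hypothesis step : forall n,
  if l n is LetR then [/\ h n.+1 = h n, v n.+1 = d n & d n.+1 = h n * d n - v n]
  else [/\ h n.+1 = d n, v n.+1 = v n & d n.+1 = v n * d n - h n].
Hypothesis markov : forall n, h n ^+ 2 + v n ^+ 2 + d n ^+ 2 = h n * v n * d n.
Hypothesis h_neq0 : forall n, h n != 0.
Hypothesis v_neq0 : forall n, v n != 0.
Hypothesis d_neq0 : forall n, d n != 0.
Hypothesis hv_neq0 : forall n, h n ^+ 2 + v n ^+ 2 != 0.

(** The ratios of the weights [zeta] at labels 0 and 2 to that at label 1. That the three weights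
    sum to 0 is [shear_abE]. *)
Definition shear_a n := - h n ^+ 2 / (h n ^+ 2 + v n ^+ 2).
Definition shear_b n := - v n ^+ 2 / (h n ^+ 2 + v n ^+ 2).

Definition mx2 (x y z t : F) : 'M[F]_2 :=
  \matrix_(i, j) nth 0 (nth [::] [:: [:: x; y]; [:: z; t]] i) j.

(* Step from level n - 1 to level n, modulo the invariant linear form. *)
Definition shear_step (k : letter) n : 'M[F]_2 :=
  if k is LetR then mx2 1 (- (2 * shear_a n)) (- 1) (- (1 + 2 * shear_b n))
  else mx2 (- (1 + 2 * shear_a n)) (- 1) (- (2 * shear_b n)) 1.

Lemma shear_abE n : shear_a n + shear_b n = - 1.
Proof. by rewrite /shear_a /shear_b; field; exact: hv_neq0. Qed.

Lemma det_shear_step k n : \det (shear_step k n) = 1.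
Proof.
have e : shear_b n = - 1 - shear_a n by rewrite -(shear_abE n); ring.
by case: k; rewrite det2 !mxE /= e; ring.
Qed.

(** The last row is the total weight of a layer. The closed loop preserves it: an input removes the
    weight of the exchanged edge and spreads [2 a + 2 b + 1 = -1] times minus this weight over the
    others. *)
Definition shear_frame : 'M[F]_(2 + 1) := mx3 [:: [:: 1; 0; 0]; [:: 0; 1; 0]; [:: 1; 1; 1]].

Definition shear_input n : 'cV[F]_3 :=
  \col_i nth 0 [:: shear_a n *+ 2; shear_b n *+ 2; 1] i.

Lemma block_mx21E (B : 'M[F]_2) (c : 'cV[F]_2) :
  block_mx B c 0 1%:M = mx3 [:: [:: B 0 0; B 0 1; c 0 0]; [:: B 1 0; B 1 1; c 1 0];
                             [:: 0; 0; 1]] :> 'M[F]_3.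
Proof.
set X := mx3 _; rewrite -(@submxK _ 2 1 2 1 X).
congr (@block_mx _ 2 1 2 1 _ _ _ _); apply/matrixP.
- by apply: forall_ord2; apply: forall_ord2; rewrite !mxE.
- by apply: forall_ord2 => j; rewrite (ord1 j) !mxE.
- by move=> i; apply: forall_ord2; rewrite (ord1 i) !mxE.
- by move=> i j; rewrite (ord1 i) (ord1 j) !mxE.
Qed.

Lemma shear_frame_unit : (shear_frame : 'M[F]_3) \in unitmx.
Proof. by rewrite unitmxE det3 !mxE /= (_ : _ + _ = 1) ?unitr1 //; ring. Qed.

Lemma shear_frame_step n k :
  shear_frame *m (letter_shift F k - shear_input n *m letter_kill F k) =
  block_mx (shear_step k n) (if k is LetR then \col_i (i != 0)%:R else \col_i (i == 0)%:R)
    0 1%:M *m shear_frame.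
Proof.
have e : shear_b n = - 1 - shear_a n by rewrite -(shear_abE n); ring.
rewrite block_mx21E; apply/matrixP.
case: k; apply: forall_ord3; apply: forall_ord3; rewrite !(mulmx3E, mxE) !big_ord1 !mxE /=;
  by rewrite ?mulr0n ?mulr1n e; ring.
Qed.

Definition trace_form n : seq F :=
  [:: 2 * h n - v n * d n; 2 * v n - h n * d n; 2 * d n - h n * v n].

(* Infinitesimal deformations of the traces act on the logarithms of the shapes
   through the first two rows; the last row is the derivative of
   [h^2 + v^2 + d^2 - hvd]. *)
Definition trace_frame n : 'M[F]_(2 + 1) :=
  mx3 [:: [:: 0; - (v n)^-1; (d n)^-1]; [:: (h n)^-1; 0; - (d n)^-1]; trace_form n].

Lemma trace_frame_unit n : (trace_frame n : 'M[F]_3) \in unitmx.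
Proof.
suff e : \det (trace_frame n : 'M[F]_3) = -1 by rewrite unitmxE e unitrN1.
rewrite det3 !mxE /=; transitivity ((2 * (h n ^+ 2 + v n ^+ 2 + d n ^+ 2) - 3 * (h n * v n * d n)) /
              (h n * v n * d n)).
  by field; rewrite h_neq0 v_neq0 d_neq0.
by rewrite markov; field; rewrite h_neq0 v_neq0 d_neq0.
Qed.

(** The differential of the invariant cubic is preserved by the letter, whence the last row of the
    block matrix. The other rows hold only on the cubic. *)
Lemma trace_frame_step n :
  trace_frame n.+1 *m (trace_jac (l n) (h n) (v n) (d n))^T =
  block_mx (shear_step (l n) n.+1)
    (\col_i ((if i == 0 then -1 else 1) / (h n.+1 ^+ 2 + v n.+1 ^+ 2))) 0 1%:M
  *m trace_frame n.
Proof.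
have hn := h_neq0 n; have vn := v_neq0 n; have dn := d_neq0 n.
have dn' := d_neq0 n.+1; have m := markov n; have hvn := hv_neq0 n.+1.
rewrite block_mx21E /shear_step /trace_frame /trace_form /shear_a /shear_b.
apply/matrixP; have := step n; move: hvn dn'; case: (l n) => hvn dn' [eh ev ed].
  rewrite eh ev ed in hvn dn' *.
  (* On the cubic the denominator of level [n + 1] is the product of the old and the new value of
     the exchanged trace, both nonzero. *)
  have M : h n ^+ 2 + d n ^+ 2 = v n * (h n * d n - v n).
    by transitivity (h n ^+ 2 + v n ^+ 2 + d n ^+ 2 - v n ^+ 2); [ring|rewrite m; ring].
  rewrite !M in hvn *.
  have h2 : h n ^+ 2 = v n * (h n * d n - v n) - d n ^+ 2 by rewrite -M addrK.
  have d2 : d n ^+ 2 = v n * (h n * d n - v n) - h n ^+ 2 by rewrite -M addrC addKr.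
  apply: forall_ord3; apply: forall_ord3; rewrite !(mulmx3E, mxE) /=.
  all: try by field; rewrite ?hn ?vn ?dn ?dn'.
    by rewrite h2; field; rewrite ?hn ?vn ?dn ?dn'.
  by rewrite d2; field; rewrite ?hn ?vn ?dn ?dn'.
rewrite eh ev ed in hvn dn' *.
have M : d n ^+ 2 + v n ^+ 2 = h n * (v n * d n - h n).
  by transitivity (h n ^+ 2 + v n ^+ 2 + d n ^+ 2 - h n ^+ 2); [ring|rewrite m; ring].
rewrite !M in hvn *.
have d2 : d n ^+ 2 = h n * (v n * d n - h n) - v n ^+ 2 by rewrite -M addrK.
have v2 : v n ^+ 2 = h n * (v n * d n - h n) - d n ^+ 2 by rewrite -M addrC addKr.
apply: forall_ord3; apply: forall_ord3; rewrite !(mulmx3E, mxE) /=.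
all: try by field; rewrite ?hn ?vn ?dn ?dn'.
  by rewrite d2; field; rewrite ?hn ?vn ?dn ?dn'.
by rewrite v2; field; rewrite ?hn ?vn ?dn ?dn'.
Qed.

Variables lw : nat -> letter.
Hypothesis lwS : forall n, lw n.+1 = l n.
Hypothesis lw_per : lw N = lw 0%N.
Hypothesis h_per : h N = h 0%N.
Hypothesis v_per : v N = v 0%N.
Hypothesis d_per : d N = d 0%N.

Lemma det_sub_mx2 (M : 'M[F]_2) x :
  \det (x%:M - map_mx iota M) = x ^+ 2 - iota (\tr M) * x + iota (\det M).
Proof. by rewrite det2 mxtrace2 (det2 M) !mxE /= rmorphB !rmorphM rmorphD; ring. Qed.

(** For a characteristic polynomial [p] of SL_2, [t^2 p(t^-1) = p(t)]; the eigenvalue 1 contributes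
    [t (t^-1 - 1) = - (t - 1)]. Together they give the factor [t ^+ 3], and the sign is that of
    [A - t] against [t - A]. *)
Lemma det_closed_prod (J : 'M[F]_3) (t : K) : t != 0 ->
  J = iteri N (fun i M => M *m trace_jac (l i) (h i) (v i) (d i)) 1%:M ->
  \det (closed_prod lw (fun n => map_mx iota (shear_input n)) N - t%:M) =
  t ^+ 3 * \det (t^-1%:M - map_mx iota J).
Proof.
move=> t0 ->.
pose A n := letter_shift F (lw n) - shear_input n *m letter_kill F (lw n).
pose Jt n := (trace_jac (l n) (h n) (v n) (d n))^T.
pose B n := shear_step (lw n) n.
have eS k : map_mx iota (letter_shift F k) = letter_shift K k.
  apply/matrixP; apply: forall_ord3; apply: forall_ord3;
  by case: k; rewrite !mxE /= ?rmorph0 ?rmorph1.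
have eK k : map_mx iota (letter_kill F k) = letter_kill K k.
  by case: k; rewrite map_delta_mx.
have -> : closed_prod lw (fun n => map_mx iota (shear_input n)) N = map_mx iota (lprod A N).
  elim: N => [|n IH] /=; first by rewrite map_mx1.
  by rewrite IH map_mxM map_mxB map_mxM eS eK.
have -> : iteri N (fun i M => M *m trace_jac (l i) (h i) (v i) (d i)) 1%:M = (lprod Jt N)^T.
  by elim: N => [|n IH] /=; rewrite ?trmx1 // IH trmx_mul trmxK.
have -> : \det (t^-1%:M - map_mx iota (lprod Jt N)^T) = \det (t^-1%:M - map_mx iota (lprod Jt N)).
  by rewrite -[RHS]det_tr linearB /= tr_scalar_mx map_trmx.
have detB n : \det (lprod B n) = 1.
  by elim: n => [|n IH]; rewrite /= ?det1 // det_mulmx IH det_shear_step mulr1.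
have [c1 e1] := lprod_triangular N (fun n => shear_frame_step n (lw n)).
have Jstep n : trace_frame n.+1 *m Jt n = block_mx (B n.+1)
    (\col_i ((if i == 0 then -1 else 1) / (h n.+1 ^+ 2 + v n.+1 ^+ 2))) 0 1%:M *m trace_frame n.
  by rewrite trace_frame_step /B lwS.
have [c2 e2] := lprod_triangular N Jstep.
have fN : trace_frame N = trace_frame 0 by rewrite /trace_frame /trace_form h_per v_per d_per.
rewrite fN in e2.
rewrite (@det_sub_triangular _ _ iota 2 1 _ _ _ _ _ (trace_frame_unit 0) e2).
have -> : \det (map_mx iota (lprod A N) - t%:M) = - \det (t%:M - map_mx iota (lprod A N)).
  by rewrite -opprB -scaleN1r detZ -signr_odd /= expr1 mulN1r.
rewrite (@det_sub_triangular _ _ iota 2 1 _ _ _ _ _ shear_frame_unit e1) !det_sub_mx2 detB.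
have B0 : B N = B 0%N by rewrite /B /shear_step /shear_a /shear_b lw_per h_per v_per.
(* The traces run through the steps 1 to N, the edge weights through 0 to N - 1; as [B N = B 0], the
   products are conjugate. *)
have shift := lprod_shift B N; rewrite B0 in shift.
have uB : B 0%N \in unitmx by rewrite unitmxE det_shear_step unitr1.
have -> : lprod (fun n => B n.+1) N = B 0%N *m lprod B N *m invmx (B 0%N).
  by rewrite -shift mulmxK.
rewrite !det_mulmx det_inv detB det_shear_step mxtrace_mulC mulmxA mulVmx // mul1mx.
by rewrite !mulr1 invr1 rmorph1; field.
Qed.

End TraceRecursion.

(** * The longitude and its eigenvalue *)

Section Brackets.
Variable C : fieldType.

Lemma bracketE (u v : 'cV[C]_2) : bracket u v = u 0 0 * v 1 0 - u 1 0 * v 0 0.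
Proof.
have e (p : 'cV[C]_2) (k : 'cV[C]_2) : bracket p k = p 0 0 * k 1 0 - k 0 0 * p 1 0.
  rewrite /bracket det2.
  have c0 i : (row_mx p k : 'M_2) i 0 = p i 0.
    by rewrite -[RHS](row_mxEl p k); congr (row_mx p k i _); apply: val_inj.
  have c1 i : (row_mx p k : 'M_2) i 1 = k i 0.
    by rewrite -[RHS](row_mxEr p k); congr (row_mx p k i _); apply: val_inj.
  by rewrite !c0 !c1.
by rewrite e; ring.
Qed.

Lemma bracketC (u v : 'cV[C]_2) : bracket u v = - bracket v u.
Proof. by rewrite !bracketE; ring. Qed.

Lemma bracketZl a (u v : 'cV[C]_2) : bracket (a *: u) v = a * bracket u v.
Proof. by rewrite !bracketE !mxE; ring. Qed.

Lemma bracketZr a (u v : 'cV[C]_2) : bracket u (a *: v) = a * bracket u v.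
Proof. by rewrite !bracketE !mxE; ring. Qed.

Lemma bracket_mul (g : 'M[C]_2) u v : \det g = 1 -> bracket (g *m u) (g *m v) = bracket u v.
Proof.
move=> dg; rewrite -[RHS]mul1r -dg det2 !bracketE !mulmx2E; ring.
Qed.

Lemma plucker (x y0 y1 y2 : 'cV[C]_2) :
  bracket x y0 * bracket y1 y2 + bracket x y1 * bracket y2 y0
  + bracket x y2 * bracket y0 y1 = 0.
Proof. by rewrite !bracketE; ring. Qed.

Lemma colv2_neq0 (x : 'cV[C]_2) : x != 0 -> (x 0 0 != 0) || (x 1 0 != 0).
Proof.
apply: contraR; rewrite negb_or !negbK => /andP[/eqP x0 /eqP x1].
by apply/eqP/matrixP => i j; rewrite (ord1 j) mxE; move: i; apply: forall_ord2.
Qed.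

Lemma tr_mul_inv_mul (U V : 'M[C]_2) : \det U = 1 ->
  \tr (U *m (U *m V)) = \tr U * \tr (U *m V) - \tr V.
Proof.
rewrite det2 => dU; have -> : \tr V = \tr V * (U 0 0 * U 1 1 - U 0 1 * U 1 0).
  by rewrite dU mulr1.
by rewrite !mxtrace2 !mulmx2E; ring.
Qed.

Section Commutator.
Variables A B L : 'M[C]_2.
Hypotheses (dA : \det A = 1) (dB : \det B = 1) (dL : \det L = 1).
Hypothesis ABL : A *m B = B *m A *m L.

Let uA : A \in unitmx. Proof. by rewrite unitmxE dA unitr1. Qed.
Let uB : B \in unitmx. Proof. by rewrite unitmxE dB unitr1. Qed.

(** Fricke's identity; at [tr L = -2] it is the cubic satisfied by the traces. *)
Lemma trace_commutator :
  \tr L = \tr A ^+ 2 + \tr B ^+ 2 + \tr (A *m B) ^+ 2 - \tr A * \tr B * \tr (A *m B) - 2.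
Proof.
have -> : L = invmx A *m (invmx B *m (A *m B)).
  by rewrite ABL -(mulmxA B) !mulKmx.
transitivity (\tr A ^+ 2 * \det B + \tr B ^+ 2 * \det A + \tr (A *m B) ^+ 2
   - \tr A * \tr B * \tr (A *m B) - 2 * \det A * \det B).
  rewrite !invmx2 // !det2 !mxtrace2 !(mulmx2E, mxE) /= ?subrr ?subr0; ring.
by rewrite dA dB !mulr1.
Qed.

(* x spans the fixed line of the parabolic L = c + k x [x, -]. *)
Variables (x : 'cV[C]_2) (c k : C).
Hypothesis Lxy : L = c%:M + k *: (x *m \row_j (if j == 0 then - x 1 0 else x 0 0)).

Lemma tr_parabolic (M : 'M[C]_2) : \tr (M *m L) = c * \tr M + k * bracket x (M *m x).
Proof.
rewrite Lxy mulmxDr mxtraceD mul_mx_scalar mxtraceZ; congr (_ + _).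
rewrite -scalemxAr mxtraceZ mulmxA mxtrace_mulC; congr (_ * _).
by move: (M *m x) => y; rewrite /mxtrace big_ord1 mulmx2E !mxE /= bracketE; ring.
Qed.

(** [A L] is [B^-1 A B], so its trace is that of [A]. The brackets, which are lambda lengths of the
    edges, are thereby proportional to traces. *)
Lemma trace_bracket1 : (1 - c) * \tr A = k * bracket x (A *m x).
Proof.
have : \tr (A *m L) = \tr A.
  by rewrite -(mulKmx uB (A *m L)) (mulmxA B A L) -ABL mxtrace_mulC mulmxK.
by rewrite tr_parabolic => e; rewrite mulrBl mul1r -{1}e addrC addKr.
Qed.

Lemma trace_bracket2 : (1 - c) * \tr B = - (k * bracket x (B *m x)).
Proof.
have trV : \tr (invmx B) = \tr B.
  by rewrite invmx2_tr // mxtraceD mxtrace_scalar raddfN /= mulr2n addrK.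
have : \tr (invmx B *m L) = \tr (invmx B).
  have -> : L = invmx A *m (invmx B *m (A *m B)).
    by rewrite ABL -(mulmxA B) !mulKmx.
  rewrite mxtrace_mulC -!mulmxA mulmxV // mulmx1 mxtrace_mulC -!mulmxA mulmxV //.
  by rewrite mulmx1.
rewrite tr_parabolic trV -[bracket x _](bracket_mul _ _ dB) mulKVmx // bracketC mulrN => e.
by rewrite mulrBl mul1r -{1}e addrC addKr.
Qed.

End Commutator.

(** [L - c] is nilpotent and kills [x], hence is a multiple of [x [x, -]]; the row in the statement
    is the form [[x, -]]. *)
Lemma parabolic_form (L : 'M[C]_2) (x : 'cV[C]_2) c :
  \det L = 1 -> x != 0 -> L *m x = c *: x -> c ^+ 2 = 1 -> 
  \tr L = 2 * c /\
  exists k, L = c%:M + k *: (x *m \row_j (if j == 0 then - x 1 0 else x 0 0)).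
Proof.
move=> dL x0 Lx c2.
have c0 : c != 0 by apply: contra_eq_neq c2 => ->; rewrite expr0n eq_sym oner_eq0.
have e0 : L 0 0 * x 0 0 + L 0 1 * x 1 0 = c * x 0 0.
  by rewrite -mulmx2E Lx mxE.
have e1 : L 1 0 * x 0 0 + L 1 1 * x 1 0 = c * x 1 0.
  by rewrite -mulmx2E Lx mxE.
move: dL; rewrite mxtrace2 det2 => dL.
(* The adjugate of [L - c] applied to [(L - c) x = 0]: the determinant [2 - c tr L] kills both
   coordinates of [x]. *)
have ch y : (y == x 0 0) || (y == x 1 0) -> (c * (L 0 0 + L 1 1) - 2) * y = 0.
  move=> Hy.
  have -> : (c * (L 0 0 + L 1 1) - 2) * y = (c * (L 0 0 + L 1 1) - c ^+ 2
      - (L 0 0 * L 1 1 - L 0 1 * L 1 0)) * y by rewrite c2 dL; ring.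
  case/orP: Hy => /eqP ->.
    transitivity ((c - L 1 1) * (L 0 0 * x 0 0 + L 0 1 * x 1 0 - c * x 0 0)
       + L 0 1 * (L 1 0 * x 0 0 + L 1 1 * x 1 0 - c * x 1 0)); first by ring.
    by rewrite e0 e1 !subrr !mulr0 addr0.
  transitivity ((c - L 0 0) * (L 1 0 * x 0 0 + L 1 1 * x 1 0 - c * x 1 0)
     + L 1 0 * (L 0 0 * x 0 0 + L 0 1 * x 1 0 - c * x 0 0)); first by ring.
  by rewrite e0 e1 !subrr !mulr0 addr0.
have tr2 : c * (L 0 0 + L 1 1) = 2.
  apply/eqP; rewrite -subr_eq0; case/orP: (colv2_neq0 x0) => nz.
    by have := ch (x 0 0); rewrite eqxx => /(_ isT)/eqP; rewrite mulf_eq0 (negbTE nz) orbF.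
  by have := ch (x 1 0); rewrite eqxx orbT => /(_ isT)/eqP; rewrite mulf_eq0 (negbTE nz) orbF.
have tr : L 0 0 + L 1 1 = 2 * c.
  by apply: (mulfI c0); rewrite tr2 mulrCA -expr2 c2 mulr1.
split=> //.
have e11 : L 1 1 = 2 * c - L 0 0 by rewrite -tr addrC addKr.
have mxE' (k : C) i j : (c%:M + k *: (x *m \row_j (if j == 0 then - x 1 0 else x 0 0))) i j
    = c *+ (i == j) + k * (x i 0 * (if j == 0 then - x 1 0 else x 0 0)).
  by rewrite !(mxE, big_ord1).
case/orP: (colv2_neq0 x0) => nz.
  have e00 : L 0 0 = c - L 0 1 * x 1 0 / x 0 0.
    by apply: (mulIf nz); rewrite mulrBl mulfVK // -e0 addrK.
  have e10 : L 1 0 = (c - L 1 1) * x 1 0 / x 0 0.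
    by apply: (mulIf nz); rewrite mulfVK // mulrBl -e1 addrK.
  exists (L 0 1 / x 0 0 ^+ 2).
  by apply: matrix2P; rewrite mxE' /= ?mulr1n ?mulr0n ?e10 ?e11 ?e00; field.
have e01 : L 0 1 = (c - L 0 0) * x 0 0 / x 1 0.
  by apply: (mulIf nz); rewrite mulfVK // mulrBl -e0 addrC addKr.
have e11' : L 1 1 = c - L 1 0 * x 0 0 / x 1 0.
  by apply: (mulIf nz); rewrite mulrBl mulfVK // -e1 addrC addKr.
have e00 : L 0 0 = 2 * c - L 1 1 by rewrite -tr addrK.
exists (- L 1 0 / x 1 0 ^+ 2).
by apply: matrix2P; rewrite mxE' /= ?mulr1n ?mulr0n ?e01 ?e00 ?e11'; field.
Qed.

End Brackets.

(** * The longitude is nontrivial in the fundamental group *)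

Section Heisenberg.
Variables (w : seq letter) (neg : bool).
Notation N := (size w).

(** Central extension of Z^2 by the cocycle [vdet]. Being invariant under matrices of determinant 1,
    the cocycle lets the monodromy extend. *)
Definition heis : Type := (vec * int)%type.

Definition heis_mul (g k : heis) : heis := (g.1 + k.1, g.2 + k.2 + vdet g.1 k.1).

Definition heis_inv (g : heis) : heis := (- g.1, - g.2).

Lemma heis_mulA g k m : heis_mul g (heis_mul k m) = heis_mul (heis_mul g k) m.
Proof. by rewrite /heis_mul /= addrA vdetDl vdetDr; congr pair; ring. Qed.

Lemma heis_mulVK g k : heis_mul (heis_inv g) (heis_mul g k) = k.
Proof.
case: k => k1 k2; rewrite /heis_mul /= addKr vdetDr !vdetNl vdetvv; congr pair; ring.
Qed.

Lemma heis_mulKV g k : heis_mul g (heis_mul (heis_inv g) k) = k.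
Proof.
case: k => k1 k2; rewrite /heis_mul /= addNKr vdetDr !vdetNr vdetNl vdetvv; congr pair; ring.
Qed.

Definition heis_letter (y : 'I_3 * bool) : heis :=
  let g := if y.1 == ga then ((1, 0), 0) else ((0, 1), 0) in
  if y.2 then heis_inv g else g.

Definition heis_word (u : gword) : heis :=
  foldr (fun y => heis_mul (heis_letter y)) (0, 0) u.

Lemma heis_word_cat u x : heis_word (u ++ x) = heis_mul (heis_word u) (heis_word x).
Proof.
elim: u => [|y u IH] /=; last by rewrite IH heis_mulA.
by case: (heis_word x) => x1 x2; rewrite /heis_mul /= !add0r /vdet /= !mul0r subrr addr0.
Qed.

Lemma heis_word_inv u : (heis_word (gw_inv u)).1 = - (heis_word u).1.
Proof.
elim: u => [|y u IH]; first by [].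
rewrite -cat1s gw_invD !heis_word_cat /= IH opprD addrC; congr (_ + _).
by rewrite /heis_letter; case: y.2; rewrite /= !addr0 ?opprK.
Qed.

Lemma heis_pi1_frame n :
  (heis_word (pi1_frame w n).1).1 = hvec w n%:Z /\
  (heis_word (pi1_frame w n).2).1 = vvec w n%:Z.
Proof.
elim: n => [//|n [IH1 IH2]]; rewrite pi1_frameS -addn1 PoszD hvecS vvecS /dvec.
by case: letter_at; rewrite /= heis_word_cat /= IH1 IH2 // addrC.
Qed.

Let pa := (monodromy w neg).1.
Let pb := (monodromy w neg).2.
Let bs : vec * vec := ((heis_word pa).1, (heis_word pb).1).

Let bs_det : vdet bs.1 bs.2 = 1.
Proof.
have [e1 e2] := heis_pi1_frame N; have f := vdet_frame w N%:Z.
rewrite /bs /pa /pb monodromyE; case: neg => /=; rewrite ?heis_word_inv e1 e2 //.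
by rewrite vdetNl vdetNr opprK.
Qed.

(* The automorphism of the Heisenberg group induced by the monodromy. *)
Definition heis_phi (k : heis) : heis :=
  (frame_map bs k.1, k.2 + (k.1.1 * (heis_word pa).2 + k.1.2 * (heis_word pb).2)).

Definition heis_phiV (k : heis) : heis :=
  let u : vec := (vdet k.1 bs.2, vdet bs.1 k.1) in
  (u, k.2 - (u.1 * (heis_word pa).2 + u.2 * (heis_word pb).2)).

Lemma heis_phiVK k : heis_phi (heis_phiV k) = k.
Proof.
case: k => -[k1 k2] k3; rewrite /heis_phi /heis_phiV /= subrK; congr pair.
have := bs_det; rewrite /frame_map /vdet /=; case: bs => -[a b] [c e] /= det1.
congr pair; rewrite -[RHS]mul1r -det1; ring.
Qed.

Lemma heis_phiK k : heis_phiV (heis_phi k) = k.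
Proof.
case: k => -[k1 k2] k3; rewrite /heis_phi /heis_phiV /=.
have [-> ->] : vdet (frame_map bs (k1, k2)) bs.2 = k1 /\
               vdet bs.1 (frame_map bs (k1, k2)) = k2.
  have := bs_det; rewrite /frame_map /vdet /=; case: bs => -[a b] [c e] /= det1.
  by split; rewrite -[RHS]mulr1 -det1; ring.
by rewrite addrK.
Qed.

Lemma heis_phi_letter g k : (g == ((1, 0), 0)) || (g == ((0, 1), 0)) ->
  heis_phi (heis_mul g k) =
  heis_mul (if g == ((1, 0), 0) then heis_word pa else heis_word pb) (heis_phi k).
Proof.
case: k => -[k1 k2] k3.
have := bs_det; rewrite /heis_phi /bs.
case: (heis_word pa) (heis_word pb) => [[a b] ca] [[c e] cb]; rewrite /vdet /= => det1.
case/orP=> /eqP-> /=; rewrite /heis_mul /frame_map /vdet /=; congr pair.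
- by congr pair => /=; ring.
- have -> : a * (k1 * b + k2 * e) - b * (k1 * a + k2 * c) = k2 * (a * e - b * c) by ring.
  by rewrite det1; ring.
- by congr pair => /=; ring.
have -> : c * (k1 * b + k2 * e) - e * (k1 * a + k2 * c) = - k1 * (a * e - b * c) by ring.
by rewrite det1; ring.
Qed.

(** The fibre acts by left translation and s by the automorphism; an action on the underlying set is
    enough to test relators, without forming a semidirect product. *)
Definition heis_act1 (y : 'I_3 * bool) (k : heis) : heis :=
  if y.1 == gs then (if y.2 then heis_phiV k else heis_phi k)
  else heis_mul (heis_letter y) k.

Definition heis_act (u : gword) (k : heis) : heis := foldr heis_act1 k u.

Lemma heis_act_cat u x k : heis_act (u ++ x) k = heis_act u (heis_act x k).
Proof. exact: foldr_cat. Qed.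

Lemma heis_act1K x b k : heis_act1 (x, b) (heis_act1 (x, ~~ b) k) = k.
Proof.
rewrite /heis_act1 /=; case: eqP => _.
  by case: b; rewrite /= ?heis_phiK ?heis_phiVK.
by case: b; rewrite /heis_letter /= ?heis_mulVK ?heis_mulKV.
Qed.

Lemma heis_actV u k : heis_act u (heis_act (gw_inv u) k) = k.
Proof.
elim: u k => [//|[x b] u IH] k.
rewrite -[in X in heis_act X]cat1s -[in gw_inv _]cat1s gw_invD !heis_act_cat IH.
exact: heis_act1K.
Qed.

Lemma heis_act_fibre u k : fibre_word u -> heis_act u k = heis_mul (heis_word u) k.
Proof.
elim: u => [_|y u IH /= /andP[ny fu]].
  by case: k => k1 k2; rewrite /heis_mul /= !add0r /vdet /= !mul0r subrr addr0.
by rewrite IH // /heis_act1 (negbTE ny) heis_mulA.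
Qed.

Lemma heis_act_pi1_eq u x : pi1_eq w neg u x -> forall k, heis_act u k = heis_act x k.
Proof.
have [fa fb] := fibre_monodromy w neg.
have rel g u' : fibre_word u' ->
    (forall k, heis_phi (heis_act1 (g, false) k) = heis_mul (heis_word u') (heis_phi k)) ->
    forall k, heis_act (gen gs ++ gen g ++ gw_inv (gen gs) ++ gw_inv u') k = k.
  move=> fu e k; rewrite !heis_act_cat -[RHS](heis_actV u').
  move: (heis_act (gw_inv u') k) => {}k.
  rewrite (heis_act_fibre _ fu) -[in RHS](heis_phiVK k) -e.
  by [].
elim=> {u x} [//|u x _ IH k|u x y _ IH1 _ IH2 k|u u' x x' _ IH1 _ IH2 k|x b k||].
- by rewrite IH.
- by rewrite IH1 IH2.
- by rewrite !heis_act_cat IH1 IH2.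
- exact: heis_act1K.
- by apply: rel => // k; exact: (@heis_phi_letter ((1, 0), 0) k isT).
by apply: rel => // k; exact: (@heis_phi_letter ((0, 1), 0) k isT).
Qed.

(** The longitude moves the neutral element to the central element (0, 2). *)
Lemma longitude_nontrivial : ~ pi1_eq w neg longitude [::].
Proof. by move/heis_act_pi1_eq => /(_ (0, 0)). Qed.

End Heisenberg.

(** * The longitude as a normal curve *)

Section LongitudeCurve.
Variables (w : seq letter) (neg : bool).
Notation N := (size w).
Hypothesis letter0 : letter_at w 0 = LetL.
Hypothesis letter1 : letter_at w 1 = LetR.

(* The longitude, drawn between the levels 0, 1 and 2, around which the letters
   L and R follow each other. *)
Definition longitude_arcs : seq Defs.arc :=
  [:: (1, 0, 2, true); (2, 1, 1, true); (1, 1, 2, false); (0, 2, 0, false);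
      (1, 2, 2, true); (2, 3, 1, true); (1, 3, 2, false); (0, 4, 0, false)].

(** [cusp_vertex] with the frame as a parameter: the frames of levels 0, 1, 2 are explicit, so
    adjacency of arcs is computed whatever the rest of the word. *)
Let cusp_vertex_in (b : vec * vec) (n : int) (p : 'Z_3) : vec :=
  let c := `|(n %% 4)%Z|%N in
  let x := nth 0 (if odd c then [:: - b.1; b.2 - b.1; b.2] else [:: b.1; b.1 + b.2; b.2]) p in
  if (c < 2)%N then x else - x.

Let exit_in b (s : Defs.arc) : vec * vec :=
  let n := (arc_tri s).2 in
  if s.2 then (cusp_vertex_in b n s.1.2, cusp_vertex_in b n (s.1.2 + 2))
  else (cusp_vertex_in b n (s.1.2 + 2), cusp_vertex_in b n (s.1.2 + 1)).

Let enter_in b (s : Defs.arc) : vec * vec :=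
  (cusp_vertex_in b (arc_tri s).2 s.1.2, cusp_vertex_in b (arc_tri s).2 (s.1.2 + 1)).

Let arc_next_check b b' (s s' : Defs.arc) :
  frame w (arc_tri s).1 = b -> frame w (arc_tri s').1 = b' ->
  (exit_in b s == enter_in b' s') && (`|(arc_tri s).2 - (arc_tri s').2| <= 1) ->
  arc_next w s s'.
Proof. by move=> <- <-. Qed.

Lemma peripheral_longitude : peripheral_curve w neg longitude_arcs.
Proof.
have f0 : frame w 0 = ((1, 0), (0, 1)) by [].
have f1 : frame w 1 = ((1, 1), (0, 1)).
  by rewrite -[1]add0r frameS letter0 f0.
have f2 : frame w 2 = ((1, 1), (1, 2)).
  by rewrite (_ : 2 = 1 + 1) // frameS letter1 f1.
exists 0, 1; split=> //.
- exists (1, 0, 2, true), (behead longitude_arcs); split=> //.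
  have -> : cusp_deck w neg 0 1 (1, 0) = (1, 4) by rewrite /cusp_deck !mulr0 !addr0.
  apply/and5P; split; [| | | |apply/and5P; split => //].
  - by apply: arc_next_check; [exact: f1|exact: f2|vm_compute].
  - by apply: arc_next_check; [exact: f2|exact: f1|vm_compute].
  - by apply: arc_next_check; [exact: f1|exact: f0|vm_compute].
  - by apply: arc_next_check; [exact: f0|exact: f1|vm_compute].
  - by apply: arc_next_check; [exact: f1|exact: f2|vm_compute].
  - by apply: arc_next_check; [exact: f2|exact: f1|vm_compute].
  - by apply: arc_next_check; [exact: f1|exact: f0|vm_compute].
  - by apply: arc_next_check; [exact: f0|exact: f1|vm_compute].
move=> e s s' sc s'c; rewrite /cusp_deck !mulr0 !addr0 mulr1 => e4.
(* Translation is by 4 strips at a fixed level, and triangles of one level lie in strips distinct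
   modulo 4. *)
have /allP/(_ s sc)/allP/(_ s' s'c) : all (fun s => all (fun s' =>
    ((arc_tri s).1 == (arc_tri s').1) && (4 %| (arc_tri s').2 - (arc_tri s).2)%Z
    ==> ((arc_tri s).2 == (arc_tri s').2)) longitude_arcs) longitude_arcs.
  by vm_compute.
rewrite e4 /= eqxx addrAC subrr add0r dvdz_mulr //= => /eqP.
move: (arc_tri s).2 => x; lia.
Qed.

End LongitudeCurve.

(** * Shapes and traces *)

Section CrossRatios.
Variable C : fieldType.
Variables (A B L : 'M[C]_2) (x : 'cV[C]_2) (c : C).
Hypotheses (dA : \det A = 1) (dB : \det B = 1).
Hypothesis ABL : A *m B = B *m A *m L.
Hypothesis Lx : L *m x = c *: x.

Notation H := (bracket x (A *m x)).
Notation V := (bracket x (B *m x)).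
Notation D := (bracket x (A *m B *m x)).
Notation W := (bracket (B *m x) (A *m x)).

Definition corners (p : 'Z_3) : 'cV[C]_2 :=
  nth 0 [:: A *m x; A *m B *m x; B *m x] p.

Lemma bracket_corner01 : bracket (A *m x) (A *m B *m x) = V.
Proof. by rewrite -mulmxA bracket_mul. Qed.

Lemma bracket_corner12 : bracket (A *m B *m x) (B *m x) = - (c * H).
Proof.
have -> : A *m B *m x = c *: (B *m (A *m x)).
  by rewrite ABL -mulmxA Lx -scalemxAr mulmxA.
by rewrite bracketZl bracket_mul // bracketC mulrN.
Qed.

(** Ptolemy relation of the parallelogram with sides [H], [V] and diagonals [D], [W]; at [c = -1] it
    produces the sum of squares in the shapes. *)
Lemma plucker_corners : D * W = c * H ^+ 2 - V ^+ 2.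
Proof.
have := plucker x (A *m x) (A *m B *m x) (B *m x).
rewrite bracket_corner12 bracket_corner01 => e.
by rewrite -[LHS]subr0 -[in LHS]e; ring.
Qed.

Lemma cross_ratio0 : cross_ratio x corners 0 = - (D * W) / V ^+ 2.
Proof.
rewrite /cross_ratio /corners /= bracket_corner01 [bracket (A *m x) _]bracketC.
by congr (_ / _); ring.
Qed.

Lemma cross_ratio1 : cross_ratio x corners 1 = V ^+ 2 / (c * H ^+ 2).
Proof.
rewrite /cross_ratio /corners /= bracket_corner12 [bracket (A *m B *m x) _]bracketC.
rewrite bracket_corner01 (_ : - V * V = - V ^+ 2) 1?(_ : - (c * H) * H = - (c * H ^+ 2)).
- by rewrite invrN mulrNN.
- by ring.
by ring.
Qed.

Lemma cross_ratio2 : cross_ratio x corners 2 = c * H ^+ 2 / (D * W).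
Proof.
rewrite /cross_ratio /corners /= [bracket (B *m x) (A *m B *m x)]bracketC bracket_corner12.
by congr (_ / _); ring.
Qed.

End CrossRatios.

Lemma shape_cross_ratio (C : fieldType) (X : 'Z_3 -> C) (H2 V2 DW : C) (q : 'Z_3) (z : C) :
  DW = H2 - V2 -> X 0 = - DW / V2 -> X 1 = V2 / H2 -> X 2 = H2 / DW ->
  z = X q -> z != 0 -> z != 1 ->
  [/\ H2 != 0, V2 != 0, DW != 0 & forall p, shape_param z (p - q) = X p].
Proof.
move=> eDW X0 X1 X2 zX z0 z1.
(* The inverse of 0 is 0, so a nonzero fraction also has a nonzero denominator. *)
have inv0 (a b : C) : a / b != 0 -> a != 0 /\ b != 0.
  by rewrite mulf_eq0 negb_or invr_eq0 => /andP[].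
have inv1 (a b : C) : b != 0 -> a / b != 1 -> a - b != 0.
  by move=> b0; rewrite subr_eq0; apply: contra => /eqP ->; rewrite divff.
have [h0 [v0 d0]] : H2 != 0 /\ V2 != 0 /\ DW != 0.
  move: z0 z1; rewrite {z}zX; move: q; apply: forall_Z3; rewrite ?X0 ?X1 ?X2.
  - move=> /inv0[]; rewrite oppr_eq0 => d0 v0 /(inv1 _ _ v0).
    by rewrite -opprD oppr_eq0 {1}eDW subrK.
  - move=> /inv0[v0 h0] /(inv1 _ _ h0); rewrite -opprB oppr_eq0 -eDW.
    by [].
  move=> /inv0[h0 d0] /(inv1 _ _ d0); rewrite {1}eDW opprB addrC subrK.
  by [].
split=> // p; rewrite {z z0 z1}zX eDW in d0 X0 X2 *.
move: q p; apply: forall_Z3; apply: forall_Z3; rewrite /shape_param /= ?X0 ?X1 ?X2.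
all: have d1 : H2 - V2 - H2 != 0 by rewrite addrAC subrr add0r oppr_eq0.
all: by field; rewrite ?oppr_eq0 ?h0 ?v0 ?d0 ?d1.
Qed.

(** The weights are the logarithmic derivatives of the three shape parameters with respect to [z];
    changing the quad type multiplies them by a common factor, so their ratios do not depend on
    [q]. *)
Lemma zeta_ratio (C : fieldType) (X : 'Z_3 -> C) (h2 v2 : C) (q : 'Z_3) (z : C) :
  h2 != 0 -> v2 != 0 -> h2 + v2 != 0 ->
  X 0 = (h2 + v2) / v2 -> X 1 = - v2 / h2 -> X 2 = h2 / (h2 + v2) -> z = X q ->
  [/\ zeta z (1 - q) != 0,
      zeta z (0 - q) = - h2 / (h2 + v2) * zeta z (1 - q) &
      zeta z (2 - q) = - v2 / (h2 + v2) * zeta z (1 - q)].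
Proof.
move=> h0 v0 s0 X0 X1 X2 ->.
have e1 : 1 - (h2 + v2) / v2 = - h2 / v2 by field.
have e2 : (h2 + v2) / v2 - 1 = h2 / v2 by field.
have e3 : - v2 / h2 - 1 = - (h2 + v2) / h2 by field.
have e4 : 1 - - v2 / h2 = (h2 + v2) / h2 by field.
have e5 : h2 / (h2 + v2) - 1 = - v2 / (h2 + v2) by field.
have e6 : 1 - h2 / (h2 + v2) = v2 / (h2 + v2) by field.
move: q; apply: forall_Z3; rewrite /zeta /= ?X0 ?X1 ?X2 ?(e1, e2, e3, e4, e5, e6); split.
all: rewrite ?(invr_eq0, mulf_eq0, oppr_eq0, negb_or, h0, v0, s0) //.
all: by field; rewrite ?oppr_eq0 ?h0 ?v0 ?s0.
Qed.

Section TracePeriod.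
Variable C : fieldType.
Variables (w : seq letter) (neg : bool) (rho : 'I_3 -> 'M[C]_2).
Hypothesis det_rho : forall x, \det (rho x) = 1.
Hypothesis rel_a : gw_eval rho (relator_a w neg) = 1%:M.
Hypothesis rel_b : gw_eval rho (relator_b w neg) = 1%:M.
Notation ev := (gw_eval rho).
Notation N := (size w).
Notation A n := (ev (pi1_frame w n).1).
Notation B n := (ev (pi1_frame w n).2).
Notation L := (ev longitude).
Notation h := (trh w rho).
Notation v := (trv w rho).
Notation d := (trd w rho).

Lemma trdE n : d n = \tr (A n *m B n).
Proof. by rewrite /trd gw_evalD. Qed.

Lemma trace_step n :
  if letter_at w n%:Z is LetR then [/\ h n.+1 = h n, v n.+1 = d n & d n.+1 = h n * d n - v n]
  else [/\ h n.+1 = d n, v n.+1 = v n & d n.+1 = v n * d n - h n].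
Proof.
have dA := det_gw_eval det_rho (pi1_frame w n).1.
have dB := det_gw_eval det_rho (pi1_frame w n).2.
rewrite !trdE /trh /trv pi1_frameS; case: letter_at; rewrite /= !gw_evalD.
  by split; rewrite ?tr_mul_inv_mul.
split=> //; first by rewrite mxtrace_mulC.
by rewrite mxtrace_mulC tr_mul_inv_mul // (mxtrace_mulC (ev _) (ev _)).
Qed.

Lemma frame_commutator n : A n *m B n = B n *m A n *m L.
Proof.
have uev := unit_gw_eval det_rho.
elim: n => [|n IH].
  rewrite /longitude !gw_evalD !(gw_evalV det_rho) mulmxA mulmxK // mulmxA mulmxV //.
  by rewrite mul1mx.
rewrite pi1_frameS; case: letter_at; rewrite /= !gw_evalD.
  by rewrite -[in RHS]mulmxA -[in RHS]mulmxA [X in _ = _ *m X]mulmxA -IH.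
by rewrite -mulmxA IH !mulmxA.
Qed.

Lemma trace_period0 : [/\ h N = h 0%N, v N = v 0%N & d N = d 0%N].
Proof.
have us : rho gs \in unitmx by rewrite unitmxE det_rho unitr1.
have [ea eb] := ev_monodromy det_rho rel_a rel_b.
have conj (X : 'M_2) : \tr (rho gs *m X *m invmx (rho gs)) = \tr X.
  by rewrite mxtrace_mulC mulmxA mulVmx // mul1mx.
have trV (X : 'M[C]_2) : \det X = 1 -> \tr (invmx X) = \tr X.
  by move=> dX; rewrite invmx2_tr // mxtraceD mxtrace_scalar raddfN /= mulr2n addrK.
have dev := det_gw_eval det_rho.
have m1 : h N = \tr (ev (monodromy w neg).1).
  by rewrite monodromyE; case: neg => //=; rewrite (gw_evalV det_rho) trV.
have m2 : v N = \tr (ev (monodromy w neg).2).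
  by rewrite monodromyE; case: neg => //=; rewrite (gw_evalV det_rho) trV.
have m3 : d N = \tr (ev (monodromy w neg).1 *m ev (monodromy w neg).2).
  rewrite trdE monodromyE; case: neg => //=; rewrite !(gw_evalV det_rho).
  rewrite -invmxM ?(unit_gw_eval det_rho) // trV; first by rewrite mxtrace_mulC.
  by rewrite det_mulmx !dev mulr1.
rewrite m1 m2 m3 ea eb !conj; split.
- by rewrite /trh /= mulmx1.
- by rewrite /trv /= mulmx1.
rewrite trdE /= !mulmx1 -[RHS]conj; congr (\tr _).
by rewrite !mulmxA mulmxKV.
Qed.

Lemma trace_period n :
  [/\ h (n + N)%N = h n, v (n + N)%N = v n & d (n + N)%N = d n].
Proof.
elim: n => [|n [e1 e2 e3]]; first exact: trace_period0.
have := trace_step n; have := trace_step (n + N).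
have -> : letter_at w (n + N)%N%:Z = letter_at w n%:Z.
  by rewrite PoszD -[N%:Z]mulr1 letter_at_periodic.
by rewrite addSn; case: letter_at => -[-> -> ->] [-> -> ->]; rewrite ?e1 ?e2 ?e3.
Qed.

End TracePeriod.

Lemma expfz_sum (K : fieldType) (a : K) I (s : seq I) (P : pred I) (F : I -> int) :
  a != 0 -> a ^ (\sum_(i <- s | P i) F i) = \prod_(i <- s | P i) a ^ F i.
Proof.
move=> a0; elim: s => [|i s IH]; first by rewrite !big_nil expr0z.
by rewrite !big_cons; case: (P i); rewrite // expfzDr // IH.
Qed.

Section CuspProduct.
Variable C : fieldType.
Variables (w : seq letter) (q : 'I_(size w) -> 'Z_3) (z : 'I_(size w) -> C).
Notation N := (size w).
Hypothesis N_gt0 : (0 < N)%N.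
Hypothesis z_nondeg : forall j, z j != 0 /\ z j != 1.

Definition ordz (i : int) : 'I_N := Ordinal (ltn_pmod `|(i %% N%:Z)%Z|%N N_gt0).

Lemma ordzE (i : int) (j : 'I_N) : ((i %% N%:Z)%Z == j%:Z) = (j == ordz i).
Proof.
have N0 : N%:Z != 0 by rewrite eqz_nat -lt0n.
have [m em] : exists m : nat, (i %% N%:Z)%Z = m by exists `|(i %% N%:Z)%Z|%N; rewrite gez0_abs ?modz_ge0.
have mN : (m < N)%N by have := ltz_pmod i (_ : 0 < N%:Z); rewrite em ltz_nat => -> //; lia.
by rewrite -val_eqE /= em eqz_nat absz_nat modn_small // eq_sym.
Qed.

Definition tet_shape (i : int) (p : 'Z_3) : C := shape_param (z (ordz i)) (p - q (ordz i)).

Lemma shape_param_neq0 j sq : shape_param (z j) sq != 0.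
Proof.
have [z0 z1] := z_nondeg j.
have z1' : 1 - z j != 0 by rewrite subr_eq0 eq_sym.
move: sq; apply: forall_Z3; rewrite /shape_param //= ?invr_eq0 //.
by rewrite subr_eq0 eq_sym invr_eq1.
Qed.

Lemma prod_Crow (c : seq Defs.arc) :
  \prod_j \prod_(sq : 'Z_3) shape_param (z j) sq ^ (Crow q c sq j) =
  \prod_(s <- c) tet_shape (arc_tri s).1 (arc_pivot s) ^ (if s.2 then 1 else -1).
Proof.
have nz := shape_param_neq0; rewrite /Crow.
under eq_bigr => j _ do under eq_bigr => sq _ do rewrite expfz_sum //.
under eq_bigr => j _ do under eq_bigr => sq _ do rewrite big_mkcond /=.
under eq_bigr => j _ do rewrite exchange_big /=.
rewrite exchange_big /=; apply: eq_bigr => s _.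
have hj := ordzE (arc_tri s).1; rewrite /tet_shape; move: (ordz _) hj => o hj.
rewrite (bigD1 o) //= [X in _ * X]big1 ?mulr1; last first.
  by move=> j nj; rewrite big1 // => sq _; rewrite hj (negbTE nj).
rewrite (bigD1 (arc_pivot s - q o)) //= subrK hj !eqxx /=.
rewrite big1 ?mulr1 // => sq nsq; case: eqP => // e.
by move: nsq; rewrite e addrK eqxx.
Qed.

End CuspProduct.

(** * From completeness to the shapes in terms of traces *)

Section Geometry.
Variable C : fieldType.
Hypothesis two_neq0 : 2 != 0 :> C.
Variables (w : seq letter) (neg : bool) (rho : 'I_3 -> 'M[C]_2).
Variables (q : 'I_(size w) -> 'Z_3) (z : 'I_(size w) -> C).
Notation N := (size w).
Hypothesis N_gt1 : (1 < N)%N.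
Hypothesis letter0 : letter_at w 0 = LetL.
Hypothesis letter1 : letter_at w 1 = LetR.
Hypothesis det_rho : forall x, \det (rho x) = 1.
Notation ev := (gw_eval rho).
Hypothesis rel_a : ev (relator_a w neg) = 1%:M.
Hypothesis rel_b : ev (relator_b w neg) = 1%:M.
Hypothesis faithful : forall u, ev u = 1%:M \/ ev u = - 1%:M -> pi1_eq w neg u [::].
Hypothesis z_nondeg : forall j, z j != 0 /\ z j != 1.
Hypothesis complete : forall c, peripheral_curve w neg c ->
  \prod_j \prod_(sq : 'Z_3) shape_param (z j) sq ^ (Crow q c sq j) = 1.
Variable x : 'cV[C]_2.
Hypothesis x_neq0 : x != 0.
Hypothesis fix_longitude : exists c, ev longitude *m x = c *: x.
Hypothesis fix_meridian : exists c, ev (meridian w neg) *m x = c *: x.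
Hypothesis z_cross : forall j : 'I_N,
  z j = cross_ratio x (fun p => ev (tet_corner w j p) *m x) (q j).

Notation A n := (ev (pi1_frame w n%N).1).
Notation B n := (ev (pi1_frame w n%N).2).
Notation L := (ev longitude).
Notation H n := (bracket x (A n *m x)).
Notation V n := (bracket x (B n *m x)).
Notation D n := (bracket x (A n *m B n *m x)).
Notation W n := (bracket (B n *m x) (A n *m x)).
Notation h := (trh w rho).
Notation v := (trv w rho).
Notation d := (trd w rho).

Let dev := det_gw_eval det_rho.
Let uev := unit_gw_eval det_rho.
Let comm := frame_commutator w det_rho.
Let N_gt0 : (0 < N)%N := ltnW N_gt1.

Definition frame_shape (n : nat) (p : 'Z_3) : C := cross_ratio x (corners (A n) (B n) x) p.

Lemma eigen_neq0 (M : 'M[C]_2) c : M \in unitmx -> M *m x = c *: x -> c != 0.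
Proof.
move=> uM Mx; apply: contraNneq x_neq0 => c0.
by rewrite -(mulKmx uM x) Mx c0 scale0r mulmx0.
Qed.

Lemma z_crE (j : 'I_N) : z j = frame_shape j (q j).
Proof.
have e p : ev (tet_corner w j p) *m x = corners (A j) (B j) x p.
  rewrite /tet_corner; case: (pi1_frame w j) => al be /=.
  by move: p; apply: forall_Z3; rewrite /corners //= gw_evalD.
by rewrite z_cross /frame_shape /cross_ratio !e.
Qed.

(** Equivariance under s. Brackets are SL_2-invariant and cross-ratios homogeneous, so a common
    factor is harmless. *)
Lemma meridian_scaling : exists2 k, k != 0 &
  [/\ H 0 = k * H N, V 0 = k * V N, D 0 = k * D N & W 0 = k * W N].
Proof.
have [c Lx] := fix_longitude; have [m Mx] := fix_meridian.
have c0 := eigen_neq0 (uev _) Lx; have m0 := eigen_neq0 (uev _) Mx.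
have [ea eb] := ev_monodromy det_rho rel_a rel_b.
have us : rho gs \in unitmx by rewrite unitmxE det_rho unitr1.
have A0 : A 0 = rho ga by rewrite /= mulmx1.
have B0 : B 0 = rho gb by rewrite /= mulmx1.
have sA : rho gs *m rho ga = ev (monodromy w neg).1 *m rho gs.
  by rewrite ea mulmxKV.
have sB : rho gs *m rho gb = ev (monodromy w neg).2 *m rho gs.
  by rewrite eb mulmxKV.
have bs := bracket_mul _ _ (det_rho gs).
rewrite A0 B0 -(bs x (rho ga *m x)) -(bs x (rho gb *m x)) -(bs x (rho ga *m rho gb *m x)).
rewrite -(bs (rho gb *m x)) !(mulmxA (rho gs)) sA sB -!mulmxA.
rewrite (mulmxA (rho gs) (rho gb)) sB -!mulmxA.
move: Mx; rewrite monodromyE /meridian; case: neg => Mx /=; last first.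
  have sx : rho gs *m x = m *: x by rewrite -Mx /= mulmx1.
  exists (m * m); first by rewrite mulf_neq0.
  by rewrite sx -!scalemxAr !bracketZl !bracketZr !mulrA.
(* For epsilon = -1, s sends V to the opposite corner of the parallelogram of level [N], and sides
   are read from there. *)
have sx : rho gs *m x = m *: (A N *m (B N *m x)).
  move: Mx; rewrite gw_evalD (gw_evalV det_rho) !gw_evalD /= mulmx1 => Mx.
  have uAB : A N *m B N \in unitmx by rewrite unitmx_mul !uev.
  by rewrite -(mulKVmx uAB (rho gs *m x)) (mulmxA (invmx _)) Mx -scalemxAr -mulmxA.
have LA : A N *m (B N *m x) = c *: (B N *m (A N *m x)).
  by rewrite mulmxA comm -mulmxA Lx -scalemxAr mulmxA.
have VB : ev (gw_inv (pi1_frame w N).2) *m (A N *m (B N *m x)) = c *: (A N *m x).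
  by rewrite LA (gw_evalV det_rho) -scalemxAr mulKmx.
have VA (y : 'cV_2) : ev (gw_inv (pi1_frame w N).1) *m (A N *m y) = y.
  by rewrite (gw_evalV det_rho) mulKmx.
have bAB : bracket (A N *m (B N *m x)) (B N *m x) = - (c * H N).
  by rewrite mulmxA; apply: bracket_corner12.
have bAA : bracket (A N *m (B N *m x)) (A N *m x) = - V N.
  by rewrite bracketC mulmxA bracket_corner01.
exists (- (m * m * c)); first by rewrite oppr_eq0 !mulf_neq0.
rewrite sx -!scalemxAr VA VB -!scalemxAr VA !bracketZl !bracketZr bAB bAA; split.
- by ring.
- by ring.
- by rewrite bracketC; ring.
by rewrite bracketC; ring.
Qed.

Lemma crN p : frame_shape N p = frame_shape 0%N p.
Proof.
have [c Lx] := fix_longitude; have [k k0 [eH eV eD eW]] := meridian_scaling.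
have dA n := dev (pi1_frame w n).1; have dB n := dev (pi1_frame w n).2.
have sc (a b : C) : a / b = k ^+ 2 * a / (k ^+ 2 * b).
  by rewrite -mulf_div divff ?mul1r ?expf_neq0.
move: p; apply: forall_Z3; rewrite /frame_shape.
- by rewrite !(cross_ratio0 _ x (dA _)) eV eD eW [LHS]sc; congr (_ / _); ring.
- by rewrite !(cross_ratio1 (dA _) (dB _) (comm _) Lx) eH eV [LHS]sc; congr (_ / _); ring.
by rewrite !(cross_ratio2 (dB _) (comm _) Lx) eH eD eW [LHS]sc; congr (_ / _); ring.
Qed.

Lemma cr_shape n : (n < N)%N -> forall c, L *m x = c *: x ->
  [/\ c * H n ^+ 2 != 0, V n ^+ 2 != 0, D n * W n != 0 &
      forall p, tet_shape q z N_gt0 n p = frame_shape n p].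
Proof.
move=> nN c Lx; have dA := dev (pi1_frame w n).1; have dB := dev (pi1_frame w n).2.
have [z0 z1] := z_nondeg (Ordinal nN).
have on : ordz N_gt0 n = Ordinal nN.
  by apply: val_inj; rewrite /= modz_small ?absz_nat ?modn_small // lez_nat ltz_nat.
rewrite /tet_shape on.
have [e0 e1] := (cross_ratio0 (B n) x dA, cross_ratio1 dA dB (comm n) Lx).
have e2 := cross_ratio2 dB (comm n) Lx.
have [i1 i2 i3 i4] := @shape_cross_ratio C (frame_shape n) _ _ _ (q (Ordinal nN)) _
  (plucker_corners dA dB (comm n) Lx) e0 e1 e2 (z_crE (Ordinal nN)) z0 z1.
by split.
Qed.

(** The normal longitude reaches level 2, outside the first period when [N = 2]; [crN] then brings
    it back to level 0. *)
Lemma tet_shape2 p : tet_shape q z N_gt0 2 p = frame_shape 2%N p.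
Proof.
have [c Lx] := fix_longitude.
have [N2|N2] := ltnP 2 N; first by have [_ _ _ ->] := cr_shape N2 Lx.
have eN : N = 2%N by apply/eqP; rewrite eqn_leq N2.
have [_ _ _ e] := cr_shape N_gt0 Lx; rewrite -[X in frame_shape X]eN crN -e.
rewrite /tet_shape; have -> // : ordz N_gt0 2 = ordz N_gt0 0%N.
by apply: val_inj; rewrite /= eN.
Qed.

(** The curve consists of two halves with the same shapes. By [key] each half contributes [- c], so
    the completeness equation reads [c ^+ 2 = 1]. *)
Lemma longitude_eigenvalue c : L *m x = c *: x -> c ^+ 2 = 1.
Proof.
move=> Lx; have c0 := eigen_neq0 (uev _) Lx.
have := complete (peripheral_longitude neg letter0 letter1).
rewrite (prod_Crow q N_gt0 z_nondeg) /longitude_arcs !big_cons big_nil /arc_tri /arc_pivot /=.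
have dA n := dev (pi1_frame w n).1; have dB n := dev (pi1_frame w n).2.
have [nH0 nV0 _ s0] := cr_shape N_gt0 Lx; have [nH1 nV1 nD1 s1] := cr_shape N_gt1 Lx.
rewrite !tet_shape2 !(s0 _ : tet_shape q z N_gt0 0 _ = _) !(s1 _ : tet_shape q z N_gt0 1 _ = _).
have e3 : 2 + 1 = 0 :> 'Z_3 by exact: val_inj.
rewrite e3 add0r {e3}.
have f1 : pi1_frame w 1 = pi1_next LetL (pi1_frame w 0).
  by rewrite pi1_frameS letter0.
have f2 : pi1_frame w 2 = pi1_next LetR (pi1_frame w 1).
  by rewrite pi1_frameS letter1.
have eA1 : A 1 = B 0 *m A 0 by rewrite f1 gw_evalD.
have eB1 : B 1 = B 0 by rewrite f1.
have eA2 : A 2 = A 1 by rewrite f2.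
have eB2 : B 2 = A 1 *m B 1 by rewrite f2 gw_evalD.
have eW1 : W 1 = H 0 by rewrite eA1 eB1 -mulmxA (bracket_mul _ _ (dB _)).
have key : frame_shape 1 2 * frame_shape 2 1 = - c * (frame_shape 1 0 * frame_shape 0 1).
  rewrite /frame_shape (cross_ratio2 (dB _) (comm _) Lx) (cross_ratio0 _ x (dA _)).
  rewrite !(cross_ratio1 (dA _) (dB _) (comm _) Lx) eA2 eB2 eW1.
  have nH0' : H 0 != 0 by apply: contraNneq nH0 => ->; rewrite expr0n mulr0.
  have nH1' : H 1 != 0 by apply: contraNneq nH1 => ->; rewrite expr0n mulr0.
  have nV0' : V 0 != 0 by apply: contraNneq nV0 => ->; rewrite expr0n.
  have nD1' : D 1 != 0 by apply: contraNneq nD1 => ->; rewrite mul0r.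
  rewrite eB1 in nD1' *.
  move: (H 0) (H 1) (V 0) (bracket x (A 1 *m B 0 *m x)) nH0' nH1' nV0' nD1' => h0 h1 v0 d1.
  by move=> nh0 nh1 nv0 nd1; field; rewrite c0 nh0 nh1 nv0 nd1.
have cr_neq0 n p : (n < N)%N -> frame_shape n p != 0.
  move=> nN; have [_ _ _ <-] := cr_shape nN Lx.
  exact: shape_param_neq0.
move=> e; rewrite -{}e !expr1z !exprN1.
have n10 := cr_neq0 1%N 0 N_gt1; have n01 := cr_neq0 0%N 1 N_gt0.
transitivity ((frame_shape 1 2 * frame_shape 2 1 / (frame_shape 1 0 * frame_shape 0 1)) ^+ 2); last by field; rewrite n10 n01.
by rewrite key (mulfK (mulf_neq0 n10 n01)); ring.
Qed.

Lemma shape_traces : exists k : C, [/\ k != 0, \tr L = - 2 &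
  forall n, [/\ 2 * h n = k * H n, 2 * v n = - (k * V n) & 2 * d n = - (k * D n)]].
Proof.
have [c Lx] := fix_longitude; have c2 := longitude_eigenvalue Lx.
have [trL [k Lk]] := parabolic_form (dev _) x_neq0 Lx c2.
have k0 : k != 0.
  (* Without parabolic part, [L] would be 1 or -1. *)
  apply/eqP => k0; apply: (@longitude_nontrivial w neg); apply: faithful.
  rewrite Lk k0 scale0r addr0.
  have : (c - 1) * (c + 1) = 0.
    by transitivity (c ^+ 2 - 1); [ring|rewrite c2 subrr].
  move=> /eqP; rewrite mulf_eq0 subr_eq0 addr_eq0 => /orP[]/eqP->; first by left.
  by right; rewrite raddfN.
have dA n := dev (pi1_frame w n).1; have dB n := dev (pi1_frame w n).2.
have t1 n : (1 - c) * h n = k * H n by exact: (trace_bracket1 (dB n) (comm n) Lk).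
have [nH0 _ _ _] := cr_shape N_gt0 Lx.
have cN1 : c = -1.
  have : (c - 1) * (c + 1) = 0.
    by transitivity (c ^+ 2 - 1); [ring|rewrite c2 subrr].
  move=> /eqP; rewrite mulf_eq0 subr_eq0 addr_eq0 => /orP[]/eqP // c1.
  have := t1 0%N; rewrite c1 subrr mul0r => /esym/eqP; rewrite mulf_eq0 (negbTE k0) /= => H0.
  by move: nH0; rewrite (eqP H0) expr0n mulr0 eqxx.
have m2 : 1 - c = 2 by rewrite cN1 opprK.
exists k; split=> //; first by rewrite trL cN1 mulrN1.
move=> n; rewrite -m2; split; first exact: t1.
  exact: (trace_bracket2 (dA n) (dB n) (comm n) Lk).
(* The pair [A], [A B] has the same commutator [L] as the pair [A], [B]. *)
have dAB : \det (A n *m B n) = 1 by rewrite det_mulmx dA dB mulr1.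
rewrite trdE; apply: (trace_bracket2 (dA n) dAB _ Lk).
by rewrite {1}comm !mulmxA.
Qed.

Lemma trace_longitude : \tr L != 2.
Proof.
have [k [_ -> _]] := shape_traces; rewrite eq_sym -subr_eq0 opprK.
by rewrite (_ : 2 + 2 = 2 * 2) ?mulf_neq0 //; ring.
Qed.

Lemma trace_markov n : h n ^+ 2 + v n ^+ 2 + d n ^+ 2 = h n * v n * d n.
Proof.
have [k [_ trL _]] := shape_traces.
have := trace_commutator (dev (pi1_frame w n).1) (dev (pi1_frame w n).2) (comm n).
rewrite trL -trdE => /eqP; rewrite -subr_eq0 => /eqP e.
apply/eqP; rewrite -subr_eq0 -[X in _ == X]oppr0 -e; apply/eqP.
by rewrite /trh /trv; ring.
Qed.

Lemma shape_from_traces n : (n < N)%N ->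
  [/\ h n != 0, v n != 0, d n != 0, h n ^+ 2 + v n ^+ 2 != 0 &
      [/\ frame_shape n 0 = (h n ^+ 2 + v n ^+ 2) / v n ^+ 2, frame_shape n 1 = - v n ^+ 2 / h n ^+ 2 &
          frame_shape n 2 = h n ^+ 2 / (h n ^+ 2 + v n ^+ 2)]].
Proof.
move=> nN; have [k [k0 trL tr]] := shape_traces; have [eh ev' ed] := tr n.
have [c Lx] := fix_longitude; have c2 := longitude_eigenvalue Lx.
have [trL' _] := parabolic_form (dev _) x_neq0 Lx c2.
have cN1 : c = -1 by apply: (mulfI two_neq0); rewrite -trL' trL mulrN1.
have dA := dev (pi1_frame w n).1; have dB := dev (pi1_frame w n).2.
have [nH nV nDW _] := cr_shape nN Lx.
have pl := plucker_corners dA dB (comm n) Lx.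
have e0 := cross_ratio0 (B n) x dA; have e1 := cross_ratio1 dA dB (comm n) Lx.
have e2 := cross_ratio2 dB (comm n) Lx.
move: nH nV nDW; rewrite {1}cN1 mulN1r oppr_eq0 !expf_eq0 /= mulf_eq0 negb_or.
move=> nH nV /andP[nD nW].
have h_eq : h n = k / 2 * H n by apply: (mulfI two_neq0); rewrite eh; field.
have v_eq : v n = - (k / 2 * V n) by apply: (mulfI two_neq0); rewrite ev'; field.
have d_eq : d n = - (k / 2 * D n) by apply: (mulfI two_neq0); rewrite ed; field.
have k2 : k / 2 != 0 by rewrite mulf_neq0 ?invr_eq0.
have DW : D n * W n = - (H n ^+ 2 + V n ^+ 2) by rewrite pl cN1; ring.
have nHV : H n ^+ 2 + V n ^+ 2 != 0 by rewrite -oppr_eq0 -DW mulf_neq0.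
have hv : h n ^+ 2 + v n ^+ 2 = (k / 2) ^+ 2 * (H n ^+ 2 + V n ^+ 2).
  by rewrite h_eq v_eq; ring.
rewrite hv h_eq v_eq d_eq !oppr_eq0 !(mulf_neq0 k2) ?mulf_neq0 ?expf_neq0 ?invr_eq0 //.
split=> //; rewrite /frame_shape e0 e1 e2 DW cN1 sqrrN; split.
- by field; rewrite nV k0 two_neq0.
- by field; rewrite oppr_eq0 oner_eq0 nH k0 two_neq0.
by field; rewrite oppr_eq0 nHV k0 two_neq0.
Qed.

End Geometry.

(** * The flattening *)

Section FlatteningProduct.
Variable C : fieldType.
Variables (l : nat -> letter) (N : nat) (h v d : nat -> C) (T : nat -> 'Z_3 -> int).
Variables (s : bool -> nat -> int) (sd : nat -> int).
Hypothesis step : forall n,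
  if l n is LetR then [/\ h n.+1 = h n, v n.+1 = d n & d n.+1 = h n * d n - v n]
  else [/\ h n.+1 = d n, v n.+1 = v n & d n.+1 = v n * d n - h n].
Hypothesis markov : forall n, h n ^+ 2 + v n ^+ 2 + d n ^+ 2 = h n * v n * d n.
Hypothesis h_neq0 : forall n, h n != 0.
Hypothesis v_neq0 : forall n, v n != 0.
Hypothesis d_neq0 : forall n, d n != 0.
Hypothesis T_sum : forall n, T n 0 + T n 1 + T n 2 = 1.
Hypothesis layers : forall n, sd n.+1 = T n.+1 1 /\
  forall c, s c n.+1 = (if is_R (l n) == c then sd n else s c n)
                     + T n.+1 (exchanged_label c) *+ 2.
Hypothesis edges : forall n, s (is_R (l n)) n + T n.+1 1 = 2.

Definition potential n : C :=
  h n ^ (s false n - 1) * v n ^ (s true n - 1) * d n ^ (sd n - 1).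

Lemma potential_step n : potential n.+1 = potential n *
  ((h n.+1 ^+ 2 / (h n.+1 ^+ 2 + v n.+1 ^+ 2)) ^ T n.+1 0 *
   (v n.+1 ^+ 2 / (h n.+1 ^+ 2 + v n.+1 ^+ 2)) ^ T n.+1 2).
Proof.
(* x is kept, y is exchanged for y', and z becomes old; x^2 + z^2 = y y'. *)
have main (x y z y' : C) (a b c e0 e1 e2 : int) :
    x != 0 -> y != 0 -> z != 0 -> y' != 0 -> x ^+ 2 + z ^+ 2 = y * y' ->
    e0 + e1 + e2 = 1 -> b + e1 = 2 ->
  x ^ (a + e0 *+ 2 - 1) * z ^ (c + e2 *+ 2 - 1) * y' ^ (e1 - 1) =
  x ^ (a - 1) * y ^ (b - 1) * z ^ (c - 1) *
  ((x ^+ 2 / (x ^+ 2 + z ^+ 2)) ^ e0 * (z ^+ 2 / (x ^+ 2 + z ^+ 2)) ^ e2).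
  move=> nx ny nz ny' -> es eb.
  have -> : a + e0 *+ 2 - 1 = (a - 1) + (e0 + e0) by rewrite mulr2n; ring.
  have -> : c + e2 *+ 2 - 1 = (c - 1) + (e2 + e2) by rewrite mulr2n; ring.
  (* The edge equation and the angle sum make the exponents of [y] and [y'] opposite, as the
     denominator [y y'] requires. *)
  have -> : b - 1 = e0 + e2 by lia.
  have -> : e1 - 1 = - (e0 + e2) by lia.
  have quot u e : u != 0 -> (u ^+ 2 / (y * y')) ^ e = u ^ (e + e) * (y ^ (- e) * y' ^ (- e)).
    by move=> nu; rewrite expr2 !expfzMl invfM expfzMl expfzDr // !exprz_inv.
  rewrite !quot //; move: (a - 1) (c - 1) => a' c'.
  rewrite !expfzDr // !opprD !expfzDr //.
  have yV (u : C) (e : int) : u != 0 -> u ^ (- e) = (u ^ e)^-1 by move=> nu; rewrite invr_expz.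
  have znz (u : C) (e : int) : u != 0 -> u ^ e != 0 by exact: expfz_neq0.
  rewrite !yV //.
  have := znz y e0 ny; have := znz y e2 ny; have := znz y' e0 ny'; have := znz y' e2 ny'.
  move: (y ^ e0) (y ^ e2) (y' ^ e0) (y' ^ e2) (x ^ e0) (z ^ e2) (x ^ a') (z ^ c') => A B A' B' X Z X' Z'.
  move=> n1 n2 n3 n4; field; rewrite n1 n2 n3 n4 //.
have := step n; have [sdE sE] := layers n; have := edges n.
have := markov n; have := T_sum n.+1.
have {sE} := (sE false, sE true) => -[sf st].
rewrite /potential sdE sf st /exchanged_label.
have hn := h_neq0 n; have vn := v_neq0 n; have dn := d_neq0 n; have dn1 := d_neq0 n.+1.
case: (l n) => /= es mk ed [hE vE dE]; rewrite hE vE in sdE *; rewrite dE in dn1 *.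
  rewrite (main (h n) (v n) (d n) _ _ (s true n)) //.
  by apply/eqP; rewrite -subr_eq0; apply/eqP; rewrite mulrBr; move: mk; move/eqP; rewrite -subr_eq0 => /eqP <-; ring.
have -> : d n ^ (sd n + T n.+1 0 *+ 2 - 1) * v n ^ (s true n + T n.+1 2 *+ 2 - 1) =
  v n ^ (s true n + T n.+1 2 *+ 2 - 1) * d n ^ (sd n + T n.+1 0 *+ 2 - 1) by rewrite mulrC.
rewrite (addrC (d n ^+ 2)) (main (v n) (h n) (d n) _ _ (s false n)) //.
- by ring.
- apply/eqP; rewrite -subr_eq0; apply/eqP; rewrite mulrBr.
  by move: mk; move/eqP; rewrite -subr_eq0 => /eqP <-; ring.
- by rewrite -es; ring.
Qed.

Lemma flattening_product :
  h N = h 0 -> v N = v 0 -> d N = d 0 -> (forall c, s c N = s c 0) -> sd N = sd 0 ->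
  \prod_(n < N) ((h n.+1 ^+ 2 / (h n.+1 ^+ 2 + v n.+1 ^+ 2)) ^ T n.+1 0 *
                 (v n.+1 ^+ 2 / (h n.+1 ^+ 2 + v n.+1 ^+ 2)) ^ T n.+1 2) = 1.
Proof.
move=> hN vN dN sN sdN.
have p0 : potential 0 != 0 by rewrite !mulf_neq0 // expfz_neq0.
have pN : potential N = potential 0 by rewrite /potential hN vN dN !sN sdN.
apply: (mulfI p0); rewrite mulr1 -{}[RHS]pN.
elim: {hN vN dN sN sdN} N => [|n IH]; first by rewrite big_ord0 mulr1.
by rewrite big_ord_recr /= (mulrA (potential 0)) IH -potential_step.
Qed.

End FlatteningProduct.

Section FlatteningStates.
Variable w : seq letter.
Notation N := (size w).
Notation d := (dvec w).
Notation lw n := (letter_at w (n%:Z - 1)).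
Hypothesis N_gt0 : (0 < N)%N.
Hypothesis has_R : exists2 k, (k < N)%N & lw k = LetR.
Hypothesis has_L : exists2 k, (k < N)%N & lw k = LetL.
Variable T : nat -> 'Z_3 -> int.
Hypothesis T_per : forall n p, T (n + N)%N p = T n p.
Hypothesis T_edge : forall b : 'I_N,
  \sum_(k < 3) \sum_(n < N) edge_weight w T (d b) (N * k + n) = 2.

(** The case [t = 1] over the integers: the matrix inverted in [periodic_start] has determinant 1,
    so the periodic partial sums are integers. As deaths reach every residue modulo N, the [N] edge
    equations give 2 at every level. *)
Lemma flattening_states : exists s sd,
  [/\ layered w T s sd, forall c n, s c (n + N)%N = s c n, forall n, sd (n + N)%N = sd n &
      forall n, s (is_R (lw n)) n + T n 1 = 2].
Proof.
pose Y n : 'cV[int]_3 := \col_i nth 0 [:: T n 0 *+ 2; T n 2 *+ 2; T n 1] i.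
pose St n := layer_state (fun n => lw n) (periodic_start (fun n => lw n) Y N 1) Y n.
have St_per n : St (n + N)%N = St n.
  rewrite -[RHS]scale1r; apply: layer_state_periodic; rewrite ?unitr1 // => k.
    exact: lw_periodic.
  by rewrite scale1r; apply/colP => i; rewrite !mxE !T_per.
pose s (c : bool) n := St n (if c then 1 else 0) 0; pose sd n := St n 2 0.
have s_per c n : s c (n + N)%N = s c n by rewrite /s St_per.
have sd_per n : sd (n + N)%N = sd n by rewrite /sd St_per.
have lay : layered w T s sd.
  move=> n; rewrite /s /sd /St /= -/(St n); split.
    by rewrite mxE mulmx3E; case: letter_at; rewrite !mxE /= ?mul0r ?add0r ?mul1r.
  move=> c; rewrite mxE mulmx3E.
  by case: letter_at; case: c; rewrite !mxE /= ?mul0r ?addr0 ?add0r ?mul1r.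
exists s, sd; split=> //.
pose res n := s (is_R (lw n)) n + T n 1.
have res_per n m : res (n + N * m)%N = res n.
  elim: m => [|m IH]; first by rewrite muln0 addn0.
  by rewrite mulnS addnCA addnC /res s_per T_per lw_periodic.
have [death deathP] := fin_all_exists (fun b : 'I_N => edge_lifetime b N_gt0).
have pi_inj : injective (fun b => Ordinal (ltn_pmod (death b) N_gt0)).
  move=> b b' /(congr1 val) /= e; have [_ low _] := deathP b; have [_ low' _] := deathP b'.
  exact: val_inj (edge_death_inj (ltn_ord b) (ltn_ord b') low low' e).
have [inv _ invK] := injF_bij pi_inj.
move=> n; rewrite -/(res n) (divn_eq n N) addnC mulnC res_per.
have /(congr1 val) /= <- := invK (Ordinal (ltn_pmod n N_gt0)).
move: (inv _) => b; have [_ _ wt] := deathP b.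
by rewrite -(res_per _ (death b %/ N)%N) addnC mulnC -divn_eq -(T_edge b)
  -edge_weight_window // (wt _ _ _ _ lay).
Qed.

End FlatteningStates.

(** * The twisted 1-loop invariant *)

Lemma fsbig_window (V : nmodType) (F : int -> V) (c : int) (n : nat) :
  (forall m, ~~ (0 <= m < n%:Z) -> F (m + c) = 0) ->
  \sum_(k \in [set: int]%classic) F k = \sum_(m < n) F (m%:Z + c).
Proof.
move=> F0; rewrite (@fsbigE _ _ _ _ _ [seq (m%:Z + c) | m <- iota 0 n]).
- rewrite big_map -{1}[n]subn0 -/(index_iota 0 n) big_mkord.
  by apply: eq_bigl => i; rewrite in_setT.
- by rewrite map_inj_uniq ?iota_uniq // => a b /addIr [].
- by [].
move=> k _; rewrite -[k in F k](subrK c) => nk; apply: F0; apply: contra nk.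
case/andP=> k0 k3; apply/mapP; exists (absz (k - c)%R); last lia.
by rewrite mem_iota; lia.
Qed.

Section GluingMatrices.
Variable w : seq letter.
Notation N := (size w).
Notation d := (dvec w).
Variables (q : 'I_N -> 'Z_3) (le lt : 'I_N -> int).
Hypothesis N_gt0 : (0 < N)%N.

Lemma GkE sq m i j : Gk q le lt sq (m + (le i - lt j)) i j =
  incidence w (d i) (j%:Z + N%:Z * m) (sq + q j).
Proof.
rewrite mxE -[RHS](incidence_shift w (le i)) -addrA -mulrDr.
by rewrite (_ : lt j + (m + (le i - lt j)) = m + le i) //; lia.
Qed.

Lemma G1E sq i j : G1 q le lt sq i j =
  \sum_(m < 3) (incidence w (d i) (j%:Z + N%:Z * m%:Z) (sq + q j))%:Z.
Proof.
rewrite mxE (@fsbig_window _ _ (le i - lt j) 3) => [|m m3]; last first.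
  by rewrite GkE incidence_window.
by apply: eq_bigr => m _; rewrite GkE.
Qed.

Section TwistedGluing.
Variables (C K : fieldType) (iota : {rmorphism C -> K}) (t : K).
Hypothesis t_neq0 : t != 0.

(** The chosen lifts only scale the row of an edge and the column of a tetrahedron by powers of [t],
    hence change the determinant by a unit. *)
Lemma twisted_gluing_entry sq i j :
  \sum_(k \in [set: int]%classic) (Gk q le lt sq k i j)%:R * t ^ k =
  t ^ (le i) * (\sum_(m < 3) t ^+ m *
     (incidence w (d i) (j%:Z + N%:Z * m%:Z) (sq + q j))%:R) * t ^ (- lt j).
Proof.
rewrite (@fsbig_window _ _ (le i - lt j) 3) => [|m m3]; last first.
  by rewrite GkE incidence_window // mul0r.
rewrite mulr_sumr mulr_suml; apply: eq_bigr => m _.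
by rewrite GkE !expfzDr // -exprnP; ring.
Qed.

Lemma det_twisted_gluing (Z : 'I_N -> 'Z_3 -> C) (r : nat -> 'Z_3 -> K) :
  (forall (j : 'I_N) p, iota (Z j (p - q j)) = r j p * iota (Z j (1 - q j))) ->
  \det (\sum_(sq : 'Z_3)
      (\matrix_(i, j) \sum_(k \in [set: int]%classic) (Gk q le lt sq k i j)%:R * t ^ k)
      *m diag_mx (\row_j iota (Z j sq))) =
  t ^ (\sum_i le i - \sum_j lt j) * iota (\prod_j Z j (1 - q j)) *
  \det (incidence_mx w t r).
Proof.
move=> Zr.
have -> : \sum_(sq : 'Z_3)
      (\matrix_(i, j) \sum_(k \in [set: int]%classic) (Gk q le lt sq k i j)%:R * t ^ k)
      *m diag_mx (\row_j iota (Z j sq)) =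
    diag_mx (\row_i t ^ le i) *m incidence_mx w t r *m
    diag_mx (\row_j (t ^ (- lt j) * iota (Z j (1 - q j)))).
  apply/matrixP => i j; rewrite mul_mx_diag mxE mul_diag_mx [incidence_mx _ _ _]lock !mxE -lock.
  rewrite summxE (reindex_inj (addIr (- q j))) /= mxE mulr_sumr mulr_suml.
  transitivity (\sum_p t ^ le i * (\sum_(m < 3) t ^+ m *
      (r j p *+ incidence w (d i) (j%:Z + N%:Z * m%:Z) p)) *
      (t ^ (- lt j) * iota (Z j (1 - q j)))).
    apply: eq_bigr => p _; rewrite mul_mx_diag !mxE twisted_gluing_entry Zr subrK.
    rewrite !mulr_sumr !mulr_suml; apply: eq_bigr => m _.
    by rewrite -[_ *+ incidence _ _ _ _]mulr_natr; ring.
  rewrite -mulr_suml -mulr_sumr exchange_big mulr_sumr mulr_suml /=.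
  by apply: eq_bigr => m _; rewrite -mulr_sumr.
rewrite !det_mulmx !det_diag.
under eq_bigr => i _ do rewrite mxE.
under [X in _ * X]eq_bigr => i _ do rewrite mxE.
rewrite big_split /= rmorph_prod.
rewrite -!expfz_sum // sumrN expfzDr //.
by move: (\det _) (\prod_j _) (t ^ _) (t ^ _) => a b c e; ring.
Qed.

End TwistedGluing.
End GluingMatrices.

(** * The 1-loop invariant in terms of the Jacobian *)

Section Core.
Variable C : fieldType.
Hypothesis two_neq0 : 2 != 0 :> C.
Variables (w : seq letter) (neg : bool) (rho : 'I_3 -> 'M[C]_2).
Variables (q : 'I_(size w) -> 'Z_3) (le lt : 'I_(size w) -> int) (z : 'I_(size w) -> C).
Variable f : 'Z_3 -> 'I_(size w) -> int.
Notation N := (size w).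
Hypothesis N_gt1 : (1 < N)%N.
Hypothesis letter0 : letter_at w 0 = LetL.
Hypothesis letter1 : letter_at w 1 = LetR.
Hypothesis det_rho : forall x, \det (rho x) = 1.
Notation ev := (gw_eval rho).
Hypothesis rel_a : ev (relator_a w neg) = 1%:M.
Hypothesis rel_b : ev (relator_b w neg) = 1%:M.
Hypothesis faithful : forall u, ev u = 1%:M \/ ev u = - 1%:M -> pi1_eq w neg u [::].
Hypothesis z_nondeg : forall j, z j != 0 /\ z j != 1.
Hypothesis complete : forall c, peripheral_curve w neg c ->
  \prod_j \prod_(sq : 'Z_3) shape_param (z j) sq ^ (Crow q c sq j) = 1.
Variable x : 'cV[C]_2.
Hypothesis x_neq0 : x != 0.
Hypothesis fix_longitude : exists c, ev longitude *m x = c *: x.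
Hypothesis fix_meridian : exists c, ev (meridian w neg) *m x = c *: x.
Hypothesis z_cross : forall j : 'I_N,
  z j = cross_ratio x (fun p => ev (tet_corner w j p) *m x) (q j).
Hypothesis f_sum : forall j, \sum_sq f sq j = 1.
Hypothesis f_edge : forall i, \sum_j \sum_sq G1 q le lt sq i j * f sq j = 2.

Notation h := (trh w rho).
Notation v := (trv w rho).
Notation d := (trd w rho).
Notation lw n := (letter_at w (n%:Z - 1)).

Let N_gt0 : (0 < N)%N := ltnW N_gt1.
Let has_R : exists2 k, (k < N)%N & lw k = LetR.
Proof.
have e : letter_at w (1 + N%:Z * 1) = LetR by rewrite letter_at_periodic.
have [N2|N2] := ltnP 2 N; first by exists 2.
(* When [N = 2], the letter of index -1 is that of index 1. *)
exists 0%N => //; rewrite -letter1 -(letter_at_periodic w (0%N%:Z - 1) 1).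
by congr (letter_at w _); lia.
Qed.
Let has_L : exists2 k, (k < N)%N & lw k = LetL.
Proof. by exists 1%N. Qed.

Let shape (j : 'I_N) := shape_from_traces two_neq0 N_gt1 letter0 letter1 det_rho rel_a rel_b
  faithful z_nondeg complete x_neq0 fix_longitude fix_meridian z_cross (ltn_ord j).
Let markov := trace_markov N_gt1 letter0 letter1 det_rho rel_a rel_b
  faithful z_nondeg complete x_neq0 fix_longitude fix_meridian z_cross.
Let step := trace_step w det_rho.
Let period := trace_period det_rho rel_a rel_b.

Let period_mod n : [/\ h n = h (n %% N)%N, v n = v (n %% N)%N & d n = d (n %% N)%N].
Proof.
rewrite {1 3 5}(divn_eq n N) addnC; elim: (n %/ N)%N => [|k IH]; first by rewrite addn0.
by rewrite mulSn addnCA addnC; have [-> -> ->] := period (n %% N + k * N).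
Qed.

Let nonzero n : [/\ h n != 0, v n != 0, d n != 0 & h n ^+ 2 + v n ^+ 2 != 0].
Proof.
have [-> -> ->] := period_mod n.
by have [] := shape (Ordinal (ltn_pmod n N_gt0)).
Qed.
Let h_neq0 n : h n != 0. Proof. by have [] := nonzero n. Qed.
Let v_neq0 n : v n != 0. Proof. by have [] := nonzero n. Qed.
Let d_neq0 n : d n != 0. Proof. by have [] := nonzero n. Qed.
Let hv_neq0 n : h n ^+ 2 + v n ^+ 2 != 0. Proof. by have [] := nonzero n. Qed.

Notation a := (shear_a h v).
Notation b := (shear_b h v).
Notation Z1 j := (zeta (z j) (1 - q j)).

Lemma zeta_shear (j : 'I_N) :
  [/\ Z1 j != 0, zeta (z j) (0 - q j) = a j * Z1 j & zeta (z j) (2 - q j) = b j * Z1 j].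
Proof.
have [h0 v0 _ s0 [X0 X1 X2]] := shape j.
apply: (zeta_ratio _ _ s0 X0 X1 X2 _); rewrite ?expf_neq0 //.
exact: z_crE z_cross j.
Qed.

(** In each tetrahedron the exponents of [Z1] add up to 1; the remaining ratios are, up to sign, the
    factors that telescope in [flattening_product]. *)
Lemma zeta_flattening : exists e : bool,
  \prod_j \prod_sq zeta (z j) sq ^ f sq j = (-1) ^+ e * \prod_j Z1 j.
Proof.
pose jn n : 'I_N := Ordinal (ltn_pmod n N_gt0).
have jnE (j : 'I_N) : jn j = j by apply: val_inj; rewrite /= modn_small.
pose T n (p : 'Z_3) : int := f (p - q (jn n)) (jn n).
have T_per n p : T (n + N)%N p = T n p.
  by rewrite /T (_ : jn (n + N)%N = jn n) //; apply: val_inj; rewrite /= modnDr.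
have T_sum n : T n 0 + T n 1 + T n 2 = 1.
  by rewrite -(f_sum (jn n)) (reindex_inj (addIr (- q (jn n)))) sum_Z3.
have T_edge (i : 'I_N) :
    \sum_(k < 3) \sum_(n < N) edge_weight w T (dvec w i) (N * k + n) = 2.
  rewrite -(f_edge i) exchange_big; apply: eq_bigr => j _.
  rewrite [RHS](reindex_inj (addIr (- q j))) /= /edge_weight exchange_big /=.
  apply: eq_bigr => p _; rewrite G1E // mulr_suml; apply: eq_bigr => k _.
  rewrite /T (_ : jn (N * k + j)%N = j) ?subrK; last first.
    by apply: val_inj; rewrite /= mulnC modnMDl modn_small.
  by rewrite PoszD PoszM [N%:Z * _ + _]addrC -mulr_natr mulrC natz.
have [s [sd [lay s_per sd_per edges]]] := flattening_states N_gt0 has_R has_L T_per T_edge.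
have lwS n : lw n.+1 = letter_at w n%:Z by rewrite -addn1 PoszD addrK.
have [hN vN dN] := period 0; rewrite add0n in hN vN dN.
pose F n : C := (h n ^+ 2 / (h n ^+ 2 + v n ^+ 2)) ^ T n 0 *
                (v n ^+ 2 / (h n ^+ 2 + v n ^+ 2)) ^ T n 2.
have F1 : \prod_(j < N) F j = 1.
  have := @flattening_product C (fun n => letter_at w n%:Z) N h v d T
    (fun c n => s c n.+1) (fun n => sd n.+1) step markov h_neq0 v_neq0 d_neq0 T_sum.
  move=> prod1; rewrite -[RHS]prod1 //; last first.
  - by rewrite -[N.+1]add1n sd_per.
  - by move=> c; rewrite -[N.+1]add1n s_per.
  - by move=> n; rewrite -lwS edges.
  - by move=> n; have := lay n.+1; rewrite lwS.
  (* The telescoping product runs over levels 1 to N, the tetrahedra over 0 to N - 1. *)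
  have FN : F N = F 0%N by rewrite /F hN vN -[N]add0n !T_per.
  have F0 : F 0%N != 0 by rewrite mulf_neq0 // expfz_neq0 // mulf_neq0 ?invr_eq0 ?expf_neq0.
  have er : \prod_(i < N.+1) F i = (\prod_(i < N) F i) * F N by rewrite big_ord_recr.
  by apply: (mulIf F0); rewrite -{1}FN -er big_ord_recl mulrC.
exists (odd (absz (\sum_(j < N) (T j 0 + T j 2))%R)).
have E (j : 'I_N) : \prod_sq zeta (z j) sq ^ f sq j = (-1) ^ (T j 0 + T j 2) * (F j * Z1 j).
  have [nZ e0 e2] := zeta_shear j.
  have prod_Z3 (G : 'Z_3 -> C) : \prod_p G p = G 0 * G 1 * G 2.
    rewrite !big_ord_recl big_ord0 mulr1 mulrA.
    by congr (_ * G _ * G _); apply: val_inj.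
  have TE p : f (p - q j) j = T j p by rewrite /T jnE.
  rewrite (reindex_inj (addIr (- q j))) prod_Z3 !TE e0 e2.
  have -> : T j 1 = 1 - (T j 0 + T j 2) by rewrite -(T_sum j); ring.
  have -> : a j = -1 * (h j ^+ 2 / (h j ^+ 2 + v j ^+ 2)) by rewrite /shear_a mulN1r mulNr.
  have -> : b j = -1 * (v j ^+ 2 / (h j ^+ 2 + v j ^+ 2)) by rewrite /shear_b mulN1r mulNr.
  rewrite /F.
  move: (h j ^+ 2 / _) (v j ^+ 2 / _) (Z1 j) nZ (T j 0) (T j 2) => A B Z nZ k m.
  have n1 : -1 != 0 :> C by rewrite oppr_eq0 oner_eq0.
  rewrite -!mulrA !expfzMl !expfzDr // expr1z opprD !expfzDr // -!invr_expz.
  have := expfz_neq0 k nZ; have := expfz_neq0 m nZ.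
  by move: (A ^ k) (B ^ m) (Z ^ k) (Z ^ m) ((-1) ^ k) ((-1) ^ m) => *; field; apply/andP.
rewrite (eq_bigr _ (fun j _ => E j)) big_split /= [X in _ * X]big_split /= F1 mul1r; congr (_ * _).
rewrite -expfz_sum ?oppr_eq0 ?oner_eq0 //.
by rewrite signr_odd; case: (\sum_j _) => k; rewrite ?NegzE // -exprnN -exprVn invrN1.
Qed.
Section Determinant.
Variables (K : fieldType) (iota : {rmorphism C -> K}) (t : K).
Hypothesis t_neq0 : t != 0.

Lemma det_gluing : exists (e : bool) (k : int),
  \det (\sum_(sq : 'Z_3)
      (\matrix_(i, j) \sum_(k \in [set: int]%classic) (Gk q le lt sq k i j)%:R * t ^ k)
      *m diag_mx (\row_j iota (zeta (z j) sq)))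
    / iota (\prod_j \prod_(sq : 'Z_3) zeta (z j) sq ^ f sq j) =
  (-1) ^+ e * t ^ k * \det (t^-1%:M - map_mx iota (jac_prod w rho N)).
Proof.
pose r n (p : 'Z_3) : K := iota (nth 0 [:: a n; 1; b n] p).
have r1 n : r n 1 = 1 by rewrite /r rmorph1.
have r_per n p : r (n + N)%N p = r n p.
  by rewrite /r /shear_a /shear_b; have [-> -> _] := period n.
have Zr (j : 'I_N) p : iota (zeta (z j) (p - q j)) = r j p * iota (Z1 j).
  have [_ e0 e2] := zeta_shear j; rewrite /r -rmorphM; congr (iota _).
  by move: p; apply: forall_Z3; rewrite /= ?mul1r.
rewrite (det_twisted_gluing le lt N_gt0 t_neq0 Zr).
have [s [k ->]] := det_incidence_mx N_gt0 has_R has_L t_neq0 r1 r_per.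
have inputE n : tet_input r n = map_mx iota (shear_input h v n).
  apply/colP; apply: forall_ord3; rewrite !mxE /= ?rmorphMn ?rmorph1; exact: erefl.
have -> : closed_prod (fun n => lw n) (tet_input r) N =
          closed_prod (fun n => lw n) (fun n => map_mx iota (shear_input h v n)) N.
  by elim: N => [|n IH]; rewrite ?[closed_prod _ _ n.+1]/= ?IH ?inputE.
have [hN vN dN] := period 0; rewrite add0n in hN vN dN.
rewrite (det_closed_prod iota step markov h_neq0 v_neq0 d_neq0 hv_neq0 _ _ hN vN dN
  t_neq0 (erefl (jac_prod w rho N))); last first.
- exact: (@lw_periodic w 0).
- by move=> n; rewrite -addn1 PoszD addrK.
have [e ->] := zeta_flattening.
have nZ : iota (\prod_j Z1 j) != 0.
  by rewrite fmorph_eq0; apply/prodf_neq0 => j _; have [] := zeta_shear j.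
exists (s (+) e), ((\sum_i le i - \sum_j lt j) + k + 3).
rewrite rmorphM rmorphXn rmorphN1 signr_addb !expfzDr // -exprnP invfM invr_sign.
by move: (iota _) (\det _) nZ => Z D nZ; field.
Qed.

End Determinant.

End Core.

Lemma letter_at_first w : letter_at w 1 = head LetR w.
Proof. by rewrite /letter_at subrr mod0z nth0. Qed.

Lemma letter_at_last w : (0 < size w)%N -> letter_at w 0 = last LetR w.
Proof.
move=> w0; rewrite /letter_at sub0r -nth_last; congr nth.
rewrite (_ : -1 = (size w)%:Z - 1 + -1 * (size w)%:Z); last by lia.
by rewrite addrC modzMDl modz_small; lia.
Qed.

Lemma word_ofP st : st <> [::] -> (forall p, p \in st -> (0 < p.1)%N /\ (0 < p.2)%N) ->
  [/\ (1 < size (word_of st))%N, letter_at (word_of st) 0 = LetL &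
      letter_at (word_of st) 1 = LetR].
Proof.
move=> st0 pos.
have hd : exists w', word_of st = LetR :: w'.
  case: st st0 pos => [//|[[|k] m] st] _ /(_ _ (mem_head _ _)) [] // _ _.
  by eexists; rewrite /word_of /=.
have tl : last LetR (word_of st) = LetL.
  case/lastP: st st0 pos {hd} => [//|st [k m]] _ pos.
  have [] := pos (k, m); first by rewrite mem_rcons mem_head.
  case: m {pos} => // m _ _.
  by rewrite /word_of map_rcons flatten_rcons !last_cat /=; elim: m.
have [w' ew] := hd; rewrite letter_at_first letter_at_last ?ew // -?ew tl.
by move: tl; rewrite ew; case: w' {ew}.
Qed.

Theorem theorem1p3 (R : realType)
    (st : seq (nat * nat)) (neg : bool)
    (st_nonempty : st <> [::])
    (st_pos : forall p, p \in st -> (0 < p.1)%N /\ (0 < p.2)%N)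
    (q : 'I_(size (word_of st)) -> 'Z_3)
    (le lt : 'I_(size (word_of st)) -> int)
    (z : 'I_(size (word_of st)) -> R[i])
    (f : 'Z_3 -> 'I_(size (word_of st)) -> int)
    (rho : 'I_3 -> 'M[R[i]]_2) :
  is_geometric_lift (word_of st) neg rho ->
  is_solution neg q le lt z ->
  is_holonomy neg q z rho ->
  is_flattening neg q le lt f ->
  (exists tau, is_twisted_alexander (word_of st) neg rho tau) /\
  (forall tau, is_twisted_alexander (word_of st) neg rho tau ->
     eq_up_to_units (tauCS q le lt z f) tau).
Proof.
have [N_gt1 letter0 letter1] := word_ofP st_nonempty st_pos.
(* From here on the word enters through its length and its two letters around level 0. *)
move: (word_of st) q le lt z f N_gt1 letter0 letter1 => w q le lt z f N_gt1 letter0 letter1.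
move=> [det_rho [rel_a rel_b] faithful _] [z_nondeg _ complete].
move=> [x [x_neq0 fix_l fix_m z_cross]] [f_sum f_edge _].
have two_neq0 : 2 != 0 :> R[i] by rewrite pnatr_eq0.
have irred := trace_longitude two_neq0 N_gt1 letter0 letter1 det_rho rel_a rel_b
  faithful z_nondeg complete x_neq0 fix_l fix_m z_cross.
have alexP tau := twisted_alexanderP two_neq0 det_rho rel_a rel_b irred tau.
split; first by eexists; apply/alexP; exact: erefl.
move=> tau /alexP ->.
exact: (det_gluing two_neq0 N_gt1 letter0 letter1 det_rho rel_a rel_b faithful z_nondeg
  complete x_neq0 fix_l fix_m z_cross f_sum f_edge (@cst R[i]) (tvar_neq0 R[i])).
Qed.
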